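(* Let $d\ge1$, $T \in (0,\infty)$, $\alpha \in (0,1)$, and $p, p_0\in (1,\infty)$ be such that $p_0 > p$ and $$1 - \frac{d+2/\alpha}{p} \geq - \frac{d+2/\alpha}{p_0}.\qquad( * )$$ Then, for $u \in \mathcal{H}_{p,0}^{\alpha,1}(\mathbb{R}^d_T)$, we have $$\|u\|_{L_{p_0}(\mathbb{R}^d_T)} \leq N \|u\|_{\mathcal{H}_p^{\alpha,1}(\mathbb{R}^d_T)},$$ where $N = N(d,\alpha,p,p_0)$. More precisely, if $g = (g_1,\ldots,g_d), f \in L_p(\mathbb{R}^d_T)$ are such that $$\int_0^T \int_{\mathbb{R}^d} I_0^{1-\alpha} u\, \varphi_t \, dx \, d s = \int_0^T \int_{\mathbb{R}^d} g_i D_i \varphi \, dx \, d s - \int_0^T \int_{\mathbb{R}^d} f \varphi \, dx \, d s$$ for any $\varphi \in C_0^\infty([0,T) \times \mathbb{R}^d)$, then $$\|u\|_{L_{p_0}(\mathbb{R}^d_T)} \leq N \varepsilon^{\frac{d + 2/\alpha}{p_0} - \frac{d + 2/\alpha}{p}} \|u\|_{L_p(\mathbb{R}^d_T)} + N \varepsilon^{2+ \frac{d+2/\alpha}{p_0} - \frac{d+2/\alpha}{p}} \|f\|_{L_p(\mathbb{R}^d_T)} + N \varepsilon^{1+ \frac{d+2/\alpha}{p_0} - \frac{d+2/\alpha}{p}} \left(\|Du\|_{L_p(\mathbb{R}^d_T)} + \|g\|_{L_p(\mathbb{R}^d_T)} \right)$$ for any $\varepsilon > 0$, where $N = N(d,\alpha,p,p_0)$.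 In particular, if equality holds in $( * )$, we have $$\|u\|_{L_{p_0}(\mathbb{R}^d_T)} \leq N \|u\|^{1/2}_{L_p(\mathbb{R}^d_T)}\|f\|_{L_p(\mathbb{R}^d_T)}^{1/2} + N \left(\|Du\|_{L_p(\mathbb{R}^d_T)} + \|g\|_{L_p(\mathbb{R}^d_T)} \right).$$
   Context: $\mathbb{R}^d_T=(0,T)\times\mathbb{R}^d$; $Du$ is the spatial gradient; summation over repeated indices is understood. Fractional integral: $I_0^{1-\alpha}u(t,x)=\frac1{\Gamma(1-\alpha)}\int_0^t(t-s)^{-\alpha}u(s,x)\,ds$; $D_t^\alpha u=\partial_tI_0^{1-\alpha}u$. Let $\Omega\subset\mathbb{R}^d$ be open and $\Omega_T=(0,T)\times\Omega$. Space $\mathbb{H}_p^{-1}(\Omega_T)$: distributions $w=D_ig_i+f$ with $g_i,f\in L_p(\Omega_T)$, with norm $\inf\{\sum_i\|g_i\|_{L_p}+\|f\|_{L_p}: w=D_ig_i+f\}$. Space $\mathcal{H}_p^{\alpha,1}(\Omega_T)$: functions $u\in L_p(\Omega_T)$ with $D_xu\in L_p(\Omega_T)$ for which there exist $g_i,f\in L_p(\Omega_T)$ such that $\int_0^T\int_\Omega I_0^{1-\alpha}u\,\partial_t\varphi\,dx\,dt=\int_0^T\int_\Omega (g_iD_i\varphi-f\varphi)\,dx\,dt$ for all $\varphi\in C_0^\infty([0,T)\times\Omega)$ (i.e. $D_t^\alpha u=D_ig_i+f\in\mathbb{H}_p^{-1}$); norm $\|u\|_{L_p}+\|D_xu\|_{L_p}+\|D_t^\alpha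 u\|_{\mathbb{H}_p^{-1}}$. Space $\mathcal{H}_{p,0}^{\alpha,1}(\Omega_T)$: those $u\in\mathcal{H}_p^{\alpha,1}(\Omega_T)$ that are limits in this norm of $u_n\in C^\infty([0,T]\times\Omega)$ vanishing for large $|x|$ with $u_n(0,x)=0$. *)

(* Defs.v *)
From HB Require Import structures.
From mathcomp Require Import all_boot all_order all_algebra.
From mathcomp Require Import all_classical all_reals all_analysis.

Set Implicit Arguments.
Unset Strict Implicit.
Unset Printing Implicit Defensive.

Import Order.TTheory GRing.Theory Num.Theory.
Import numFieldNormedType.Exports.

Local Open Scope classical_set_scope.
Local Open Scope ring_scope.

(* Matrices carry the sigma-algebra generated by their entries; for row
   vectors over a realType this is the Borel sigma-algebra. *)

Definition measure_mx_display : measure_display -> measure_display.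
Proof. exact. Qed.

Section measurable_matrix.
Context {d} {T : sigmaRingType d} {m n : nat}.

Definition mx_cylinders : set (set 'M[T]_(m, n)) :=
  [set A | exists i j (B : set T),
     measurable B /\ A = (fun M : 'M[T]_(m, n) => M i j) @^-1` B].

Let mx_set0 : <<s mx_cylinders >> set0.
Proof. exact: sigma_algebra0. Qed.

Let mx_setC A : <<s mx_cylinders >> A -> <<s mx_cylinders >> (~` A).
Proof. exact: sigma_algebraC. Qed.

Let mx_bigcup (F : _^nat) : (forall i, <<s mx_cylinders >> (F i)) ->
  <<s mx_cylinders >> (\bigcup_i (F i)).
Proof. exact: sigma_algebra_bigcup. Qed.

HB.instance Definition _ := @isMeasurable.Build (measure_mx_display d)
  'M[T]_(m, n) <<s mx_cylinders >> mx_set0 mx_setC mx_bigcup.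

End measurable_matrix.

Section measurable_matrix_lemmas.
Context d (T : sigmaRingType d) (m n : nat).

Lemma measurable_mx_entry i j :
  measurable_fun [set: 'M[T]_(m, n)] (fun M : 'M[T]_(m, n) => M i j).
Proof.
move=> _ Y mY; rewrite setTI; apply: sub_sigma_algebra.
by exists i, j, Y.
Qed.

Lemma measurable_fun_mxP d' (U : measurableType d') (f : U -> 'M[T]_(m, n)) :
  (forall i j, measurable_fun [set: U] (fun x => f x i j)) ->
  measurable_fun [set: U] f.
Proof.
move=> mf; apply: (@measurability _ _ _ _ _ _ mx_cylinders) => //.
move=> _ [_ [i [j [B [mB ->]]]] <-].
exact: (mf i j).
Qed.

End measurable_matrix_lemmas.

Section lebesgue_measure_rV.
Context {R : realType}.

Definition cons_rV n (z : R * 'rV[R]_n) : 'rV[R]_n.+1 :=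
  \row_j (if unlift ord0 j is Some k then z.2 ord0 k else z.1).

Definition uncons_rV n (v : 'rV[R]_n.+1) : R * 'rV[R]_n :=
  (v ord0 ord0, \row_j v ord0 (lift ord0 j)).

Lemma cons_rVK n : cancel (@cons_rV n) (@uncons_rV n).
Proof.
move=> [t x]; congr pair; first by rewrite mxE unlift_none.
by apply/rowP => j; rewrite !mxE liftK.
Qed.

Lemma measurable_cons_rV n : measurable_fun [set: R * 'rV[R]_n] (@cons_rV n).
Proof.
apply: measurable_fun_mxP => i j.
under eq_fun do rewrite mxE.
case: unliftP => [k _|_]; last exact: measurable_fst.
exact: measurableT_comp (measurable_mx_entry ord0 k) measurable_snd.
Qed.

Lemma measurable_uncons_rV n :
  measurable_fun [set: 'rV[R]_n.+1] (@uncons_rV n).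
Proof.
apply/measurable_fun_pairP; split; first exact: measurable_mx_entry.
apply: measurable_fun_mxP => i j /=.
under eq_fun do rewrite mxE.
exact: measurable_mx_entry.
Qed.

Section succ.
Variables (n : nat) (mu : {sigma_finite_measure set 'rV[R]_n -> \bar R}).

Definition lebesgue_rV_succ : set 'rV[R]_n.+1 -> \bar R :=
  pushforward (lebesgue_measure \x mu)%E (@cons_rV n).

Let mf : measurable_fun [set: measurableTypeR R * 'rV[R]_n] (@cons_rV n) :=
  @measurable_cons_rV n.

Let succ0 : lebesgue_rV_succ set0 = 0%E.
Proof. by rewrite /lebesgue_rV_succ /pushforward preimage_set0 measure0. Qed.

Let succ_ge0 A : (0 <= lebesgue_rV_succ A)%E.
Proof. exact: measure_ge0. Qed.

Let succ_sigma_additive : semi_sigma_additive lebesgue_rV_succ.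
Proof.
exact: (@measure_semi_sigma_additive _ _ _
  (measure_function_pushforward__canonical__measure_function_Measure
    (lebesgue_measure \x mu)%E mf)).
Qed.

HB.instance Definition _ := isMeasure.Build _ _ _ lebesgue_rV_succ
  succ0 succ_ge0 succ_sigma_additive.

Let succ_sigma_finite : sigma_finite setT lebesgue_rV_succ.
Proof.
have /sigma_finiteP[F [FT ndF Foo]] :=
  sigma_finiteT (@lebesgue_measure R : {sigma_finite_measure set _ -> \bar R}).
have /sigma_finiteP[G [GT ndG Goo]] := sigma_finiteT mu.
exists (fun k => @uncons_rV n @^-1` (F k `*` G k)).
  apply/esym; rewrite -subTset => v _ /=.
  have : setT (uncons_rV v).1 by []; rewrite FT => -[i _ Fi].
  have : setT (uncons_rV v).2 by []; rewrite GT => -[j _ Gj].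
  exists (maxn i j) => //; split.
    by move: Fi; exact/subsetPset/ndF/leq_maxl.
  by move: Gj; exact/subsetPset/ndG/leq_maxr.
move=> k; have [mF Fk] := Foo k; have [mG Gk] := Goo k; split.
  rewrite -[X in measurable X]setTI; apply: measurable_uncons_rV => //.
  exact: measurableX.
rewrite /lebesgue_rV_succ /pushforward -comp_preimage.
rewrite (_ : _ \o _ = id); last by apply/funext => z; exact: cons_rVK.
by rewrite preimage_id product_measure1E// lte_mul_pinfty// ge0_fin_numE.
Qed.

HB.instance Definition _ := Measure_isSigmaFinite.Build _ _ _
  lebesgue_rV_succ succ_sigma_finite.

End succ.

Fixpoint lebesgue_rV n : {sigma_finite_measure set 'rV[R]_n -> \bar R} :=
  match n with
  | 0%N => [the {sigma_finite_measure set 'rV[R]_0 -> \bar R} of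
      @dirac _ 'rV[R]_0 (0 : 'rV[R]_0) R]
  | k.+1 => [the {sigma_finite_measure set 'rV[R]_k.+1 -> \bar R} of
      lebesgue_rV_succ (lebesgue_rV k)]
  end.

Lemma lebesgue_rV_box n (A : 'I_n -> set R) :
  (forall i, measurable (A i)) ->
  lebesgue_rV n [set v | forall i, A i (v ord0 i)] =
  (\prod_(i < n) lebesgue_measure (A i))%E.
Proof.
elim: n A => [|n IH] A mA.
  rewrite big_ord0 /= diracE mem_set//=; by case.
rewrite big_ord_recl -IH; last by move=> i; exact: mA.
rewrite /= /lebesgue_rV_succ /pushforward.
rewrite -product_measure1E.
- congr (_ \x _)%E; apply/seteqP; split => [[t x]/= h|[t x]/= [h1 h2] i].
    split; first by have := h ord0; rewrite mxE unlift_none.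
    by move=> i; have := h (lift ord0 i); rewrite mxE liftK.
  by rewrite mxE; case: unliftP => [j ->|->].
- exact: mA.
- rewrite [X in measurable X](_ : _ = \bigcap_(i in [set: 'I_n])
    ((fun v : 'rV[R]_n => v ord0 i) @^-1` A (lift ord0 i))); last first.
    by apply/seteqP; split => v /= h i; [move=> _|]; exact: h.
  apply: fin_bigcap_measurable => // i _.
  rewrite -[X in measurable X]setTI.
  exact: (measurable_mx_entry ord0 i).
Qed.

End lebesgue_measure_rV.

Section calculus.
Context {R : realType} {d : nat}.
Implicit Types (z v : R * 'rV[R]_d) (f phi : R * 'rV[R]_d -> R).

Definition D_t f : R * 'rV[R]_d -> R := 'D_(1, 0) f.

Definition D_x (i : 'I_d) f : R * 'rV[R]_d -> R := 'D_(0, delta_mx ord0 i) f.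

Fixpoint iter_derive (s : seq (R * 'rV[R]_d)) f : R * 'rV[R]_d -> R :=
  if s is v :: s' then 'D_v (iter_derive s' f) else f.

Definition smooth_open (U : set (R * 'rV[R]_d)) f :=
  forall s z, U z ->
    {for z, continuous (iter_derive s f)} /\
    forall v, derivable (iter_derive s f) z v.

(* C^infty(A) for a set A that need not be open, e.g. [0, T] x Omega:
   functions that extend smoothly to a neighbourhood of A. *)
Definition smooth_on (A : set (R * 'rV[R]_d)) f :=
  exists U g, [/\ open U, A `<=` U, smooth_open U g &
    forall z, A z -> f z = g z].

(* C_0^infty(A): the support is a compact subset of A, so that elements of
   C_0^infty([0, T) x Omega) need not vanish at t = 0. *)
Definition Cc_smooth (A : set (R * 'rV[R]_d)) f :=
  smooth_on A f /\
  exists K, [/\ compact K, K `<=` A & forall z, A z -> ~ K z -> f z = 0].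

Definition enorm (x : 'rV[R]_d) : R := Num.sqrt (\sum_i x ord0 i ^+ 2).

End calculus.

Definition Gamma {R : realType} (x : R) : R :=
  \int[lebesgue_measure]_(t in `]0, +oo[%classic) (t `^ (x - 1) * expR (- t)).

Section spaces.
Context {R : realType} {d : nat}.
Implicit Types (p al T : R) (Om : set 'rV[R]_d) (D : set (R * 'rV[R]_d)).
Implicit Types (u f phi : R * 'rV[R]_d -> R) (g : R * 'rV[R]_d -> 'rV[R]_d).

Definition lebesgue_tx :
    {measure set (measurableTypeR R * 'rV[R]_d)%type -> \bar R} :=
  [the {measure set (measurableTypeR R * 'rV[R]_d)%type -> \bar R} of
    (lebesgue_measure \x lebesgue_rV d)%E].

Definition cyl T Om : set (R * 'rV[R]_d) := `]0, T[%classic `*` Om.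

Definition Lpnorm p D f : \bar R := 'N[lebesgue_tx]_(p%:E)[EFin \o (f \_ D)].

Definition in_Lp p D f : Prop := (f \_ D) \in Lfun lebesgue_tx p%:E.

Definition vLpnorm p D g : \bar R := Lpnorm p D (fun z => enorm (g z)).

Definition in_vLp p D g : Prop := forall i, in_Lp p D (fun z => g z ord0 i).

(* I_0^{1-al} u; the order of integration is 1 - al, not al *)
Definition frac_int al u : R * 'rV[R]_d -> R := fun z =>
  (Gamma (1 - al))^-1 *
  \int[lebesgue_measure]_(s in `]0, z.1[%classic)
    ((z.1 - s) `^ (- al) * u (s, z.2)).

Definition weak_gradient T Om u g :=
  forall i phi, Cc_smooth (cyl T Om) phi ->
    \int[lebesgue_tx]_(z in cyl T Om) (u z * D_x i phi z) =
    - \int[lebesgue_tx]_(z in cyl T Om) (g z ord0 i * phi z).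

(* A choice among the weak gradients of u in L_p, which agree a.e. *)
Definition wgrad p T Om u : R * 'rV[R]_d -> 'rV[R]_d :=
  xget (fun=> 0) [set g | in_vLp p (cyl T Om) g /\ weak_gradient T Om u g].

(* Distributions are represented by functionals on the test functions. As in
   the definition of H_p^{al,1}, these are taken in C_0^infty([0, T) x Omega);
   since no time derivative of phi occurs in the action of D_i g_i + f, this
   gives the same pairs (g, f) as testing with C_0^infty((0, T) x Omega). *)
Definition Dt_frac al T Om u : (R * 'rV[R]_d -> R) -> R := fun phi =>
  - \int[lebesgue_tx]_(z in cyl T Om) (frac_int al u z * D_t phi z).

Definition Hm1_rep p T Om (w : (R * 'rV[R]_d -> R) -> R) g f :=
  [/\ in_vLp p (cyl T Om) g, in_Lp p (cyl T Om) f &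
    forall phi, Cc_smooth (`[0, T[%classic `*` Om) phi -> w phi =
      \int[lebesgue_tx]_(z in cyl T Om)
        (f z * phi z - \sum_(i < d) g z ord0 i * D_x i phi z)].

Definition Hm1_norm p T Om (w : (R * 'rV[R]_d -> R) -> R) : \bar R :=
  ereal_inf [set x | exists g f, Hm1_rep p T Om w g f /\
    x = (\sum_(i < d) Lpnorm p (cyl T Om) (fun z => g z ord0 i)
         + Lpnorm p (cyl T Om) f)%E].

Definition H_al1 al p T Om u :=
  [/\ in_Lp p (cyl T Om) u,
      exists g, in_vLp p (cyl T Om) g /\ weak_gradient T Om u g &
      exists g f, Hm1_rep p T Om (Dt_frac al T Om u) g f].

Definition H_al1_norm al p T Om u : \bar R :=
  (Lpnorm p (cyl T Om) u + vLpnorm p (cyl T Om) (wgrad p T Om u)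
   + Hm1_norm p T Om (Dt_frac al T Om u))%E.

Definition H_al1_0 al p T Om u :=
  H_al1 al p T Om u /\
  exists u_ : nat -> (R * 'rV[R]_d -> R),
    [/\ forall n, smooth_on (`[0, T]%classic `*` Om) (u_ n),
        forall n, exists M, forall t x,
          0 <= t <= T -> Om x -> M < enorm x -> u_ n (t, x) = 0,
        forall n x, Om x -> u_ n (0, x) = 0,
        forall n, H_al1 al p T Om (u_ n) &
        H_al1_norm al p T Om (u_ n \- u) @[n --> \oo] --> 0%E].

End spaces.

(* Main.v *)
(** Average u over the backward parabolic boxes of time length rho^(2/alpha) and
    side rho below (t, x).  Testing the equation with products of a smoothed
    (t - s)_+^alpha and a function of x shows that the averages at scales rho and
    rho/2 differ by at most averages, at the same scale, of
    rho (|Du| + |g|) + rho^2 |f|.  Sum over rho = eps 2^-k and put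
    dl = 1/p - 1/p0: since 1 - dl (d + 2/alpha) >= 0, the averaging kernels of all
    scales add up to at most a power of eps times the kernel
    prod_a (z_a)_+^(dl - 1), a running over the coordinates t, x_1, ..., x_d.
    Hence the averages converge wherever the resulting potential W is finite, the
    limit is u almost everywhere because it has the right integrals over boxes,
    and |u| <= W.  The kernel is a tensor product of one-dimensional Riesz kernels,
    so the Hardy-Littlewood-Sobolev inequality for it follows from the
    one-dimensional one by Tonelli's theorem, and duality bounds u in L_p0. *)

From HB Require Import structures.
Require Import Defs.
From mathcomp Require Import all_boot all_order all_algebra.
From mathcomp Require Import all_classical all_reals all_analysis.
From mathcomp Require Import measurable_realfun.
From mathcomp Require Import ring lra.

Set Implicit Arguments.
Unset Strict Implicit.
Unset Printing Implicit Defensive.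

Import Order.TTheory GRing.Theory Num.Theory.
Import numFieldNormedType.Exports.

Local Open Scope classical_set_scope.
Local Open Scope ring_scope.

(** * The one-dimensional Hardy-Littlewood-Sobolev inequality *)

(** The fractional equation is inverted by the Beta identity: the integral over s of (s - r)_+^(-al)
    (t - s)_+^(al - 1) has the same value for every r < t. Paired with the derivative of (t -
    s)_+^al, the memory integral of u thus collapses to a constant times the integral of u over s <
    t, and differences of two such truncations are averages in time. On the right-hand side the
    memory survives: the time weight of a single average has a non-integrable tail al z^(al - 1), to
    leading order the same at every scale. Only the difference of two scales gains a factor tau / z,
    so scales are compared and u is rebuilt as a telescoping series. What remains is tau^(al - 1)
    min(1, tau / z), and tau^al = rho^2 turns tau^(al - 1) into rho^2 times the normalisation 1 /
    tau of an average. With tau scaled to 1, this majorant lies below z^(th - 1) for every th in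
    [0, 1]; th slightly below and slightly above dl make the scales sum geometrically, even in the
    case of equality, where the powers of rho in front of Du and g give no decay. All averages look
    backwards in time, so nothing beyond T is tested and N is independent of T. *)

Section power_integrals.
Context {R : realType}.
Notation mu := (@lebesgue_measure R).

(** Uniqueness of Lebesgue measure: its pushforward under x -> a x + b, scaled by |a|, gives every
    interval ]c, d] its length. For a < 0 the preimage is half-open on the other side, hence the two
    cases. *)
Lemma ge0_integral_affine (a b : R) (f : R -> \bar R) : a != 0 ->
  measurable_fun [set: measurableTypeR R] f -> (forall x, 0 <= f x)%E ->
  (\int[mu]_x f (a * x + b)%R = (`|a|^-1)%:E * \int[mu]_x f x)%E.
Proof.
move=> a0 mf f0; pose phi (x : measurableTypeR R) : measurableTypeR R := a * x + b.
have mphi : measurable_fun [set: measurableTypeR R] phi.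
  by apply: measurable_funD => //; exact: measurable_funM.
pose m := measure_function_pushforward__canonical__measure_function_Measure
  (mu : {measure set (measurableTypeR R) -> \bar R}) mphi.
have na : 0 <= `|a| by [].
pose ms := mscale (NngNum na) m.
have mE A : measurable A -> mu A = ms A.
  apply: (lebesgue_measure_unique (mu := ms)) => X [[c d] _ <-] /=.
  rewrite /ms /mscale /= /pushforward.
  have [cd|dc] := ltP c d; last first.
    have e0 : `]c, d]%classic = set0 :> set R.
      by rewrite set_itv_ge// bnd_simp -leNgt.
    by rewrite e0 preimage_set0 !measure0 mule0.
  have [a_gt0|a_lt0|a00] := ltgtP a 0; last by rewrite a00 eqxx in a0.
    have -> : phi @^-1` `]c, d] = `[(d - b) / a, (c - b) / a[%classic.
      apply/seteqP; split => x; rewrite /= !in_itv/= /phi.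
        by rewrite ler_ndivrMr// ltr_ndivlMr// mulrC; lra.
      by rewrite ler_ndivrMr// ltr_ndivlMr// mulrC; lra.
    rewrite !lebesgue_measure_itv/= !lte_fin cd.
    rewrite ltr_ndivrMr// divfK// ltrD2r cd -EFinD -EFinM; congr EFin.
    by rewrite ltr0_norm//; field.
  have -> : phi @^-1` `]c, d] = `](c - b) / a, (d - b) / a]%classic.
    apply/seteqP; split => x; rewrite /= !in_itv/= /phi.
      by rewrite ltr_pdivrMr// ler_pdivlMr// mulrC; lra.
    by rewrite ltr_pdivrMr// ler_pdivlMr// mulrC; lra.
  rewrite !lebesgue_measure_itv/= !lte_fin cd.
  rewrite ltr_pdivrMr// divfK// ltrD2r cd -EFinD -EFinM; congr EFin.
  by rewrite gtr0_norm//; field.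
have -> : (\int[mu]_x f x = `|a|%:E * \int[m]_x f x)%E.
  transitivity (\int[ms]_x f x)%E.
    by apply: eq_measure_integral => A mA _; exact: mE.
  by rewrite /ms ge0_integral_mscale.
rewrite muleA -EFinM mulVf ?normr_eq0// mul1e.
by rewrite (ge0_integral_pushforward mphi) ?preimage_setT.
Qed.

Lemma powRD_gt0 (a r s : R) : 0 < a -> a `^ (r + s) = a `^ r * a `^ s.
Proof. by move=> a0; rewrite powRD// (gt_eqF a0) implybT. Qed.

Lemma continuous_powR (r x : R) : 0 < x -> {for x, continuous (fun y : R => y `^ r)}.
Proof.
move=> x0; apply: differentiable_continuous; apply/derivable1_diffP.
by apply: ex_derive; exact: is_derive1_powR.
Qed.

Lemma integral_powR_itv (r c d : R) : r != -1 -> 0 < c -> c < d ->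
  (\int[mu]_(x in `[c, d]) (x `^ r)%:E =
   ((d `^ (r + 1) - c `^ (r + 1)) / (r + 1))%:E)%E.
Proof.
move=> r1 c0 cd.
have r10 : r + 1 != 0 by rewrite addr_eq0.
have h (x : R) : 0 < x -> is_derive x (1 : R) (fun y : R => (r + 1)^-1 * y `^ (r + 1)) (x `^ r).
  move=> x0; have -> : x `^ r = (r + 1)^-1 * ((r + 1) * x `^ (r + 1 - 1)).
    by rewrite mulKf// addrK.
  by apply: is_deriveZ; exact: is_derive1_powR.
have hc (x : R) : 0 < x -> {for x, continuous (fun y : R => (r + 1)^-1 * y `^ (r + 1))}.
  by move=> /h [dx _]; apply: differentiable_continuous; exact/derivable1_diffP.
have d0 : 0 < d by exact: lt_trans cd.
rewrite (@continuous_FTC2 R _ (fun y : R => (r + 1)^-1 * y `^ (r + 1)))//.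
- by rewrite -EFinB -mulrBr mulrC.
- apply: continuous_in_subspaceT => x; rewrite inE/= in_itv/= => /andP[cx _].
  by apply: continuous_powR; exact: lt_le_trans cx.
- split.
  + move=> x; rewrite in_itv/= => /andP[cx _].
    by have [] := h x (lt_trans c0 cx).
  + by apply: cvg_at_right_filter; exact: hc.
  + by apply: cvg_at_left_filter; exact: hc.
- move=> x; rewrite in_itv/= => /andP[cx _].
  by rewrite derive1E; have [_ ->] := h x (lt_trans c0 cx).
Qed.

Lemma integral_powR_near (dl r : R) : 0 < dl -> 0 < r ->
  (\int[mu]_(x in `]0%R, r[) (x `^ (dl - 1))%:E <= (r `^ dl / dl)%:E)%E.
Proof.
(* The singularity at 0 is avoided by exhausting ]0, r] by compact intervals, on which the
   fundamental theorem applies; [n.+2] keeps them nondegenerate from n = 0 on. *)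
move=> dl0 r0; pose F n := `[r / n.+2%:R, r]%classic : set (measurableTypeR R).
have ndF : {homo F : n m / (n <= m)%N >-> (n <= m)%O}.
  move=> n m nm; apply/subsetPset => x; rewrite /F/= !in_itv/= => /andP[h ->].
  rewrite andbT (le_trans _ h)// ler_pM2l// lef_pV2 ?posrE ?ltr0n// ler_nat.
  by rewrite !ltnS.
have mF n : measurable (F n) by exact: measurable_itv.
have mp (D : set (measurableTypeR R)) : measurable_fun D (fun x : R => (x `^ (dl - 1))%:E).
  by apply/measurable_EFinP; apply: measurable_funTS; exact: measurable_powR.
apply: (@le_trans _ _ (\int[mu]_(x in \bigcup_n F n) (x `^ (dl - 1))%:E)%E).
  apply: ge0_subset_integral => //=.
  - exact: bigcupT_measurable.
  - by move=> x _; rewrite lee_fin powR_ge0.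
  - move=> x /=; rewrite in_itv/= => /andP[x0 xr].
    have [n hn] : exists n, r / x < n%:R.
      by exists (Num.trunc (r / x)).+1; exact: truncnS_gt.
    exists n => //; rewrite /F/= in_itv/= (ltW xr) andbT ler_pdivrMr ?ltr0n//.
    rewrite mulrC -ler_pdivrMr// (le_trans (ltW hn))// ler_nat.
    by rewrite -addn2 leq_addr.
have := @ge0_nondecreasing_set_cvg_integral _ _ _ F (fun x : R => (x `^ (dl - 1))%:E)
  mu ndF mF (fun n => mp (F n)) (fun n x _ => powR_ge0 _ _).
move=> h; rewrite -(cvg_lim _ h)//.
apply: lime_le; first by apply/cvg_ex; eexists; exact: h.
apply: nearW => n; rewrite /F integral_powR_itv.
- rewrite lee_fin subrK ler_pM2r ?invr_gt0//.
  by rewrite lerBlDr lerDl powR_ge0.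
- by rewrite -subr_eq0 opprK subrK gt_eqF.
- by rewrite divr_gt0.
- by rewrite ltr_pdivrMr ?ltr0n// ltr_pMr// ltr1n.
Qed.

Lemma integral_powR_far (e r : R) : 1 < e -> 0 < r ->
  (\int[mu]_(x in `[r, +oo[) (x `^ (- e))%:E <= (r `^ (1 - e) / (e - 1))%:E)%E.
Proof.
move=> e1 r0; rewrite itv_bndy_bigcup_BRight.
pose F n := `[r, r + n%:R]%classic : set (measurableTypeR R).
have ndF : {homo F : n m / (n <= m)%N >-> (n <= m)%O}.
  move=> n m nm; apply/subsetPset => x; rewrite /F/= !in_itv/= => /andP[-> h].
  by rewrite (le_trans h)// lerD2l ler_nat.
have mF n : measurable (F n) by exact: measurable_itv.
have mp (D : set (measurableTypeR R)) : measurable_fun D (fun x : R => (x `^ (- e))%:E).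
  by apply/measurable_EFinP; apply: measurable_funTS; exact: measurable_powR.
have := @ge0_nondecreasing_set_cvg_integral _ _ _ F (fun x : R => (x `^ (- e))%:E)
  mu ndF mF (fun n => mp (F n)) (fun n x _ => powR_ge0 _ _).
move=> h; rewrite -(cvg_lim _ h)//.
apply: lime_le; first by apply/cvg_ex; eexists; exact: h.
apply: nearW => -[|n].
  rewrite /F addr0 set_itv1 integral_set1 lee_fin divr_ge0 ?powR_ge0//.
  by rewrite subr_ge0 ltW.
rewrite /F integral_powR_itv//.
- rewrite lee_fin -[X in X <= _]mulrNN -invrN opprB opprD opprK.
  rewrite (_ : - e + 1 = 1 - e)%R 1?addrC// (_ : e + - 1 = e - 1)%R//.
  rewrite ler_pM2r ?invr_gt0 ?subr_gt0//.
  by have := powR_ge0 (r + n.+1%:R) (1 - e); lra.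
- by rewrite -subr_eq0 opprK addrC subr_eq0 lt_eqF.
- by rewrite ltrDl ltr0n.
Qed.

End power_integrals.

Section riesz_kernel.
Context {R : realType}.
Notation mu := (@lebesgue_measure R).

(** The Riemann-Liouville kernel without its factor 1 / Gamma(dl). Orders of at least 1 occur too:
    [riesz (al + 1)] is z_+^al and [riesz 1] the Heaviside function, while [riesz (1 - al)] is the
    kernel of [frac_int]. *)
Definition riesz (dl z : R) : R := if 0 < z then z `^ (dl - 1) else 0.

Lemma riesz_ge0 dl z : 0 <= riesz dl z.
Proof. by rewrite /riesz; case: ifP => // _; exact: powR_ge0. Qed.

Lemma measurable_riesz dl : measurable_fun [set: R] (riesz dl).
Proof.
apply: measurable_fun_if => //=.
- exact: measurable_fun_ltr.
- by apply: measurable_funTS; exact: measurable_powR.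
Qed.

Variables p q dl : R.
Hypotheses (p1 : 1 < p) (pq : p < q) (dlE : dl = p^-1 - q^-1).

Let p0 : 0 < p. Proof. exact: lt_trans p1. Qed.
Let q0 : 0 < q. Proof. exact: lt_trans pq. Qed.
Let q1 : 1 < q. Proof. exact: lt_trans pq. Qed.
Let ip1 : p^-1 < 1. Proof. by rewrite invf_lt1. Qed.
Let iq1 : q^-1 < 1. Proof. by rewrite invf_lt1. Qed.
Let iq0 : 0 < q^-1. Proof. by rewrite invr_gt0. Qed.
Let dl0 : 0 < dl. Proof. by rewrite dlE subr_gt0 ltf_pV2. Qed.
Let s := (1 - q^-1)^-1.
Let s0 : 0 < s. Proof. by rewrite invr_gt0 subr_gt0. Qed.
Let e := (1 - dl) * q.
Let eE : e = q * (1 - p^-1) + 1.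
Proof. by rewrite /e dlE; field; rewrite !gt_eqF. Qed.
Let e1 : 1 < e.
Proof. by rewrite eE ltrDr mulr_gt0// subr_gt0. Qed.

(** Here a stands for the value of F at a point, and a^(-p) is the radius at which the kernel is
    split. With this radius the near and the far part both have integral at most a constant times
    a^p, so that integrating over the point produces the integral of F^p. *)
Definition hls_near (a z : R) : R :=
  if (0 < z) && (z < a `^ (- p)) then a `^ (p + p * dl) * z `^ (dl - 1) else 0.

Definition hls_far (a z : R) : R :=
  if a `^ (- p) <= z then a `^ (p - (e - 1) * p) * z `^ (- e) else 0.

(** Near the origin g is replaced by its cap a^(p/s), and 1 + p/s = p + p dl. Far away Young's
    inequality with exponents q and s separates kernel and g; the q-th power of the kernel is
    z^(-e), integrable at infinity because e > 1. *)
Lemma hls_split (a g z : R) : 0 < a -> 0 <= g -> g `^ s <= a `^ p ->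
  a * (riesz dl z * g) <= hls_near a z + (a `^ p * g `^ s + hls_far a z).
Proof.
move=> a0 g0 gs.
have far0 : 0 <= hls_far a z.
  by rewrite /hls_far; case: ifP => // _; rewrite mulr_ge0// powR_ge0.
have near0 : 0 <= hls_near a z.
  by rewrite /hls_near; case: ifP => // _; rewrite mulr_ge0// powR_ge0.
have ag0 : 0 <= a `^ p * g `^ s by rewrite mulr_ge0// powR_ge0.
rewrite {1}/riesz; case: ifPn => z0; last first.
  by rewrite mul0r mulr0 !addr_ge0.
have [zr|rz] := ltP z (a `^ (- p)).
  apply: (@le_trans _ _ (hls_near a z)); last by rewrite lerDl addr_ge0.
  rewrite /hls_near z0 zr/= mulrCA [leRHS]mulrC ler_wpM2l ?powR_ge0//.
  have g_le : g <= a `^ (p / s).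
    have -> : g = (g `^ s) `^ s^-1.
      by rewrite -powRrM divff ?gt_eqF// powRr1.
    rewrite powRrM ge0_ler_powR// ?nnegrE ?powR_ge0//.
    by rewrite invr_ge0 ltW.
  rewrite (_ : p + p * dl = 1 + p / s); last first.
    by rewrite /s invrK dlE; field; rewrite !gt_eqF.
  rewrite powRD_gt0//.
  by rewrite powRr1 ?(ltW a0)// ler_wpM2l// ltW.
apply: (@le_trans _ _ (a `^ p * g `^ s + hls_far a z)); last by rewrite lerDr.
rewrite /hls_far rz.
set k := z `^ (dl - 1).
have kE : k `^ q = z `^ (- e).
  by rewrite /k -powRrM; congr (_ `^ _); rewrite /e; ring.
(* The weight in Young's inequality: a l^s = a^p gives the g-term its coefficient, and a l^(-q) is
   then the coefficient in [hls_far]. *)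
pose l := a `^ ((p - 1) / s).
have l0 : 0 < l by rewrite powR_gt0.
have young : k * g <= l `^ s * g `^ s + l `^ (- q) * k `^ q.
  have h : (k / l) * (l * g) <= (k / l) `^ q / q + (l * g) `^ s / s.
    apply: conjugate_powR => //.
    - by rewrite divr_ge0 ?powR_ge0// ltW.
    - by rewrite mulr_ge0// ltW.
    - by rewrite /s invrK addrC subrK.
  have -> : k * g = (k / l) * (l * g) by field; rewrite gt_eqF.
  apply: (le_trans h); rewrite addrC lerD//.
    rewrite powRM// ?(ltW l0)// ler_pdivrMr// ler_peMr ?mulr_ge0 ?powR_ge0//.
    by rewrite /s invf_ge1 ?subr_gt0// gerBl ltW.
  rewrite powRM ?powR_ge0// ?invr_ge0 ?(ltW l0)//.
  have -> : l^-1 `^ q = l `^ (- q).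
    by rewrite -(powR_inv1 (ltW l0)) -(powRrM l) mulN1r.
  have := powR_ge0 l (- q); have := powR_ge0 k q.
  move: (k `^ q) (l `^ (- q)) => X Y X0 Y0.
  rewrite [Y * X]mulrC ler_pdivrMr//.
  by rewrite ler_peMr ?(ltW q1)// mulr_ge0.
apply: (le_trans (ler_wpM2l (ltW a0) young)).
rewrite mulrDr -kE !mulrA lerD//.
  rewrite ler_wpM2r ?powR_ge0// /l -powRrM divfK ?gt_eqF//.
  rewrite -{1}[a]powRr1 ?(ltW a0)// -powRD_gt0//.
  by rewrite addrC subrK.
rewrite ler_wpM2r ?powR_ge0// /l -powRrM.
rewrite -{1}[a]powRr1 ?(ltW a0)// -powRD_gt0//.
rewrite (_ : 1 + _ = p - (e - 1) * p)// eE /s invrK.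
by field; rewrite !gt_eqF.
Qed.

Notation T1 := (measurableTypeR R).

Let hlsC := dl^-1 + 1 + (e - 1)^-1.

Let hlsCE : dl^-1 + 1 + (q * (1 - p^-1))^-1 = hlsC.
Proof. by rewrite /hlsC eE addrK. Qed.

Let mine_bound (a : R) (g : \bar R) z : 0 < a -> (0 <= g)%E ->
  (a%:E * ((riesz dl z)%:E * mine g (a%:E `^ (p / s))) <=
   (hls_near a z)%:E + ((a `^ p)%:E * g `^ s + (hls_far a z)%:E))%E.
Proof.
move=> a0 g0; rewrite poweR_EFin.
have ap0 : (0 <= (a `^ (p / s))%:E)%E by rewrite lee_fin powR_ge0.
have : (mine g (a `^ (p / s))%:E <= (a `^ (p / s))%:E)%E by rewrite ge_min lexx orbT.
have : (mine g (a `^ (p / s))%:E <= g)%E by rewrite ge_min lexx.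
have : (0 <= mine g (a `^ (p / s))%:E)%E by rewrite le_min g0 ap0.
case: (mine _ _) => [h| |]//; rewrite lee_fin => h0 hg; rewrite lee_fin => ha.
have hp : h `^ s <= a `^ p.
  have -> : a `^ p = (a `^ (p / s)) `^ s by rewrite -powRrM divfK ?gt_eqF.
  by rewrite ge0_ler_powR ?nnegrE ?powR_ge0// ltW.
rewrite -!EFinM; apply: (@le_trans _ _ (hls_near a z + (a `^ p * h `^ s + hls_far a z))%:E).
  by rewrite lee_fin; exact: hls_split.
rewrite !EFinD leeD2l// leeD2r// EFinM lee_wpmul2l ?lee_fin ?powR_ge0//.
rewrite -poweR_EFin; apply: gt0_ler_poweR => //; rewrite ?(ltW s0)// in_itv/= leey andbT//.
Qed.

Let measurable_near a : measurable_fun [set: T1] (hls_near a).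
Proof.
apply: measurable_fun_if => //=.
- by apply: measurable_and; exact: measurable_fun_ltr.
- apply: measurable_funTS; apply: measurable_funM => //; exact: measurable_powR.
Qed.

Let measurable_far a : measurable_fun [set: T1] (hls_far a).
Proof.
apply: measurable_fun_if => //=.
- exact: measurable_fun_ler.
- apply: measurable_funTS; apply: measurable_funM => //; exact: measurable_powR.
Qed.

Let near_ge0 a z : 0 <= hls_near a z.
Proof. by rewrite /hls_near; case: ifP => // _; rewrite mulr_ge0 ?powR_ge0. Qed.

Let far_ge0 a z : 0 <= hls_far a z.
Proof. by rewrite /hls_far; case: ifP => // _; rewrite mulr_ge0 ?powR_ge0. Qed.

Let int_near (a : R) : 0 < a ->
  (\int[mu]_z (hls_near a z)%:E <= (a `^ p / dl)%:E)%E.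
Proof.
move=> a0.
have -> : (\int[mu]_z (hls_near a z)%:E =
    \int[mu]_(z in `]0%R, (a `^ (- p))%R[) ((a `^ (p + p * dl))%:E * (z `^ (dl - 1))%:E))%E.
  rewrite [RHS]integral_mkcond; apply: eq_integral => z _.
  rewrite patchE /hls_near; case: ifPn => h.
    by rewrite mem_set ?EFinM//= in_itv/=.
  by rewrite memNset//= in_itv/=; exact/negP.
rewrite ge0_integralZl_EFin ?powR_ge0//; last 2 first.
- by move=> z _; rewrite lee_fin powR_ge0.
- by apply/measurable_EFinP; apply: measurable_funTS; exact: measurable_powR.
apply: (@le_trans _ _ ((a `^ (p + p * dl))%:E * ((a `^ (- p)) `^ dl / dl)%:E)%E).
  by rewrite lee_wpmul2l ?lee_fin ?powR_ge0// integral_powR_near// powR_gt0.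
rewrite -EFinM lee_fin mulrA ler_pM2r ?invr_gt0//.
by rewrite -powRrM -powRD_gt0// mulNr addrK.
Qed.

Let int_far (a : R) : 0 < a ->
  (\int[mu]_z (hls_far a z)%:E <= (a `^ p / (e - 1))%:E)%E.
Proof.
move=> a0.
have -> : (\int[mu]_z (hls_far a z)%:E =
    \int[mu]_(z in `[(a `^ (- p))%R, +oo[) ((a `^ (p - (e - 1) * p))%:E * (z `^ (- e))%:E))%E.
  rewrite [RHS]integral_mkcond; apply: eq_integral => z _.
  rewrite patchE /hls_far; case: ifPn => h.
    by rewrite mem_set ?EFinM//= in_itv/= h.
  by rewrite memNset//= in_itv/= andbT; exact/negP.
rewrite ge0_integralZl_EFin ?powR_ge0//; last 2 first.
- by move=> z _; rewrite lee_fin powR_ge0.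
- by apply/measurable_EFinP; apply: measurable_funTS; exact: measurable_powR.
apply: (@le_trans _ _ ((a `^ (p - (e - 1) * p))%:E * ((a `^ (- p)) `^ (1 - e) / (e - 1))%:E)%E).
  by rewrite lee_wpmul2l ?lee_fin ?powR_ge0// integral_powR_far// powR_gt0.
rewrite -EFinM lee_fin mulrA ler_pM2r ?invr_gt0 ?subr_gt0//.
rewrite -powRrM -powRD_gt0// (_ : _ + _ = p)//; ring.
Qed.

Let hls_inner (c x a : R) (G : T1 -> \bar R) : c != 0 -> `|c| = 1 -> 0 < a ->
  measurable_fun [set: T1] G -> (forall y, 0 <= G y)%E ->
  (\int[mu]_y (G y `^ s) <= 1)%E ->
  (\int[mu]_y (a%:E * ((riesz dl (c * (x - y)))%:E * mine (G y) (a%:E `^ (p / s))))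
    <= hlsC%:E * (a `^ p)%:E)%E.
Proof.
move=> c0 c1 a0 mG G0 G1.
have maff : measurable_fun [set: T1] (fun y : T1 => - c * y + c * x).
  by apply: measurable_funD => //; exact: measurable_funM.
have zE y : c * (x - y) = - c * y + c * x by ring.
have mGs : measurable_fun [set: T1] (fun y => G y `^ s)%E.
  by apply: (measurableT_comp (measurable_poweR _)).
have mn : measurable_fun [set: T1] (fun y => (hls_near a (c * (x - y)))%:E).
  apply/measurable_EFinP; under eq_fun do rewrite zE.
  exact: (measurableT_comp (measurable_near a)).
have mf : measurable_fun [set: T1] (fun y => (hls_far a (c * (x - y)))%:E).
  apply/measurable_EFinP; under eq_fun do rewrite zE.
  exact: (measurableT_comp (measurable_far a)).
have aff (f : R -> R) : measurable_fun [set: T1] f -> (forall z, 0 <= f z) ->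
    (\int[mu]_y (f (c * (x - y)))%:E = \int[mu]_z (f z)%:E)%E.
  move=> mf' f0; under eq_integral do rewrite zE.
  rewrite (@ge0_integral_affine R (- c) (c * x) (EFin \o f)) ?oppr_eq0//=.
  - by rewrite normrN c1 invr1 mul1e.
  - exact/measurable_EFinP.
apply: (@le_trans _ _ (\int[mu]_y ((hls_near a (c * (x - y)))%:E +
    ((a `^ p)%:E * G y `^ s + (hls_far a (c * (x - y)))%:E)))%E).
  apply: ge0_le_integral => //.
  - move=> y _; rewrite !mule_ge0 ?lee_fin ?riesz_ge0 ?(ltW a0)// le_min G0.
    exact: poweR_ge0.
  - apply: measurable_funeM; apply: emeasurable_funM.
      apply/measurable_EFinP; under eq_fun do rewrite zE.
      exact: (measurableT_comp (measurable_riesz dl)).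
    exact: measurable_mine.
  - by apply: emeasurable_funD => //; apply: emeasurable_funD => //; exact: measurable_funeM.
  - by move=> y _; exact: mine_bound.
have ap := powR_ge0 a p.
rewrite ge0_integralD//; last 3 first.
- by move=> y _; rewrite lee_fin near_ge0.
- by move=> y _; rewrite adde_ge0 ?mule_ge0 ?lee_fin ?far_ge0 ?poweR_ge0.
- by apply: emeasurable_funD => //; exact: measurable_funeM.
rewrite ge0_integralD//; last 3 first.
- by move=> y _; rewrite mule_ge0 ?lee_fin ?poweR_ge0.
- exact: measurable_funeM.
- by move=> y _; rewrite lee_fin far_ge0.
rewrite ge0_integralZl_EFin//; last by move=> y _; exact: poweR_ge0.
rewrite !aff//.
apply: (@le_trans _ _ ((a `^ p / dl)%:E + ((a `^ p)%:E * 1 + (a `^ p / (e - 1))%:E))%E).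
  rewrite leeD ?int_near// leeD ?int_far//.
  by rewrite lee_wpmul2l.
by rewrite mule1 -!EFinD -EFinM lee_fin /hlsC; lra.
Qed.

(** Cutting G off at F(x)^(p/s) loses nothing at the pairs where G^s is at most F^p, and for those
    the integral of F^p controls everything once G is normalised. The sign c = 1 or -1 allows a
    second use with F and G exchanged, which reflects the one-sided kernel. *)
Lemma hls_half (c : R) (F G : T1 -> \bar R) : c != 0 -> `|c| = 1 ->
  measurable_fun [set: T1] F -> (forall y, 0 <= F y)%E ->
  measurable_fun [set: T1] G -> (forall y, 0 <= G y)%E ->
  (\int[mu]_y (G y `^ ((1 - q^-1)^-1)) <= 1)%E ->
  (\int[mu]_x \int[mu]_y (F x * ((riesz dl (c * (x - y)))%:E *
      mine (G y) (F x `^ (p / (1 - q^-1)^-1))))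
    <= (dl^-1 + 1 + (q * (1 - p^-1))^-1)%:E * \int[mu]_x (F x `^ p))%E.
Proof.
rewrite -/s hlsCE => c0 c1 mF F0 mG G0 G1.
have C0 : 0 < hlsC.
  by rewrite /hlsC !addr_gt0 ?invr_gt0 ?subr_gt0.
have mFp : measurable_fun [set: T1] (fun y => F y `^ p)%E.
  by apply: (measurableT_comp (measurable_poweR _)).
rewrite -ge0_integralZl_EFin ?(ltW C0)//; last first.
  by move=> y _; exact: poweR_ge0.
pose H (z : T1 * T1) := (F z.1 * ((riesz dl (c * (z.1 - z.2)))%:E *
   mine (G z.2) (F z.1 `^ (p / s))))%E.
have H0 z : (0 <= H z)%E.
  by rewrite !mule_ge0 ?lee_fin ?riesz_ge0// le_min G0 poweR_ge0.
have mH : measurable_fun [set: T1 * T1] H.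
  apply: emeasurable_funM; first exact: (measurableT_comp mF).
  apply: emeasurable_funM.
    apply/measurable_EFinP; apply: (measurableT_comp (measurable_riesz dl)).
    by apply: measurable_funM => //; exact: measurable_funB.
  apply: measurable_mine; first exact: (measurableT_comp mG).
  by apply: (measurableT_comp (measurable_poweR _)); exact: (measurableT_comp mF).
apply: ge0_le_integral => //.
- by move=> x _; apply: integral_ge0 => y _; exact: (H0 (x, y)).
- exact: (measurable_fun_fubini_tonelli_F H mH H0).
- exact: measurable_funeM.
move=> x _; have := F0 x; case: (F x) => [a| |]//.
- rewrite lee_fin le_eqVlt => /predU1P[<-|a0].
    under eq_integral do rewrite mul0e.
    by rewrite integral0 mule_ge0 ?lee_fin ?(ltW C0)// poweR_ge0.
  by rewrite [leRHS](_ : _ = hlsC%:E * (a `^ p)%:E)%E ?poweR_EFin//; exact: hls_inner.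
- move=> _; rewrite [X in (_ <= _ * X)%E]poweRE gt_eqF//=.
  by rewrite gt0_muley ?leey// lte_fin.
Qed.

End riesz_kernel.

(** Compare a^p with b^s: whichever is larger, one of the two truncations is inactive. *)
Lemma conj_pow_mine {R : realType} (a b : \bar R) (p s : R) : 0 < p -> 0 < s ->
  (0 <= a)%E -> (0 <= b)%E -> (b <= mine b (a `^ (p / s)))%E \/ (a <= mine a (b `^ (s / p)))%E.
Proof.
move=> p0 s0 a0 b0.
have [h|h] := leP b (a `^ (p / s))%E; first by left.
right; rewrite min_l//.
have : ((a `^ (p / s)) `^ (s / p) <= b `^ (s / p))%E.
  apply: gt0_ler_poweR; rewrite ?divr_ge0 ?ltW// in_itv/= leey andbT ?poweR_ge0//.
by rewrite -poweRrM mulrA divfK ?divff ?gt_eqF// poweRe1.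
Qed.

(** * Products of kernels *)

Section sigma_finite_product.
Context d1 d2 (X1 : measurableType d1) (X2 : measurableType d2) (R : realType).
Variables (m1 : {sigma_finite_measure set X1 -> \bar R})
          (m2 : {sigma_finite_measure set X2 -> \bar R}).

Let prod_sigma_finite : sigma_finite setT (m1 \x m2)%E.
Proof.
by case: (lebesgue_integral_fubini.measure_function_Measure_isSigmaFinite__to__measure_function_isSigmaFinite m1 m2).
Qed.

(* The canonical sigma-finite structure of (m1 \x m2) is shadowed by the one for
   products of probabilities, hence this alias. *)
Definition sfprod_fun : set (X1 * X2) -> \bar R := (m1 \x m2)%E.
HB.instance Definition _ := Measure.on sfprod_fun.
HB.instance Definition _ :=
  Measure_isSigmaFinite.Build _ _ _ sfprod_fun prod_sigma_finite.

Definition sfprod : {sigma_finite_measure set (X1 * X2)%type -> \bar R} :=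
  [the {sigma_finite_measure set (X1 * X2)%type -> \bar R} of sfprod_fun].

End sigma_finite_product.

Lemma measurable_fst_comp d d1 d2 (U : measurableType d) (X1 : measurableType d1)
    (X2 : measurableType d2) (f : U -> X1 * X2) :
  measurable_fun [set: U] f -> measurable_fun [set: U] (fun x => (f x).1).
Proof. exact: (measurableT_comp measurable_fst). Qed.

Lemma measurable_snd_comp d d1 d2 (U : measurableType d) (X1 : measurableType d1)
    (X2 : measurableType d2) (f : U -> X1 * X2) :
  measurable_fun [set: U] f -> measurable_fun [set: U] (fun x => (f x).2).
Proof. exact: (measurableT_comp measurable_snd). Qed.

Ltac mproj := repeat lazymatch goal with
  | |- measurable_fun _ (fun x => (@?f x, @?g x)) =>
      apply/measurable_fun_pairP; split; rewrite /comp /=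
  | |- measurable_fun _ (fun x => fst (@?f x)) => apply: measurable_fst_comp
  | |- measurable_fun _ (fun x => snd (@?f x)) => apply: measurable_snd_comp
  | |- measurable_fun _ (fun x => x) => exact: measurable_id
  | |- measurable_fun _ (fun _ => ?c) => exact: measurable_cst
  end.

Section hls_class.
Context {R : realType}.
Variables p s : R.

(* The Hardy-Littlewood-Sobolev inequality in bilinear form. *)
Definition hls d (X : measurableType d) (m : {measure set X -> \bar R})
    (k : X -> X -> R) (C : R) :=
  forall F G : X -> \bar R,
  measurable_fun [set: X] F -> (forall x, 0 <= F x)%E ->
  measurable_fun [set: X] G -> (forall x, 0 <= G x)%E ->
  (\int[m]_x \int[m]_y (F x * ((k x y)%:E * G y)) <=
   C%:E * ((\int[m]_x (F x `^ p)) `^ p^-1 * (\int[m]_y (G y `^ s)) `^ s^-1))%E.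

Hypotheses (p0 : 0 < p) (s0 : 0 < s).

(** Both sides are homogeneous of degree one in F and in G, so dividing by the norms leaves norm
    one. The degenerate norms are separate: a zero norm makes the function vanish almost everywhere,
    and an infinite one next to a nonzero one makes the right-hand side infinite. *)
Lemma hls_normalized d (X : measurableType d) (m : {sigma_finite_measure set X -> \bar R})
    (k : X -> X -> R) (C : R) : 0 < C ->
  measurable_fun [set: X * X] (fun z => k z.1 z.2) -> (forall x y, 0 <= k x y) ->
  (forall F G : X -> \bar R,
    measurable_fun [set: X] F -> (forall x, 0 <= F x)%E ->
    measurable_fun [set: X] G -> (forall x, 0 <= G x)%E ->
    (\int[m]_x (F x `^ p) = 1)%E -> (\int[m]_x (G x `^ s) = 1)%E ->
    (\int[m]_x \int[m]_y (F x * ((k x y)%:E * G y)) <= C%:E)%E) ->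
  hls m k C.
Proof.
move=> C0 mk k0 H F G mF F0 mG G0.
set A := (\int[m]_x (F x `^ p))%E; set B := (\int[m]_x (G x `^ s))%E.
have mFp : measurable_fun [set: X] (fun y => F y `^ p)%E.
  by apply: (measurableT_comp (measurable_poweR _)).
have mGs : measurable_fun [set: X] (fun y => G y `^ s)%E.
  by apply: (measurableT_comp (measurable_poweR _)).
have A0 : (0 <= A)%E by apply: integral_ge0 => x _; exact: poweR_ge0.
have B0 : (0 <= B)%E by apply: integral_ge0 => x _; exact: poweR_ge0.
have mkx x : measurable_fun [set: X] (fun y => (k x y)%:E).
  by apply/measurable_EFinP; exact: (measurable_fun_pair2 x mk).
have inner0 x : (0 <= \int[m]_y (F x * ((k x y)%:E * G y)))%E.
  by apply: integral_ge0 => y _; rewrite !mule_ge0 ?lee_fin.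
have vanish (r : R) (K : X -> \bar R) : 0 < r -> measurable_fun [set: X] K ->
    (forall x, 0 <= K x)%E -> (\int[m]_x (K x `^ r) = 0)%E -> ae_eq m setT K (cst 0%E).
  move=> r0 mK K0 h.
  have mKr : measurable_fun [set: X] (fun y => K y `^ r)%E.
    by apply: (measurableT_comp (measurable_poweR _)).
  have : ae_eq m setT (fun y => K y `^ r)%E (cst 0%E).
    apply/(ae_eq_integral_abs m measurableT mKr).
    by under eq_integral do rewrite gee0_abs ?poweR_ge0//.
  by apply: filterS => x h' _; apply: (@poweR_eq0_eq0 _ _ r) => //; exact: h'.
have mH : measurable_fun [set: X * X] (fun z : X * X => F z.1 * ((k z.1 z.2)%:E * G z.2))%E.
  apply: emeasurable_funM; first exact: (measurableT_comp mF).
  apply: emeasurable_funM; first exact/measurable_EFinP.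
  exact: (measurableT_comp mG).
have H0 (z : X * X) : (0 <= F z.1 * ((k z.1 z.2)%:E * G z.2))%E.
  by rewrite !mule_ge0 ?lee_fin.
have [A00|A0'] := eqVneq A 0%E.
  have F00 := vanish _ _ p0 mF F0 A00.
  rewrite (ae_eq_integral (cst 0%E)) ?integral0//; last first.
  - apply: filterS F00 => x Fx _; rewrite Fx//; under eq_integral do rewrite mul0e.
    exact: integral0.
  - exact: (measurable_fun_fubini_tonelli_F _ mH H0).
  by rewrite !mule_ge0 ?poweR_ge0// lee_fin ltW.
have [B00|B0'] := eqVneq B 0%E.
  have G00 := vanish _ _ s0 mG G0 B00.
  under eq_integral => x _.
    rewrite (ae_eq_integral (cst 0%E)) ?integral0//; last first.
    - by apply: filterS G00 => y Gy _; rewrite Gy// !mule0.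
    - by apply: emeasurable_funM => //; exact: emeasurable_funM.
    over.
  by rewrite integral0 !mule_ge0 ?poweR_ge0// lee_fin ltW.
have pow_gt0 (K : \bar R) (r : R) : (0 <= K)%E -> K != 0%E -> (0 < K `^ r)%E.
  by move=> K0 K1; rewrite lt0e poweR_ge0 andbT poweR_eq0// negb_and K1.
have [Aoo|Afin] := eqVneq A +oo%E.
  rewrite {1}Aoo poweRyr ?invr_eq0 ?gt_eqF// gt0_mulye ?pow_gt0//.
  by rewrite gt0_muley ?leey// lte_fin.
have [Boo|Bfin] := eqVneq B +oo%E.
  rewrite {1}Boo poweRyr ?invr_eq0 ?gt_eqF// gt0_muley ?pow_gt0//.
  by rewrite gt0_muley ?leey// lte_fin.
have [a a0 AE] : exists2 a : R, 0 < a & A = (a `^ p)%:E.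
  exists (fine A `^ p^-1).
    by rewrite powR_gt0// fine_gt0// lt0e A0' A0 ltey Afin.
  rewrite -powRrM mulVf ?gt_eqF// powRr1 ?fine_ge0// fineK//.
  by rewrite ge0_fin_numE// ltey.
have [b b0 BE] : exists2 b : R, 0 < b & B = (b `^ s)%:E.
  exists (fine B `^ s^-1).
    by rewrite powR_gt0// fine_gt0// lt0e B0' B0 ltey Bfin.
  rewrite -powRrM mulVf ?gt_eqF// powRr1 ?fine_ge0// fineK//.
  by rewrite ge0_fin_numE// ltey.
have norm1 (r c : R) (K : X -> \bar R) : 0 < r -> 0 < c -> measurable_fun [set: X] K ->
    (forall x, 0 <= K x)%E -> (\int[m]_x (K x `^ r) = (c `^ r)%:E)%E ->
    (\int[m]_x ((c^-1%:E * K x) `^ r) = 1)%E.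
  move=> r0 c0 mK K0 h.
  have mKr : measurable_fun [set: X] (fun y => K y `^ r)%E.
    by apply: (measurableT_comp (measurable_poweR _)).
  under eq_integral do rewrite poweRM ?lee_fin ?invr_ge0 ?(ltW c0)// poweR_EFin.
  rewrite ge0_integralZl_EFin ?powR_ge0 ?h//; last by move=> x _; exact: poweR_ge0.
  by rewrite -EFinM -powRM ?invr_ge0 ?(ltW c0)// mulVf ?gt_eqF// powR1.
have := H (fun x => a^-1%:E * F x)%E (fun x => b^-1%:E * G x)%E.
move=> /(_ (measurable_funeM _ mF) _ (measurable_funeM _ mG) _
  (norm1 _ _ _ p0 a0 mF F0 AE) (norm1 _ _ _ s0 b0 mG G0 BE)).
have ia : 0 <= a^-1 by rewrite invr_ge0 ltW.
have ib : 0 <= b^-1 by rewrite invr_ge0 ltW.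
move=> /(_ _ _)/wrap[].
  by move=> x; rewrite mule_ge0.
  by move=> x; rewrite mule_ge0.
have -> : (\int[m]_x \int[m]_y (a^-1%:E * F x * ((k x y)%:E * (b^-1%:E * G y))) =
    (a * b)^-1%:E * \int[m]_x \int[m]_y (F x * ((k x y)%:E * G y)))%E.
  rewrite -ge0_integralZl_EFin ?invr_ge0 ?mulr_ge0 ?(ltW a0) ?(ltW b0)//; last first.
    exact: (measurable_fun_fubini_tonelli_F _ mH H0).
  apply: eq_integral => x _.
  rewrite -ge0_integralZl_EFin ?invr_ge0 ?mulr_ge0 ?(ltW a0) ?(ltW b0)//; last 2 first.
  - by move=> y _; rewrite !mule_ge0 ?lee_fin.
  - by apply: emeasurable_funM => //; exact: emeasurable_funM.
  apply: eq_integral => y _.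
  rewrite invfM EFinM [RHS]muleACA; congr (_ * _)%E.
  by rewrite muleCA.
rewrite AE BE !poweR_EFin -!powRrM !divff ?gt_eqF// !powRr1 ?(ltW a0) ?(ltW b0)//.
by rewrite lee_pdivrMl ?mulr_gt0// EFinM muleC.
Qed.

End hls_class.

Section hls_instances.
Context {R : realType}.
Variables p q dl : R.
Hypotheses (p1 : 1 < p) (pq : p < q) (dlE : dl = p^-1 - q^-1).
Let s := (1 - q^-1)^-1.
Notation mu := (@lebesgue_measure R).
Notation T1 := (measurableTypeR R).

Let p0 : 0 < p. Proof. exact: lt_trans p1. Qed.
Let q0 : 0 < q. Proof. exact: lt_trans pq. Qed.
Let q1 : 1 < q. Proof. exact: lt_trans pq. Qed.
Let iq1 : q^-1 < 1. Proof. by rewrite invf_lt1. Qed.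
Let ip1 : p^-1 < 1. Proof. by rewrite invf_lt1. Qed.
Let s0 : 0 < s. Proof. by rewrite invr_gt0 subr_gt0. Qed.
Let s1 : 1 < s. Proof. by rewrite invf_gt1 ?subr_gt0// gtrBl invr_gt0. Qed.
Let dl0 : 0 < dl. Proof. by rewrite dlE subr_gt0 ltf_pV2. Qed.
Let iq0 : 0 < q^-1. Proof. by rewrite invr_gt0. Qed.
Let ip0 : 0 < p^-1. Proof. by rewrite invr_gt0. Qed.

(* The pair (s, p') plays the role of (p, q) when F and G are exchanged. *)
Let p' := (1 - p^-1)^-1.
Let sp' : s < p'.
Proof. by rewrite ltf_pV2 ?posrE ?subr_gt0// ltrD2l ltrN2 ltf_pV2. Qed.
Let dlE' : dl = s^-1 - p'^-1.
Proof. by rewrite /s /p' !invrK dlE; ring. Qed.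
Let p'E : p = (1 - p'^-1)^-1.
Proof. by rewrite /p' invrK opprB addrC subrK invrK. Qed.

Lemma hls_riesz : exists2 C : R, 0 < C & @hls R p s _ T1 mu (fun x y => riesz dl (x - y)) C.
Proof.
pose C1 := dl^-1 + 1 + (q * (1 - p^-1))^-1.
pose C2 := dl^-1 + 1 + (p' * (1 - s^-1))^-1.
have C10 : 0 < C1 by rewrite !addr_gt0 ?invr_gt0 ?mulr_gt0 ?subr_gt0.
have C20 : 0 < C2.
  by rewrite !addr_gt0 ?invr_gt0 ?mulr_gt0 ?subr_gt0 ?invf_lt1 ?invr_gt0 ?subr_gt0.
exists (C1 + C2); first by rewrite addr_gt0.
apply: hls_normalized => //.
- by rewrite addr_gt0.
- by apply: (measurableT_comp (measurable_riesz dl)); exact: measurable_funB.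
- by move=> x y; exact: riesz_ge0.
move=> F G mF F0 mG G0 F1 G1.
have h1 := @hls_half R p q dl p1 pq dlE 1 F G (oner_neq0 _) (normr1 _) mF F0 mG G0.
have h2 := @hls_half R s p' dl s1 sp' dlE' (-1) G F _ _ mG G0 mF F0.
rewrite -/s -p'E in h1 h2.
have {}h1 := h1 _; rewrite G1 F1 in h1; have {}h1 := h1 (lexx _).
have {}h2 := h2 _ _ _; rewrite G1 F1 in h2.
have {}h2 := h2 _ _ (lexx _); rewrite oppr_eq0 oner_eq0 normrN1 in h2.
have {}h2 := h2 erefl erefl.
pose H1 (z : T1 * T1) := (F z.1 * ((riesz dl (1 * (z.1 - z.2)))%:E * mine (G z.2) (F z.1 `^ (p / s))))%E.
pose H2 (z : T1 * T1) := (G z.2 * ((riesz dl (-1 * (z.2 - z.1)))%:E * mine (F z.1) (G z.2 `^ (s / p))))%E.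
have H10 z : (0 <= H1 z)%E.
  by rewrite !mule_ge0 ?lee_fin ?riesz_ge0// le_min G0 poweR_ge0.
have H20 z : (0 <= H2 z)%E.
  by rewrite !mule_ge0 ?lee_fin ?riesz_ge0// le_min F0 poweR_ge0.
have mr (c : R) (f g : T1 * T1 -> T1) : measurable_fun [set: T1 * T1] f -> 
    measurable_fun [set: T1 * T1] g ->
    measurable_fun [set: T1 * T1] (fun z => (riesz dl (c * (f z - g z)))%:E).
  move=> mf mg; apply/measurable_EFinP; apply: (measurableT_comp (measurable_riesz dl)).
  by apply: measurable_funM => //; exact: measurable_funB.
have mH1 : measurable_fun [set: T1 * T1] H1.
  apply: emeasurable_funM; first exact: (measurableT_comp mF).
  apply: emeasurable_funM; first exact: mr.
  apply: measurable_mine; first exact: (measurableT_comp mG).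
  by apply: (measurableT_comp (measurable_poweR _)); exact: (measurableT_comp mF).
have mH2 : measurable_fun [set: T1 * T1] H2.
  apply: emeasurable_funM; first exact: (measurableT_comp mG).
  apply: emeasurable_funM; first exact: mr.
  apply: measurable_mine; first exact: (measurableT_comp mF).
  by apply: (measurableT_comp (measurable_poweR _)); exact: (measurableT_comp mG).
pose H (z : T1 * T1) := (F z.1 * ((riesz dl (z.1 - z.2))%:E * G z.2))%E.
have mH : measurable_fun [set: T1 * T1] H.
  apply: emeasurable_funM; first exact: (measurableT_comp mF).
  apply: emeasurable_funM; last exact: (measurableT_comp mG).
  apply/measurable_EFinP; apply: (measurableT_comp (measurable_riesz dl)).
  exact: measurable_funB.
have H0 z : (0 <= H z)%E by rewrite !mule_ge0 ?lee_fin ?riesz_ge0.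
have -> : (\int[mu]_x \int[mu]_y (F x * ((riesz dl (x - y))%:E * G y)) =
    \int[mu \x mu]_z H z)%E by rewrite fubini_tonelli1.
(* At every pair one of the truncations is inactive by [conj_pow_mine], so the integrand lies below
   the sum of the two truncated ones, each of which [hls_half] controls. *)
apply: (@le_trans _ _ (\int[mu \x mu]_z (H1 z + H2 z))%E).
  apply: ge0_le_integral => //.
  - exact: emeasurable_funD.
  - case=> x y _; rewrite /H/=.
    have := conj_pow_mine p0 s0 (F0 x) (G0 y) => -[h|h].
      apply: (@le_trans _ _ (H1 (x, y))); last by rewrite leeDl.
      by rewrite /H1/= mul1r lee_wpmul2l// lee_wpmul2l// lee_fin riesz_ge0.
    apply: (@le_trans _ _ (H2 (x, y))); last by rewrite leeDr.
    rewrite /H2/= mulN1r opprB muleCA [leRHS]muleCA lee_wpmul2l ?lee_fin ?riesz_ge0//.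
    by rewrite muleC lee_wpmul2l.
rewrite ge0_integralD//.
rewrite EFinD leeD//.
  by rewrite fubini_tonelli1// (le_trans h1)// mule1.
by rewrite fubini_tonelli2// (le_trans h2)// mule1.
Qed.

(** Fibrewise: for fixed first coordinates x and x', the inequality in the second factor bounds the
    inner double integral by the product of the L_p norm of F(x, .) and the L_s norm of G(x', .).
    These norms, [a] and [b], are then the functions fed to the inequality in the first factor. *)
Lemma hls_prod d1 d2 (X1 : measurableType d1) (X2 : measurableType d2)
    (m1 : {sigma_finite_measure set X1 -> \bar R})
    (m2 : {sigma_finite_measure set X2 -> \bar R})
    (k1 : X1 -> X1 -> R) (k2 : X2 -> X2 -> R) (C1 C2 : R) :
  0 < C1 -> 0 < C2 ->
  measurable_fun [set: X1 * X1] (fun z => k1 z.1 z.2) -> (forall x y, 0 <= k1 x y) ->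
  measurable_fun [set: X2 * X2] (fun z => k2 z.1 z.2) -> (forall x y, 0 <= k2 x y) ->
  hls p s m1 k1 C1 -> hls p s m2 k2 C2 ->
  hls p s (m1 \x m2)%E (fun z w => k1 z.1 w.1 * k2 z.2 w.2) (C1 * C2).
Proof.
move=> C10 C20 mk1 k10 mk2 k20 H1 H2 F G mF F0 mG G0.
have mFx x : measurable_fun [set: X2] (fun y => F (x, y)) by exact: measurable_fun_pair2.
have mGx x : measurable_fun [set: X2] (fun y => G (x, y)) by exact: measurable_fun_pair2.
pose a x := ((\int[m2]_y (F (x, y) `^ p)) `^ p^-1)%E.
pose b x := ((\int[m2]_y (G (x, y) `^ s)) `^ s^-1)%E.
have mFp : measurable_fun [set: X1 * X2] (fun z => F z `^ p)%E.
  by apply: (measurableT_comp (measurable_poweR _)).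
have mGs : measurable_fun [set: X1 * X2] (fun z => G z `^ s)%E.
  by apply: (measurableT_comp (measurable_poweR _)).
have ma : measurable_fun [set: X1] a.
  apply: (measurableT_comp (measurable_poweR _)).
  by apply: (measurable_fun_fubini_tonelli_F _ mFp) => z; exact: poweR_ge0.
have mb : measurable_fun [set: X1] b.
  apply: (measurableT_comp (measurable_poweR _)).
  by apply: (measurable_fun_fubini_tonelli_F _ mGs) => z; exact: poweR_ge0.
have a0 x : (0 <= a x)%E by exact: poweR_ge0.
have b0 x : (0 <= b x)%E by exact: poweR_ge0.
have := H1 a b ma a0 mb b0.
have -> : (\int[m1]_x (a x `^ p) = \int[m1 \x m2]_z (F z `^ p))%E.
  rewrite fubini_tonelli1//; last by move=> z; exact: poweR_ge0.
  apply: eq_integral => x _; rewrite /a -poweRrM mulVf ?gt_eqF// poweRe1//.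
  by apply: integral_ge0 => y _; exact: poweR_ge0.
have -> : (\int[m1]_x (b x `^ s) = \int[m1 \x m2]_z (G z `^ s))%E.
  rewrite fubini_tonelli1//; last by move=> z; exact: poweR_ge0.
  apply: eq_integral => x _; rewrite /b -poweRrM mulVf ?gt_eqF// poweRe1//.
  by apply: integral_ge0 => y _; exact: poweR_ge0.
move=> h; rewrite [(C1 * C2)%:E]EFinM [(C1%:E * C2%:E)%E]muleC -muleA.
apply: le_trans (lee_wpmul2l _ h); last by rewrite lee_fin ltW.
pose K (z : (X1 * X2) * (X1 * X2)) :=
  (F z.1 * ((k1 z.1.1 z.2.1 * k2 z.1.2 z.2.2)%:E * G z.2))%E.
have mk : measurable_fun [set: (X1 * X2) * (X1 * X2)]
    (fun z => k1 z.1.1 z.2.1 * k2 z.1.2 z.2.2).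
  apply: measurable_funM.
    apply: (measurableT_comp mk1 (g := fun z : (X1 * X2) * (X1 * X2) => (z.1.1, z.2.1))).
    by mproj.
  apply: (measurableT_comp mk2 (g := fun z : (X1 * X2) * (X1 * X2) => (z.1.2, z.2.2))).
  by mproj.
have mK : measurable_fun [set: (X1 * X2) * (X1 * X2)] K.
  apply: emeasurable_funM; first exact: (measurableT_comp mF).
  apply: emeasurable_funM; last exact: (measurableT_comp mG).
  exact/measurable_EFinP.
have K0 z : (0 <= K z)%E by rewrite !mule_ge0 ?lee_fin ?mulr_ge0.
have mI : measurable_fun [set: X1 * X2] (fun z => \int[m1 \x m2]_w K (z, w))%E.
  exact: (measurable_fun_fubini_tonelli_F (m2 := sfprod m1 m2) _ mK K0).
rewrite fubini_tonelli1//; last first.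
  by move=> z; apply: integral_ge0 => w _; exact: (K0 (z, w)).
rewrite -ge0_integralZl_EFin ?(ltW C20)//; last 2 first.
- move=> x _; apply: integral_ge0 => y _.
  by rewrite !mule_ge0 ?lee_fin.
- apply: (measurable_fun_fubini_tonelli_F (fun z : X1 * X1 => a z.1 * ((k1 z.1 z.2)%:E * b z.2))%E).
    apply: emeasurable_funM; first exact: (measurableT_comp ma).
    apply: emeasurable_funM; last exact: (measurableT_comp mb).
    exact/measurable_EFinP.
  by move=> z; rewrite !mule_ge0 ?lee_fin.
have mk1x x : measurable_fun [set: X1] (fun y => (k1 x y)%:E).
  by apply/measurable_EFinP; exact: (measurable_fun_pair2 x mk1).
have mk2x x : measurable_fun [set: X2] (fun y => (k2 x y)%:E).
  by apply/measurable_EFinP; exact: (measurable_fun_pair2 x mk2).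
apply: ge0_le_integral => //.
- move=> x _; apply: integral_ge0 => y _; apply: integral_ge0 => w _.
  exact: (K0 ((x, y), w)).
- apply: (measurable_fun_fubini_tonelli_F (fun z => \int[m1 \x m2]_w K (z, w))%E) => //.
  by move=> z; apply: integral_ge0 => w _; exact: (K0 (z, w)).
- apply: measurable_funeM.
  apply: (measurable_fun_fubini_tonelli_F (fun z : X1 * X1 => a z.1 * ((k1 z.1 z.2)%:E * b z.2))%E).
    apply: emeasurable_funM; first exact: (measurableT_comp ma).
    apply: emeasurable_funM; last exact: (measurableT_comp mb).
    exact/measurable_EFinP.
  by move=> z; rewrite !mule_ge0 ?lee_fin.
move=> x _; rewrite /fubini_F.
have mKx y : measurable_fun [set: X1 * X2] (fun w => K ((x, y), w)).
  exact: measurable_fun_pair2.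
have -> : (\int[m2]_y \int[m1 \x m2]_w K ((x, y), w) =
    \int[m2]_y \int[m1]_x' \int[m2]_y' K ((x, y), (x', y')))%E.
  by apply: eq_integral => y _; rewrite fubini_tonelli1// => w; exact: K0.
pose L (z : X2 * X1) := (\int[m2]_y' K ((x, z.1), (z.2, y')))%E.
have mL : measurable_fun [set: X2 * X1] L.
  apply: (measurable_fun_fubini_tonelli_F (fun w : (X2 * X1) * X2 => K ((x, w.1.1), (w.1.2, w.2)))).
    apply: (measurableT_comp mK).
    by mproj.
  by move=> w; exact: K0.
have L0 z : (0 <= L z)%E by apply: integral_ge0 => w _; exact: K0.
(* Exchanges y with x', so that for fixed x and x' both variables of the second factor are
   integrated together and [H2] applies. *)
rewrite [leLHS](fubini_tonelli L mL L0).
rewrite -ge0_integralZl_EFin ?(ltW C20)//; last 2 first.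
- by move=> y _; rewrite !mule_ge0 ?lee_fin.
- apply: emeasurable_funM => //; apply: emeasurable_funM => //.
apply: ge0_le_integral => //.
- by move=> y _; apply: integral_ge0 => w _; exact: (L0 (w, y)).
- exact: (measurable_fun_fubini_tonelli_G L mL L0).
- by apply: measurable_funeM; apply: emeasurable_funM => //; exact: emeasurable_funM.
move=> x' _; rewrite /L/= /K/=.
have -> : (\int[m2]_y \int[m2]_y' (F (x, y) * ((k1 x x' * k2 y y')%:E * G (x', y'))) =
    (k1 x x')%:E * \int[m2]_y \int[m2]_y' (F (x, y) * ((k2 y y')%:E * G (x', y'))))%E.
  rewrite -ge0_integralZl_EFin//; last 2 first.
  - by move=> y _; apply: integral_ge0 => y' _; rewrite !mule_ge0 ?lee_fin.
  - apply: (measurable_fun_fubini_tonelli_F (fun z : X2 * X2 => F (x, z.1) * ((k2 z.1 z.2)%:E * G (x', z.2)))%E).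
      apply: emeasurable_funM; first exact: (measurableT_comp (mFx x)).
      apply: emeasurable_funM; last exact: (measurableT_comp (mGx x')).
      exact/measurable_EFinP.
    by move=> z; rewrite !mule_ge0 ?lee_fin.
  apply: eq_integral => y _; rewrite -ge0_integralZl_EFin//; last 2 first.
  - by move=> y' _; rewrite !mule_ge0 ?lee_fin.
  - by apply: emeasurable_funM => //; exact: emeasurable_funM.
  apply: eq_integral => y' _; rewrite EFinM -muleA.
  by rewrite [LHS](muleCA (F (x, y)) (k1 x x')%:E).
have := H2 _ _ (mFx x) (fun y => F0 (x, y)) (mGx x') (fun y => G0 (x', y)).
rewrite -/(a x) -/(b x') => h2.
rewrite [leRHS](_ : _ = (k1 x x')%:E * (C2%:E * (a x * b x')))%E.
  by rewrite lee_wpmul2l ?lee_fin.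
by rewrite (muleCA (a x)) (muleCA C2%:E).
Qed.

End hls_instances.

Section hls_euclidean.
Context {R : realType}.
Variables p q dl : R.
Hypotheses (p1 : 1 < p) (pq : p < q) (dlE : dl = p^-1 - q^-1).
Let s := (1 - q^-1)^-1.

Lemma measurable_rV_entry d (i : 'I_d) : measurable_fun [set: 'rV[R]_d] (fun y : 'rV[R]_d => y ord0 i : measurableTypeR R).
Proof. exact: measurable_mx_entry. Qed.

Lemma integral_rV0 (f : 'rV[R]_0 -> \bar R) : measurable_fun [set: 'rV[R]_0] f ->
  (\int[lebesgue_rV 0]_y f y = f 0%R)%E.
Proof. by move=> mf /=; rewrite integral_dirac// diracT mul1e. Qed.

Lemma ge0_integral_rV_succ n (f : 'rV[R]_n.+1 -> \bar R) :
  measurable_fun [set: 'rV[R]_n.+1] f -> (forall y, 0 <= f y)%E ->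
  (\int[lebesgue_rV n.+1]_y f y =
   \int[lebesgue_measure \x lebesgue_rV n]_z f (cons_rV z))%E.
Proof.
move=> mf f0.
have mc : measurable_fun [set: measurableTypeR R * 'rV[R]_n] (@cons_rV R n).
  exact: measurable_cons_rV.
have := ge0_integral_pushforward mc (lebesgue_measure \x lebesgue_rV n)%E
  (D := setT) (f := f) measurableT mf.
by rewrite preimage_setT => <-//.
Qed.

Definition rriesz d (z : 'rV[R]_d) : R := \prod_i riesz dl (z ord0 i).

Lemma rriesz_ge0 d (z : 'rV[R]_d) : 0 <= rriesz z.
Proof. by apply: prodr_ge0 => i _; exact: riesz_ge0. Qed.

Lemma rriesz0 (z : 'rV[R]_0) : rriesz z = 1.
Proof. by rewrite /rriesz big_ord0. Qed.

Lemma measurable_rriesz d :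
  measurable_fun [set: 'rV[R]_d * 'rV[R]_d] (fun z => rriesz (z.1 - z.2)).
Proof.
rewrite /rriesz; apply: measurable_prod => i _.
apply: (measurableT_comp (measurable_riesz dl)).
under eq_fun do rewrite !mxE.
apply: measurable_funB.
  exact: (measurableT_comp (measurable_rV_entry i) measurable_fst).
exact: (measurableT_comp (measurable_rV_entry i) measurable_snd).
Qed.

Lemma hls_rV d : exists2 C : R, 0 < C &
  hls p s (lebesgue_rV d) (fun x y : 'rV[R]_d => rriesz (x - y)) C.
Proof.
have p0 : 0 < p by exact: lt_trans p1.
have q0 : 0 < q by exact: lt_trans pq.
have s0 : 0 < s by rewrite invr_gt0 subr_gt0 invf_lt1 // (lt_trans p1).
elim: d => [|d [C2 C20 H2]].
  (* In dimension 0 the measure is a Dirac mass and the kernel an empty product: both sides are F 0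
     * G 0. *)
  exists 1 => // F G mF F0 mG G0.
  have mFp : measurable_fun [set: 'rV[R]_0] (fun y => F y `^ p)%E.
    exact: (measurableT_comp (measurable_poweR _) mF).
  have mGs : measurable_fun [set: 'rV[R]_0] (fun y => G y `^ s)%E.
    exact: (measurableT_comp (measurable_poweR _) mG).
  have iE x : (\int[lebesgue_rV 0]_y (F x * ((rriesz (x - y))%:E * G y)) = F x * G 0%R)%E.
    rewrite integral_rV0 ?rriesz0 ?mul1e//.
    under eq_fun do rewrite rriesz0 mul1e.
    exact: measurable_funeM.
  under eq_integral do rewrite iE.
  rewrite !integral_rV0//; last by apply: emeasurable_funM.
  rewrite -!poweRrM !divff ?gt_eqF// !poweRe1 ?mul1e//.
have [C1 C10 H1] := hls_riesz p1 pq dlE.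
exists (C1 * C2); first by rewrite mulr_gt0.
move=> F G mF F0 mG G0.
have H := hls_prod p1 pq C10 C20 _ _ _ _ H1 H2.
have mc : measurable_fun [set: measurableTypeR R * 'rV[R]_d] (@cons_rV R d).
  exact: measurable_cons_rV.
have mF' : measurable_fun [set: measurableTypeR R * 'rV[R]_d] (F \o @cons_rV R d).
  exact: (measurableT_comp mF mc).
have mG' : measurable_fun [set: measurableTypeR R * 'rV[R]_d] (G \o @cons_rV R d).
  exact: (measurableT_comp mG mc).
have kE z w : riesz dl (z.1 - w.1) * rriesz (z.2 - w.2) =
    rriesz (@cons_rV R d z - @cons_rV R d w).
  rewrite /rriesz [RHS]big_ord_recl !mxE unlift_none; congr (_ * _).
  by apply: eq_bigr => i _; rewrite !mxE liftK.
have mKx x : measurable_fun [set: 'rV[R]_d.+1]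
    (fun y => F x * ((rriesz (x - y))%:E * G y))%E.
  apply: emeasurable_funM => //; apply: emeasurable_funM => //.
  apply/measurable_EFinP.
  by have := measurable_fun_pair2 (f := fun z : 'rV[R]_d.+1 * 'rV[R]_d.+1 => rriesz (z.1 - z.2)) x (@measurable_rriesz d.+1).
have K0 x y : (0 <= F x * ((rriesz (x - y))%:E * G y))%E.
  by rewrite !mule_ge0// lee_fin rriesz_ge0.
rewrite ge0_integral_rV_succ; last 2 first.
- apply: (measurable_fun_fubini_tonelli_F (fun z : 'rV[R]_d.+1 * 'rV[R]_d.+1 =>
    F z.1 * ((rriesz (z.1 - z.2))%:E * G z.2))%E).
    apply: emeasurable_funM; first exact: (measurableT_comp mF measurable_fst).
    apply: emeasurable_funM; last exact: (measurableT_comp mG measurable_snd).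
    by apply/measurable_EFinP; exact: measurable_rriesz.
  by move=> z; exact: K0.
- by move=> x; apply: integral_ge0 => y _; exact: K0.
rewrite (ge0_integral_rV_succ (f := fun x => F x `^ p)%E); last 2 first.
- by apply: (measurableT_comp (measurable_poweR _)).
- by move=> x; exact: poweR_ge0.
rewrite (ge0_integral_rV_succ (f := fun x => G x `^ s)%E); last 2 first.
- by apply: (measurableT_comp (measurable_poweR _)).
- by move=> x; exact: poweR_ge0.
under eq_integral => z _.
  rewrite ge0_integral_rV_succ//.
  under eq_integral => w _ do rewrite -kE.
  over.
apply: (H _ _ _ _ (F \o @cons_rV R d) (G \o @cons_rV R d)) => //.
- by apply: (measurableT_comp (measurable_riesz dl)); exact: measurable_funB.
- by move=> x y; exact: riesz_ge0.
- exact: measurable_rriesz.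
- by move=> x y; exact: rriesz_ge0.
- by move=> z; exact: F0.
- by move=> z; exact: G0.
Qed.

End hls_euclidean.

(** * Duality in Lebesgue spaces *)

Section duality.
Context {R : realType}.

(** The dual function is |u|^(q - 1). As u is not known to lie in L_q, it is first truncated in
    height and to sets of finite measure; then I, the integral of v^q, is finite, I <= M I^(1 - 1/q)
    may be divided out, and monotone convergence removes the truncation. Pairing with a majorant W
    means that u enters only through a pointwise bound. *)
Lemma Lnorm_le_dual d (X : measurableType d) (m : {sigma_finite_measure set X -> \bar R})
    (q M : R) (u : X -> R) (W : X -> \bar R) : 1 < q -> 0 <= M ->
  measurable_fun [set: X] u -> measurable_fun [set: X] W -> (forall x, 0 <= W x)%E ->
  {ae m, forall x, (`|u x|%:E <= W x)%E} ->
  (forall G : X -> \bar R, measurable_fun [set: X] G -> (forall x, 0 <= G x)%E ->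
    (\int[m]_x (G x * W x) <= M%:E * (\int[m]_x (G x `^ (1 - q^-1)^-1)) `^ (1 - q^-1))%E) ->
  ('N[m]_(q%:E)[EFin \o u] <= M%:E)%E.
Proof.
move=> q1 M0 mu mW W0 uW H.
have q0 : 0 < q by exact: lt_trans q1.
have iq1 : q^-1 < 1 by rewrite invf_lt1.
have s0 : 0 < 1 - q^-1 by rewrite subr_gt0.
have /sigma_finiteP[B [BT ndB Boo]] := sigma_finiteT m.
pose v n x : R := Num.min `|u x| n%:R * \1_(B n) x.
have mB n : measurable (B n) by case: (Boo n).
have mnu : measurable_fun [set: X] (fun x => `|u x|) by exact: (measurableT_comp (@normr_measurable R setT)).
have mv n : measurable_fun [set: X] (v n).
  apply: measurable_funM; last exact: measurable_indic.
  by apply: measurable_minr.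
have v0 n x : 0 <= v n x.
  by rewrite /v mulr_ge0// le_min normr_ge0 ler0n.
have v_le n x : v n x <= `|u x|.
  rewrite /v -[leRHS]mulr1 ler_pM ?le_min ?normr_ge0 ?ler0n//.
  by rewrite ge_min lexx.
have vn n x : v n x <= n%:R * \1_(B n) x.
  by rewrite /v ler_wpM2r// ge_min lexx orbT.
have mvr n (r : R) : measurable_fun [set: X] (fun x => (v n x `^ r)%:E).
  by apply/measurable_EFinP; apply: (measurableT_comp (measurable_powR r)).
pose I n := (\int[m]_x (v n x `^ q)%:E)%E.
have I0 n : (0 <= I n)%E by apply: integral_ge0 => x _; rewrite lee_fin powR_ge0.
have Ifin n : (I n < +oo)%E.
  apply: (@le_lt_trans _ _ (\int[m]_x ((n%:R `^ q)%:E * (\1_(B n) x)%:E))%E).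
    apply: ge0_le_integral => //.
    - by move=> x _; rewrite lee_fin powR_ge0.
    - by apply: measurable_funeM; exact/measurable_EFinP.
    - move=> x _; rewrite -EFinM lee_fin.
      have := vn n x; rewrite indicE; case: (x \in B n).
        by rewrite !mulr1 => h; rewrite ge0_ler_powR ?nnegrE ?(ltW q0).
      rewrite !mulr0 => h; have -> : v n x = 0 by apply/eqP; rewrite eq_le h v0.
      by rewrite powR0// gt_eqF.
  rewrite ge0_integralZl_EFin ?powR_ge0//; last exact/measurable_EFinP.
  rewrite integral_indic// setIT lte_mul_pinfty ?lee_fin ?powR_ge0//.
  by case: (Boo n).
have Ile n : (I n <= M%:E * I n `^ (1 - q^-1))%E.
  have := H (fun x => (v n x `^ (q - 1))%:E) (mvr _ _) _.
  move=> /(_ (fun x => _)) h; have {}h := h (fun x => powR_ge0 _ _).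
  move: h; under [X in (_ <= _ * X `^ _)%E -> _]eq_integral => x _.
    rewrite poweR_EFin -powRrM (_ : (q - 1) * (1 - q^-1)^-1 = q); last first.
      by field; rewrite !gt_eqF//= subr_gt0.
    over.
  apply: le_trans.
  apply: (@ae_ge0_le_integral _ _ _ m setT measurableT).
  - by move=> x _; rewrite lee_fin powR_ge0.
  - exact: mvr.
  - by move=> x _; rewrite mule_ge0// lee_fin powR_ge0.
  - exact: emeasurable_funM.
  - apply: filterS uW => x uWx _.
    rewrite [v n x `^ q](_ : _ = v n x `^ (q - 1) * v n x); last first.
      have := v0 n x; rewrite le_eqVlt => /predU1P[<-|vx].
        by rewrite mulr0 powR0// gt_eqF.
      rewrite -{3}[v n x]powRr1 ?(ltW vx)// -powRD ?subrK//.
      by rewrite (gt_eqF vx) implybT.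
    rewrite EFinM lee_wpmul2l ?lee_fin ?powR_ge0//.
    by rewrite (le_trans _ uWx)// lee_fin.
have IM n : (I n <= (M `^ q)%:E)%E.
  have := Ile n; have := Ifin n; have := I0 n.
  case: (I n) => [i| |]//; rewrite lee_fin => i0 _.
  rewrite poweR_EFin -EFinM !lee_fin => h.
  have [->|i_neq0] := eqVneq i 0; first by rewrite powR_ge0.
  have {}i0 : 0 < i by rewrite lt_neqAle eq_sym i_neq0.
  have : i `^ q^-1 <= M.
    rewrite -(ler_pM2r (powR_gt0 (1 - q^-1) i0)).
    rewrite -powRD ?(gt_eqF i0) ?implybT//.
    by rewrite addrC subrK powRr1 ?(ltW i0)// (le_trans h).
  move=> /(ge0_ler_powR (ltW q0)); rewrite -powRrM mulVf ?gt_eqF// powRr1 ?(ltW i0)//.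
  by apply; rewrite nnegrE ?powR_ge0.
have cvI : (\int[m]_x ((v n x `^ q)%:E))%E @[n --> \oo] --> (\int[m]_x ((`|u x| `^ q)%:E))%E.
  rewrite (_ : (\int[m]_x ((`|u x| `^ q)%:E))%E =
    (\int[m]_x (limn (fun n => (v n x `^ q)%:E)))%E); last first.
    apply: eq_integral => x _; apply/esym/cvg_lim => //.
    apply: cvg_near_cst.
    have [N _ BN] : (\bigcup_k B k) x by rewrite -BT.
    have [K hK] : exists K, `|u x| < K%:R.
      by exists (Num.trunc `|u x|).+1; exact: truncnS_gt.
    exists (maxn N K) => // n /= hn; rewrite /v indicE mem_set; last first.
      by move: BN; apply/subsetPset/ndB; rewrite (leq_trans (leq_maxl _ _) hn).
    rewrite mulr1 min_l// (le_trans (ltW hK))// ler_nat.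
    by rewrite (leq_trans (leq_maxr _ _) hn).
  apply: cvg_monotone_convergence => //.
  - by move=> n x _; rewrite lee_fin powR_ge0.
  - move=> x _ n k nk; rewrite lee_fin ge0_ler_powR ?nnegrE ?(ltW q0)//.
    rewrite /v ler_pM ?le_min ?normr_ge0 ?ler0n//.
      by rewrite !ge_min lexx/= ler_nat nk orbT.
    rewrite !indicE; have [h1|//] := boolP (x \in B n).
    rewrite mem_set//; move: h1; rewrite inE.
    exact: (subsetPset _ _ (ndB _ _ nk)).
have : (\int[m]_x ((`|u x| `^ q)%:E) <= (M `^ q)%:E)%E.
  rewrite -(cvg_lim _ cvI)//; apply: lime_le; first by apply/cvg_ex; eexists; exact: cvI.
  by apply: nearW => n; exact: IM.
rewrite (_ : (\int[m]_x _)%E = ('N[m]_q%:E[EFin \o u] `^ q)%E); last first.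
  by rewrite poweR_Lnorm ?gt_eqF.
move=> h; have N0 := Lnorm_ge0 m q%:E (EFin \o u).
have : (('N[m]_q%:E[EFin \o u] `^ q) `^ q^-1 <= (M `^ q)%:E `^ q^-1)%E.
  apply: gt0_ler_poweR; rewrite ?invr_ge0 ?(ltW q0)// in_itv/= leey ?poweR_ge0//.
  by rewrite lee_fin powR_ge0.
by rewrite -poweRrM poweR_EFin -powRrM divff ?gt_eqF// poweRe1// powRr1.
Qed.

End duality.

(** * Test functions *)

Section flat_functions.
Context {R : realType}.
Notation mu := (@lebesgue_measure R).

Lemma is_derive_chain (f g : R -> R) (x a b : R) :
  is_derive (g x) (1 : R) f a -> is_derive x (1 : R) g b ->
  is_derive x (1 : R) (fun y => f (g y)) (a * b).
Proof. exact: is_derive1_comp. Qed.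

Lemma is_derive_mulfun (f g : R -> R) (x a b : R) :
  is_derive x (1 : R) f a -> is_derive x (1 : R) g b ->
  is_derive x (1 : R) (fun y => f y * g y) (f x * b + g x * a).
Proof. exact: is_deriveM. Qed.

(* A function that is smooth on the whole line for l > 0 and tends to x_+^b as l -> 0. *)
Definition flat (b l x : R) : R := if 0 < x then x `^ b * expR (- (l / x)) else 0.

Lemma flat_ge0 b l x : 0 <= flat b l x.
Proof. by rewrite /flat; case: ifP => // _; rewrite mulr_ge0 ?powR_ge0 ?expR_ge0. Qed.

Lemma flat_le0 b l x : x <= 0 -> flat b l x = 0.
Proof. by rewrite /flat leNgt; case: ifP. Qed.

(** The exponential beats every power: exp(y / n) >= y / n gives exp(-y) <= (n / y)^n for y = l / x,
    and n > |2 - b| leaves at least x^2. This is what makes the derivative at 0 vanish. *)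
Lemma flat_small b l : 0 < l ->
  exists2 C : R, 0 <= C & forall x, 0 < x <= 1 -> flat b l x <= C * x ^+ 2.
Proof.
move=> l0; pose n := (Num.trunc `|2 - b|).+1.
have hn : `|2 - b| < n%:R by exact: truncnS_gt.
have n0 : 0 < n%:R :> R by rewrite ltr0n.
exists ((n%:R / l) ^+ n) => [|x /andP[x0 x1]]; first by rewrite exprn_ge0// divr_ge0 ?ltW.
rewrite /flat x0.
have y0 : 0 < l / x by rewrite divr_gt0.
have h : expR (- (l / x)) <= (n%:R / l * x) ^+ n.
  rewrite expRN -[leRHS]invrK lef_pV2 ?posrE ?expR_gt0 ?invr_gt0 ?exprn_gt0 ?mulr_gt0 ?invr_gt0//.
  rewrite -exprVn !invfM invrK.
  have -> : expR (l / x) = expR (l / x / n%:R) ^+ n.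
    by rewrite -expRM_natl mulrCA divff ?mulr1// gt_eqF.
  rewrite lerXn2r ?nnegrE ?expR_ge0 ?mulr_ge0 ?invr_ge0 ?(ltW x0) ?(ltW l0) ?ler0n//.
  apply: le_trans (expR_ge1Dx _).
  by rewrite [n%:R^-1 * l]mulrC mulrAC lerDr.
apply: (le_trans (ler_wpM2l (powR_ge0 _ _) h)).
rewrite exprMn mulrCA ler_wpM2l ?exprn_ge0 ?divr_ge0 ?(ltW l0) ?(ltW n0)//.
rewrite -!powR_mulrn ?(ltW x0)// -powRD ?(gt_eqF x0) ?implybT//.
rewrite (_ : b + n%:R = 2 + (b + n%:R - 2)); last by ring.
rewrite powRD ?(gt_eqF x0) ?implybT// ler_piMr ?powR_ge0//.
apply: (@le_trans _ _ (1 `^ (b + n%:R - 2))); last by rewrite powR1.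
rewrite ge0_ler_powR ?nnegrE ?(ltW x0)//.
by have := ler_norm (2 - b); lra.
Qed.

(** The derivative is again a combination of [flat] functions, valid also at 0; hence the family is
    closed under differentiation and all its members are smooth. *)
Lemma is_derive_flat b l (x : R) : 0 < l ->
  is_derive x (1 : R) (flat b l) (b * flat (b - 1) l x + l * flat (b - 2) l x).
Proof.
move=> l0; have [x0|x0|x0] := ltgtP x 0.
- rewrite !flat_le0 ?ltW// !mulr0 addr0.
  apply: (@near_eq_is_derive _ _ _ (cst 0)) => //.
  near=> y; rewrite flat_le0//; near: y.
  by apply: filterS (lt_nbhsl x0) => y /ltW.
- rewrite {2 3}/flat x0.
  apply: (@near_eq_is_derive _ _ _ (fun y : R => y `^ b * expR (- (l * y^-1)))).
    near=> y; rewrite /flat ifT//; near: y; exact: lt_nbhsr.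
  have h1 := is_derive1_powR b x0.
  have h2 : is_derive x (1 : R) (fun y : R => - (l * y^-1)) (l * x ^- 2).
    have hV : is_derive x (1 : R) (fun y : R => y^-1) (- x ^- 2 *: 1).
      by apply: is_deriveV; rewrite ?gt_eqF//; exact: is_derive_id.
    rewrite (_ : (fun y : R => - (l * y^-1)) = - (l \*: (fun y : R => y^-1)))//.
    apply: (is_derive_eq (is_deriveN (is_deriveZ l hV))).
    by rewrite /GRing.scale/= mulr1 mulrN opprK.
  have h3 := @is_derive_chain expR (fun y => - (l * y^-1)) x _ _ (is_derive_expR _) h2.
  apply: (is_derive_eq (is_derive_mulfun h1 h3)).
  have -> : x `^ (b - 2) = x `^ b * x ^- 2.
    by rewrite powRD ?(gt_eqF x0) ?implybT// powRN powR_mulrn// ltW.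
  ring.
- rewrite x0 !flat_le0// !mulr0 addr0.
  have [C C0 hC] := flat_small b l0.
  have h : (fun h : R => h^-1 *: ((flat b l \o shift 0) (h *: 1) - flat b l 0)) @ 0^' --> (0 : R).
    apply/cvgr0Pnorm_lt => e e0; near=> h.
    rewrite (flat_le0 b l (lexx (0 : R))) subr0 /= addr0 /GRing.scale/= mulr1.
    have h1 : `|h| < Num.min 1 (e / (C + 1)).
      by near: h; apply: dnbhs0_lt; rewrite lt_min ltr01 divr_gt0// ltr_wpDl.
    move: h1; rewrite lt_min ltr_pdivlMr ?ltr_wpDl// => /andP[h1 h2].
    have [hle|hgt] := leP h 0; first by rewrite flat_le0// mulr0 normr0.
    rewrite normrM normfV (ger0_norm (flat_ge0 _ _ _)) !gtr0_norm//.
    rewrite gtr0_norm// in h1 h2.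
    rewrite mulrC ltr_pdivrMr//; apply: (@le_lt_trans _ _ (C * h ^+ 2)).
      by apply: hC; rewrite hgt ltW.
    apply: (@lt_trans _ _ ((h * (C + 1)) * h)); last by rewrite ltr_pM2r.
    by rewrite expr2 mulrA ltr_pM2r// [h * _]mulrC ltr_pM2r// ltrDl.
  apply: DeriveDef; first by apply/cvg_ex; exists 0.
  exact: cvg_lim h.
Unshelve. all: by end_near. Qed.

Lemma continuous_flat b l : 0 < l -> continuous (flat b l).
Proof.
move=> l0 x; apply: differentiable_continuous; apply/derivable1_diffP.
by apply: ex_derive; exact: is_derive_flat.
Qed.

Lemma flat_gt0 b l x : 0 < x -> 0 < flat b l x.
Proof. by move=> x0; rewrite /flat x0 mulr_gt0 ?powR_gt0 ?expR_gt0. Qed.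

Definition cutoff0 (x : R) := flat 0 1 x * flat 0 1 (1 - x).

Lemma cutoff0_ge0 x : 0 <= cutoff0 x.
Proof. by rewrite mulr_ge0 ?flat_ge0. Qed.

Lemma cutoff0_out x : (x <= 0) || (1 <= x) -> cutoff0 x = 0.
Proof.
by rewrite /cutoff0 => /orP[x0|x1]; [rewrite flat_le0 ?mul0r|rewrite mulrC flat_le0 ?mul0r// subr_le0].
Qed.

Lemma continuous_cutoff0 : continuous cutoff0.
Proof.
move=> x; apply: cvgM; first exact: continuous_flat.
apply: (@continuous_comp _ _ _ (fun x : R => 1 - x) (flat 0 1)).
  by apply: cvgB; [exact: cvg_cst|exact: cvg_id].
exact: continuous_flat.
Qed.

Lemma flat0_le1 l x : 0 <= l -> flat 0 l x <= 1.
Proof.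
move=> l0; rewrite /flat; case: ifPn => [x0|_]; last exact: ler01.
by rewrite powRr0 mul1r -expR0 ler_expR oppr_le0 divr_ge0// ltW.
Qed.

Lemma cutoff0_le1 x : cutoff0 x <= 1.
Proof. by rewrite /cutoff0 -[leRHS]mulr1 ler_pM ?flat_ge0 ?(flat0_le1 _ ler01). Qed.

Lemma measurable_cutoff0 (D : set R) : measurable_fun D cutoff0.
Proof.
by apply: measurable_funTS; apply: continuous_measurable_fun; exact: continuous_cutoff0.
Qed.

Lemma integrable_cutoff0 (D : set (measurableTypeR R)) : measurable D -> mu.-integrable D (EFin \o cutoff0).
Proof.
move=> mD.
apply: (@integrableS _ _ _ _ setT) => //.
apply: (@le_integrable _ _ _ _ setT _ _ (EFin \o \1_(`[0, 1]%classic : set (measurableTypeR R)))) => //.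
- by apply/measurable_EFinP; exact: measurable_cutoff0.
- move=> x _ /=; rewrite lee_fin ger0_norm ?cutoff0_ge0// indicE.
  have [h|h] := boolP (x \in _); first by rewrite normr1 cutoff0_le1.
  rewrite normr0 cutoff0_out//; move: h; rewrite notin_setE/= in_itv/= => /negP.
  by rewrite negb_and -!ltNge => /orP[/ltW->//|/ltW->]; rewrite orbT.
- apply/integrableP; split; first exact/measurable_EFinP.
  under eq_integral do rewrite gee0_abs ?lee_fin//.
  rewrite integral_indic// setIT.
  apply: (@le_lt_trans _ _ (mu `[0%R, 1%R]%classic)) => //.
  by rewrite lebesgue_measure_itv/= lte_fin ltr01 -EFinD ltry.
Qed.

Definition bint x : R := (\int[mu]_(t in [set` Interval -oo%O (BRight x)]) cutoff0 t)%R.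

Lemma is_derive_bint (x : R) : is_derive x (1 : R) bint (cutoff0 x).
Proof.
have [h1 h2] : derivable bint x 1 /\ bint^`()%classic x = cutoff0 x.
  apply: (@continuous_FTC1 R cutoff0 -oo%O x (x + 1)).
  - by rewrite ltrDl.
  - by apply: integrable_cutoff0; exact: measurable_itv.
  - by rewrite /Order.lt/=.
  - exact: continuous_cutoff0.
by split; [exact: h1|exact: (etrans (esym (derive1E _ _)) h2)].
Qed.

Lemma bint_le0 x : x <= 0 -> bint x = 0.
Proof.
move=> x0; rewrite /bint (@eq_Rintegral _ _ _ _ _ (cst 0)) ?Rintegral_cst ?mul0r//.
move=> y; rewrite inE/= in_itv/= => yx.
by rewrite cutoff0_out// (le_trans yx x0).
Qed.

Lemma bint_ge1 x : 1 <= x -> bint x = bint 1.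
Proof.
move=> x1; rewrite /bint !(Rintegral_mkcond _ [set` _]); congr Rintegral.
apply/funext => y; rewrite !patchE; case: ifPn; case: ifPn => //.
- rewrite notin_setE/= in_itv/= => /negP; rewrite -ltNge => y1 _.
  by rewrite cutoff0_out// (ltW y1) orbT.
- rewrite inE/= in_itv/= => y1; rewrite notin_setE/= in_itv/= => /negP.
  by rewrite (le_trans y1 x1).
Qed.

Let continuous_bint (A : set R) : {within A, continuous bint}.
Proof.
apply: continuous_subspaceT => z; apply: differentiable_continuous.
by apply/derivable1_diffP; apply: ex_derive; exact: is_derive_bint.
Qed.

Lemma bint_ndecr x y : x <= y -> bint x <= bint y.
Proof.
move=> xy; have [c _ h] := MVT_segment xy (fun x _ => is_derive_bint x) (@continuous_bint _).
by rewrite -subr_ge0 h mulr_ge0 ?cutoff0_ge0 ?subr_ge0.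
Qed.

Lemma bint1_gt0 : 0 < bint 1.
Proof.
have [c hc h] := MVT ltr01 (fun x _ => is_derive_bint x) (@continuous_bint _).
rewrite (bint_le0 (lexx (0 : R))) !subr0 mulr1 in h; rewrite h.
move: hc; rewrite in_itv/= => /andP[c0 c1].
by rewrite /cutoff0 mulr_gt0 ?flat_gt0 ?subr_gt0.
Qed.

(** [bint 1] is the total mass of [cutoff0], so [cutoff] is a bump of integral one on [0, 1], [step]
    its primitive rising from 0 to 1, and [dcutoff] its derivative spelled out in [flat]
    functions. *)
Definition cutoff x := (bint 1)^-1 * cutoff0 x.
Definition step x := (bint 1)^-1 * bint x.
Definition dcutoff x := (bint 1)^-1 *
  (flat (-2) 1 x * flat 0 1 (1 - x) - flat 0 1 x * flat (-2) 1 (1 - x)).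

Lemma is_derive_step (x : R) : is_derive x (1 : R) step (cutoff x).
Proof. exact: (is_deriveZ (bint 1)^-1 (is_derive_bint x)). Qed.

Lemma is_derive_cutoff (x : R) : is_derive x (1 : R) cutoff (dcutoff x).
Proof.
apply: is_deriveZ.
have h1 : is_derive x (1 : R) (flat 0 1) (flat (-2) 1 x).
  apply: is_derive_eq; first exact: (is_derive_flat 0 x ltr01).
  by rewrite mul0r mul1r add0r sub0r.
have h2 : is_derive x (1 : R) (fun y : R => flat 0 1 (1 - y)) (- flat (-2) 1 (1 - x)).
  have h : is_derive x (1 : R) (fun y : R => 1 - y) (-1).
    by apply: is_derive_eq; ring.
  apply: is_derive_eq; first exact: (@is_derive_chain (flat 0 1) (fun y => 1 - y) x _ _ (is_derive_flat _ _ ltr01) h).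
  by rewrite mul0r mul1r add0r sub0r mulrN1.
apply: (is_derive_eq (is_derive_mulfun h1 h2)); ring.
Qed.

Lemma step_le0 x : x <= 0 -> step x = 0.
Proof. by move=> x0; rewrite /step (bint_le0 x0) mulr0. Qed.

Lemma step_ge1 x : 1 <= x -> step x = 1.
Proof. by move=> x0; rewrite /step (bint_ge1 x0) mulVf// gt_eqF// bint1_gt0. Qed.

Lemma step_ndecr x y : x <= y -> step x <= step y.
Proof. by move=> xy; rewrite ler_wpM2l ?invr_ge0 ?(ltW bint1_gt0)// bint_ndecr. Qed.

Lemma step_ge0 x : 0 <= step x.
Proof.
have [x0|x0] := leP x 0; first by rewrite step_le0.
by rewrite -(step_le0 (lexx 0)) step_ndecr// ltW.
Qed.

Lemma step_le1 x : step x <= 1.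
Proof.
have [x1|x1] := leP x 1; last by rewrite step_ge1// ltW.
by rewrite -(step_ge1 (lexx 1)) step_ndecr.
Qed.

Lemma cutoff_ge0 x : 0 <= cutoff x.
Proof. by rewrite mulr_ge0 ?cutoff0_ge0// invr_ge0 ltW// bint1_gt0. Qed.

Lemma cutoff_out x : (x <= 0) || (1 <= x) -> cutoff x = 0.
Proof. by move=> h; rewrite /cutoff cutoff0_out ?mulr0. Qed.

Lemma cutoff_le x : cutoff x <= (bint 1)^-1.
Proof. by rewrite ler_piMr ?cutoff0_le1// invr_ge0 ltW// bint1_gt0. Qed.

Lemma dcutoff_out x : (x <= 0) || (1 <= x) -> dcutoff x = 0.
Proof.
by rewrite /dcutoff => /orP[x0|x1];
  rewrite ?(flat_le0 _ _ x0) ?mul0r ?subr0 ?mulr0//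
   !(@flat_le0 _ _ (1 - x)) ?subr_le0// !mulr0 subr0 mulr0.
Qed.

(** With y = 1 / x this is y^2 exp(-y) <= 4, from exp y = exp(y / 2)^2 >= (y / 2)^2. *)
Lemma flatN2_le x : flat (-2) 1 x <= 4.
Proof.
rewrite /flat; case: ifPn => [x0|_]; last by [].
have ix0 : 0 < x^-1 by rewrite invr_gt0.
rewrite div1r powRN powR_mulrn ?(ltW x0)// expRN -invfM.
rewrite -[leRHS]invrK lef_pV2 ?posrE ?invr_gt0 ?mulr_gt0 ?exprn_gt0 ?expR_gt0//.
have h : (x^-1 / 2) ^+ 2 <= expR x^-1.
  rewrite {2}[x^-1](_ : _ = 2%:R * (x^-1 / 2)); last by field; rewrite gt_eqF.
  rewrite expRM_natl lerXn2r ?nnegrE ?expR_ge0 ?divr_ge0 ?(ltW ix0)//.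
  by apply: le_trans (expR_ge1Dx _); rewrite lerDr.
apply: (@le_trans _ _ (x ^+ 2 * (x^-1 / 2) ^+ 2)); last by rewrite ler_wpM2l ?sqr_ge0.
by rewrite -exprMn mulrA divff ?gt_eqF// mul1r; lra.
Qed.

Lemma dcutoff_le x : `|dcutoff x| <= (bint 1)^-1 * 4.
Proof.
rewrite /dcutoff normrM ger0_norm ?invr_ge0 ?(ltW bint1_gt0)//.
rewrite ler_wpM2l ?invr_ge0 ?(ltW bint1_gt0)//.
have := flatN2_le x; have := flatN2_le (1 - x).
have := flat_ge0 (-2) 1 x; have := flat_ge0 (-2) 1 (1 - x).
have := flat0_le1 x ler01; have := flat0_le1 (1 - x) ler01.
have := flat_ge0 0 1 x; have := flat_ge0 0 1 (1 - x).
move: (flat (-2) 1 x) (flat (-2) 1 (1-x)) (flat 0 1 x) (flat 0 1 (1-x)) => A B C D.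
move=> D0 C0 D1 C1 B0 A0 B4 A4.
have h1 : A * D <= 4 by rewrite -[leRHS]mulr1 ler_pM.
have h2 : C * B <= 4 by rewrite -[leRHS]mul1r ler_pM.
have h3 : 0 <= A * D by rewrite mulr_ge0.
have h4 : 0 <= C * B by rewrite mulr_ge0.
by rewrite ler_norml; apply/andP; split; lra.
Qed.

End flat_functions.

Section test_functions.
Context {R : realType} {d : nat}.
Notation Z := (R * 'rV[R]_d)%type.

Definition affine (ell a : Z -> R) := continuous ell /\
  forall h v z, ell (h *: v + z) = h * a v + ell z.

(** A syntactic class that is closed under directional derivatives and consists of continuous
    functions, so that the conditions on all iterated derivatives in [smooth_open] follow by
    induction on the list of directions. [step] fits in because its derivative is a constant times a
    product of two [flat] functions. *)
Inductive tame : (Z -> R) -> Prop :=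
| tame_cst c : tame (fun=> c)
| tame_flat b l ell a : 0 < l -> affine ell a -> tame (fun z => flat b l (ell z))
| tame_step ell a : affine ell a -> tame (fun z => step (ell z))
| tame_add f g : tame f -> tame g -> tame (fun z => f z + g z)
| tame_mul f g : tame f -> tame g -> tame (fun z => f z * g z).

Lemma is_derive_line (f : Z -> R) (z v : Z) (k : R -> R) (dk : R) :
  (forall t, f (t *: v + z) = k t) -> is_derive (0 : R) (1 : R) k dk ->
  is_derive z v f dk.
Proof.
move=> fk [dk1 dk2].
have E : (fun h : R => h^-1 *: ((f \o shift z) (h *: v) - f z)) =
         (fun h : R => h^-1 *: ((k \o shift 0) (h *: (1 : R)) - k 0)).
  apply/funext => h /=; rewrite fk addr0 /GRing.scale/= mulr1.
  by congr (_ * (_ - _)); rewrite -fk scale0r add0r.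
by split; [rewrite /derivable E|rewrite /derive E].
Qed.

Lemma is_derive_affine (h h' : R -> R) ell a (z v : Z) : affine ell a ->
  (forall x : R, is_derive x (1 : R) h (h' x)) ->
  is_derive z v (fun z => h (ell z)) (a v * h' (ell z)).
Proof.
move=> [_ ella] dh; apply: (@is_derive_line _ _ _ (fun t => h (t * a v + ell z))).
  by move=> t; rewrite ella.
have hl : is_derive (0 : R) (1 : R) (fun t : R => t * a v + ell z) (a v).
  by apply: is_derive_eq; rewrite /GRing.scale/=; ring.
have := @is_derive_chain R h (fun t : R => t * a v + ell z) 0 _ _ (dh _) hl.
by rewrite mul0r add0r mulrC.
Qed.

Lemma tame_derive f : tame f -> continuous f /\
  forall v, exists2 g, tame g & forall z, is_derive z v f (g z).
Proof.
elim => {f} [c|b l ell a l0 ha|ell a ha|f g tf [cf df] tg [cg dg]|f g tf [cf df] tg [cg dg]].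
- split; first exact: cst_continuous.
  move=> v; exists (fun=> 0); first exact: tame_cst.
  by move=> z; exact: is_derive_cst.
- split.
    by move=> z; apply: continuous_comp; [exact: ha.1|exact: continuous_flat].
  move=> v; exists (fun z => a v * (b * flat (b - 1) l (ell z) + l * flat (b - 2) l (ell z))).
    by apply: tame_mul; [exact: tame_cst|apply: tame_add; apply: tame_mul;
      solve [exact: tame_cst|exact: (tame_flat _ l0 ha)]].
  move=> z; apply: (is_derive_affine (h := flat b l)
    (h' := fun x => b * flat (b - 1) l x + l * flat (b - 2) l x) _ _ ha) => x.
  exact: is_derive_flat.
- split.
    move=> z; apply: continuous_comp; first exact: ha.1.
    apply: differentiable_continuous; apply/derivable1_diffP.
    by apply: ex_derive; exact: is_derive_step.
  move=> v; exists (fun z => a v * ((bint 1)^-1 * (flat 0 1 (ell z) * flat 0 1 (1 - ell z)))).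
    have ha' : affine (fun z => 1 - ell z) (fun v => - a v).
      split; first by move=> z; apply: cvgB; [exact: cvg_cst|exact: ha.1].
      by move=> t w z; rewrite ha.2; ring.
    by apply: tame_mul; [exact: tame_cst|apply: tame_mul; [exact: tame_cst|apply: tame_mul]];
      [exact: (tame_flat _ ltr01 ha)|exact: (tame_flat _ ltr01 ha')].
  by move=> z; apply: (is_derive_affine (h := step) (h' := cutoff)) => //; exact: is_derive_step.
- split; first by move=> z; apply: cvgD; [exact: cf|exact: cg].
  move=> v; have [f' tf' df'] := df v; have [g' tg' dg'] := dg v.
  exists (fun z => f' z + g' z); first exact: tame_add.
  by move=> z; exact: is_deriveD.
- split; first by move=> z; apply: cvgM; [exact: cf|exact: cg].
  move=> v; have [f' tf' df'] := df v; have [g' tg' dg'] := dg v.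
  exists (fun z => f z * g' z + g z * f' z).
    by apply: tame_add; apply: tame_mul.
  by move=> z; exact: is_deriveM.
Qed.

Lemma tame_iter_derive s f : tame f -> tame (iter_derive s f).
Proof.
move=> tf; elim: s => //= v s ih.
have [_ /(_ v)[g tg dg]] := tame_derive ih.
rewrite (_ : 'D_v (iter_derive s f) = g)//.
by apply/funext => z; have [_ ->] := dg z.
Qed.

Lemma tame_Cc_smooth A K f : tame f -> compact K -> K `<=` A ->
  (forall z, A z -> ~ K z -> f z = 0) -> Cc_smooth A f.
Proof.
move=> tf cK KA f0; split; last by exists K.
exists setT, f; split => //; first exact: openT.
move=> s z _; have [cs ds] := tame_derive (tame_iter_derive s tf).
by split; [exact: cs|move=> v; have [g _ /(_ z)[]] := ds v].
Qed.

Lemma affine_time (c1 c0 : R) :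
  affine (fun z => c1 * z.1 + c0) (fun v => c1 * v.1).
Proof.
split; last by move=> h v z /=; rewrite /GRing.scale/=; ring.
move=> z; apply: cvgD; last exact: cvg_cst.
by apply: cvgM; [exact: cvg_cst|exact: cvg_fst].
Qed.

Lemma affine_space (c1 c0 : R) (i : 'I_d) :
  affine (fun z => c1 * z.2 ord0 i + c0) (fun v => c1 * v.2 ord0 i).
Proof.
split; last by move=> h v z /=; rewrite !mxE; ring.
move=> z; apply: cvgD; last exact: cvg_cst.
apply: cvgM; first exact: cvg_cst.
apply: (@continuous_comp _ _ _ (@snd R 'rV[R]_d) (fun x : 'rV[R]_d => x ord0 i)).
  exact: cvg_snd.
exact: coord_continuous.
Qed.

Definition tame1 (c : R -> R) := forall ell a, affine ell a -> tame (fun z => c (ell z)).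

Lemma tame1_flat b l : 0 < l -> tame1 (flat b l).
Proof. by move=> l0 ell a h; exact: (tame_flat _ l0 h). Qed.

Lemma affine_comp (c1 c0 : R) ell a : affine ell a ->
  affine (fun z => c1 * ell z + c0) (fun v => c1 * a v).
Proof.
move=> [ce h]; split; last by move=> t v z; rewrite h; ring.
move=> z; apply: cvgD; last exact: cvg_cst.
by apply: cvgM; [exact: cvg_cst|exact: ce].
Qed.

Lemma tame1_affine c (c1 c0 : R) : tame1 c -> tame1 (fun x => c (c1 * x + c0)).
Proof. by move=> tc ell a h; exact: (tc _ _ (affine_comp c1 c0 h)). Qed.

Lemma tame1_step : tame1 step.
Proof. by move=> ell a h; exact: (tame_step h). Qed.

Lemma tame1_cst c : tame1 (fun=> c).
Proof. by move=> ell a h; exact: tame_cst. Qed.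

Lemma tame1_add c e : tame1 c -> tame1 e -> tame1 (fun x => c x + e x).
Proof. by move=> tc te ell a h; exact: (tame_add (tc _ _ h) (te _ _ h)). Qed.

Lemma tame1_mul c e : tame1 c -> tame1 e -> tame1 (fun x => c x * e x).
Proof. by move=> tc te ell a h; exact: (tame_mul (tc _ _ h) (te _ _ h)). Qed.

Lemma tame1_cutoff : tame1 cutoff.
Proof.
apply: tame1_mul; first exact: tame1_cst.
apply: tame1_mul; first exact: tame1_flat.
have h := @tame1_affine (flat 0 1) (-1) 1 (tame1_flat _ ltr01).
move=> ell a ha; rewrite (_ : (fun z => flat 0 1 (1 - ell z)) = (fun z => flat 0 1 (-1 * ell z + 1))).
  exact: (h _ _ ha).
by apply/funext => z; rewrite mulN1r addrC.
Qed.

Lemma tame_prod (I : Type) (r : seq I) (F : I -> Z -> R) :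
  (forall i, tame (F i)) -> tame (fun z => \prod_(i <- r) F i z).
Proof.
move=> tF; elim: r => [|i r ih].
  by under eq_fun do rewrite big_nil; exact: tame_cst.
by under eq_fun do rewrite big_cons; apply: tame_mul.
Qed.

End test_functions.

(** * The Beta and Gamma integrals *)

Section special_functions.
Context {R : realType}.
Notation mu := (@lebesgue_measure R).
Notation T1 := (measurableTypeR R).
Variable al : R.
Hypothesis hal : 0 < al < 1.

Let al0 : 0 < al. Proof. by case/andP: hal. Qed.
Let al1 : 0 < 1 - al. Proof. by rewrite subr_gt0; case/andP: hal. Qed.

(** The Beta integral B(1 - al, al), kept in the extended reals until [ebeta_fin_gt0] shows that it
    is finite. *)
Definition ebeta : \bar R := (\int[mu]_s (riesz (1 - al) s * riesz al (1 - s))%:E)%E.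

Lemma measurable_beta_fun (r t : R) :
  measurable_fun [set: T1] (fun s : T1 => riesz (1 - al) (s - r) * riesz al (t - s)).
Proof.
apply: measurable_funM; apply: (measurableT_comp (measurable_riesz _));
  exact: measurable_funB.
Qed.

Lemma integral_riesz_le (dl r : R) : 0 < dl -> 0 < r ->
  (\int[mu]_(s in `]0%R, r[) (riesz dl s)%:E <= (r `^ dl / dl)%:E)%E.
Proof.
move=> dl0 r0; rewrite (eq_integral (fun x : T1 => (x `^ (dl - 1))%:E)).
  exact: integral_powR_near.
by move=> x; rewrite inE/= in_itv/= /riesz => /andP[-> _].
Qed.

(** Positive since the integrand is at least 1 on [1/4, 3/4]; finite since on each half of ]0, 1[
    one of the two factors is at most 2 and the other is an integrable power. *)
Lemma ebeta_fin_gt0 : (0 < ebeta < +oo)%E.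
Proof.
have a0 := al0; have a1 := al1.
have m01 := measurable_beta_fun 0 1.
have m0 : measurable_fun [set: T1] (fun s : T1 => (riesz (1 - al) s * riesz al (1 - s))%:E).
  by apply/measurable_EFinP; under eq_fun do rewrite -[X in riesz (1 - al) X]subr0.
have mr dl (D : set T1) : measurable_fun D (fun s : T1 => (riesz dl s)%:E).
  by apply/measurable_EFinP; apply: measurable_funTS; exact: measurable_riesz.
have r1 dl : measurable_fun [set: T1] (fun s : T1 => (riesz dl (1 - s))%:E).
  by apply/measurable_EFinP; apply: (measurableT_comp (measurable_riesz _)); exact: measurable_funB.
have pge (y r : R) : 0 < y -> y < 1 -> r <= 0 -> 1 <= y `^ r.
  move=> y0 y1 r0; rewrite -[r]opprK powRN -[leLHS]invr1.
  rewrite lef_pV2 ?posrE ?powR_gt0//.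
  apply: (@le_trans _ _ (1 `^ (- r))); last by rewrite powR1.
  by rewrite ge0_ler_powR ?nnegrE ?oppr_ge0// ltW.
have key (x : R) : 1 / 4 <= x -> x <= 3 / 4 -> 1 <= riesz (1 - al) x * riesz al (1 - x).
  move=> x1 x2; rewrite /riesz ifT; last by lra.
  rewrite ifT; last by lra.
  have h1 : 1 <= x `^ (1 - al - 1) by apply: pge; lra.
  have h2 : 1 <= (1 - x) `^ (al - 1) by apply: pge; lra.
  by rewrite -[leLHS]mulr1 ler_pM.
have bnd (y e : R) : 2^-1 <= y -> y < 1 -> 0 < e < 1 -> riesz e y <= 2.
  move=> y2 y1 /andP[e0 e1]; have y0 : 0 < y by apply: lt_le_trans y2.
  rewrite /riesz y0 -opprB powRN -[leRHS]invrK lef_pV2 ?posrE ?powR_gt0//.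
  apply: (@le_trans _ _ y); first exact: y2.
  rewrite -[leLHS]powRr1 ?(ltW y0)// -[X in _ `^ X <= _](subrK e).
  rewrite powRD ?(gt_eqF y0) ?implybT//.
  rewrite ler_piMr ?powR_ge0//.
  apply: (@le_trans _ _ (1 `^ e)); last by rewrite powR1.
  by rewrite ge0_ler_powR ?nnegrE ?(ltW e0) ?(ltW y0)// ltW.
have key2 (x : R) : riesz (1 - al) x * riesz al (1 - x) <=
    2 * riesz (1 - al) x * \1_(`]0, 1[%classic : set T1) x +
    2 * riesz al (1 - x) * \1_(`]0, 1[%classic : set T1) (1 - x).
  have [x0|x0] := leP x 0.
    by rewrite {1}/riesz ltNge x0/= mul0r addr_ge0// mulr_ge0// mulr_ge0// riesz_ge0.
  have [x1|x1] := leP 1 x.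
    rewrite [X in _ * X <= _]/riesz ltNge subr_le0 x1/= mulr0.
    by rewrite addr_ge0// mulr_ge0// mulr_ge0// riesz_ge0.
  rewrite !indicE !mem_set /=; last 2 first.
  - by rewrite in_itv/=; lra.
  - by rewrite in_itv/=; lra.
  rewrite !mulr1.
  have [x2|x2] := leP x 2^-1.
    apply: (@le_trans _ _ (2 * riesz (1 - al) x)).
      rewrite mulrC ler_wpM2r ?riesz_ge0// bnd//; lra.
    by rewrite lerDl mulr_ge0 ?riesz_ge0.
  apply: (@le_trans _ _ (2 * riesz al (1 - x))).
    rewrite ler_wpM2r ?riesz_ge0// bnd ?(ltW x2)//; lra.
  by rewrite lerDr mulr_ge0 ?riesz_ge0.
apply/andP; split.
  apply: (@lt_le_trans _ _ (\int[mu]_(s in `[(1/4)%R, (3/4)%R]) (1 : R)%:E)%E).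
    rewrite integral_cst//= lebesgue_measure_itv/= lte_fin mul1e ifT; last by lra.
    by rewrite -EFinD lte_fin; lra.
  apply: (@le_trans _ _ (\int[mu]_(s in `[(1/4)%R, (3/4)%R]) (riesz (1 - al) s * riesz al (1 - s))%:E)%E).
    apply: ge0_le_integral => //.
    - exact: measurable_funTS.
    - by move=> x; rewrite /= in_itv/= => /andP[x1 x2]; rewrite lee_fin; exact: key.
  by apply: ge0_subset_integral => //= x _; rewrite lee_fin mulr_ge0 ?riesz_ge0.
have mi dl : measurable_fun [set: T1] (fun s => (2 * riesz dl s * \1_(`]0, 1[%classic : set T1) s)%:E).
  apply/measurable_EFinP; apply: measurable_funM; last exact: measurable_indic.
  by apply: measurable_funM => //; exact: measurable_riesz.
have m1s : measurable_fun [set: T1] (fun s : T1 => 1 - s : T1) by exact: measurable_funB.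
have mi' dl : measurable_fun [set: T1] (fun s : T1 => (2 * riesz dl (1 - s) * \1_(`]0, 1[%classic : set T1) (1 - s))%:E).
  exact: (measurableT_comp (mi dl) m1s).
rewrite /ebeta.
apply: (@le_lt_trans _ _ (\int[mu]_s ((2 * riesz (1 - al) s * \1_(`]0, 1[%classic : set T1) s)%:E +
    (2 * riesz al (1 - s) * \1_(`]0, 1[%classic : set T1) (1 - s))%:E))%E).
  apply: ge0_le_integral => //.
  - by move=> x _; rewrite lee_fin mulr_ge0 ?riesz_ge0.
  - exact: emeasurable_funD.
  - by move=> x _; rewrite -EFinD lee_fin; exact: key2.
have h dl : 0 < dl -> (\int[mu]_s (2 * riesz dl s * \1_(`]0%R, 1%R[%classic : set T1) s)%:E < +oo)%E.
  move=> dl0; rewrite (_ : (\int[mu]_s _)%E = (\int[mu]_(s in `]0%R, 1%R[) (2%:E * (riesz dl s)%:E))%E).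
    rewrite ge0_integralZl_EFin//; last by move=> s _; rewrite lee_fin riesz_ge0.
    rewrite lte_mul_pinfty ?lee_fin//.
    by rewrite (le_lt_trans (integral_riesz_le _ _)) ?ltry.
  rewrite [RHS]integral_mkcond; apply: eq_integral => s _; rewrite patchE indicE.
  by case: (s \in _); rewrite ?mulr1 ?mulr0 ?EFinM.
have gi dl x : (0 <= (2 * riesz dl x * \1_(`]0%R, 1%R[%classic : set T1) x)%:E)%E.
  by rewrite lee_fin mulr_ge0// mulr_ge0// riesz_ge0.
rewrite ge0_integralD//.
rewrite lte_add_pinfty ?h//.
have := @ge0_integral_affine R (-1) 1 (fun s => (2 * riesz al s * \1_(`]0, 1[%classic : set T1) s)%:E)
  _ (mi _) (gi _).
rewrite oppr_eq0 oner_eq0 normrN1 invr1 mul1e => /(_ isT).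
under [X in X = _ -> _]eq_integral do rewrite mulN1r addrC.
by move=> ->; exact: h.
Qed.

(** Substitute s = (t - r) s' + r: the exponents -al and al - 1 add up to -1, which cancels the
    Jacobian. The value therefore does not depend on t - r, and this is what inverts the fractional
    integral. *)
Lemma beta_shift (r t : R) :
  (\int[mu]_s (riesz (1 - al) (s - r) * riesz al (t - s))%:E =
   if (r < t)%R then ebeta else 0)%E.
Proof.
have [tr|rt] := leP t r.
  rewrite (eq_integral (cst 0%E)) ?integral0//.
  move=> s _; rewrite /riesz.
  case: ifPn => h1; last by rewrite mul0r.
  case: ifPn => h2; last by rewrite mulr0.
  by move: h1 h2; rewrite !subr_gt0 => h1 h2; have := lt_trans h1 h2; rewrite ltNge tr.
have tr0 : 0 < t - r by rewrite subr_gt0.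
have a0 := al0; have a1 := al1.
have mb : measurable_fun [set: T1] (fun s : T1 => (riesz (1 - al) (s - r) * riesz al (t - s))%:E).
  by apply/measurable_EFinP; exact: measurable_beta_fun.
have hb (s : R) : (0 <= (riesz (1 - al) (s - r) * riesz al (t - s))%:E)%E.
  by rewrite lee_fin mulr_ge0 ?riesz_ge0.
have := ge0_integral_affine r (lt0r_neq0 tr0) mb hb.
have sc (dl c z : R) : 0 < c -> riesz dl (c * z) = c `^ (dl - 1) * riesz dl z.
  move=> c0; rewrite /riesz pmulr_rgt0//; case: ifP => z0; last by rewrite mulr0.
  by rewrite powRM// ltW.
under [X in X = _ -> _]eq_integral => s _.
  rewrite addrK (_ : t - ((t - r) * s + r) = (t - r) * (1 - s)); last by ring.
  rewrite !sc// mulrACA -powRD ?(gt_eqF tr0) ?implybT//.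
  rewrite (_ : 1 - al - 1 + (al - 1) = -1); last by ring.
  rewrite powR_inv1 ?(ltW tr0)// EFinM.
  over.
have mb0 : measurable_fun [set: T1] (fun s : T1 => (riesz (1 - al) s * riesz al (1 - s))%:E).
  by apply/measurable_EFinP; under eq_fun do rewrite -[X in riesz (1 - al) X]subr0; exact: measurable_beta_fun.
have hb0 (s : R) : (0 <= (riesz (1 - al) s * riesz al (1 - s))%:E)%E.
  by rewrite lee_fin mulr_ge0 ?riesz_ge0.
have itr : 0 <= (t - r)^-1 by rewrite invr_ge0 (ltW tr0).
rewrite (ge0_integralZl_EFin mu measurableT (fun s _ => hb0 s) mb0 itr) -/ebeta.
rewrite (gtr0_norm tr0) => h.
have cancel (x y : \bar R) : ((t - r)^-1%:E * x = (t - r)^-1%:E * y -> y = x)%E.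
  move=> /(congr1 (fun w => (t - r)%:E * w)%E).
  by rewrite !muleA -!EFinM (divff (lt0r_neq0 tr0)) !mul1e => ->.
exact: (cancel _ _ h).
Qed.

(** [Gamma] is a real-valued integral, hence the finite part of an extended one and 0 if that is
    infinite; positivity therefore includes convergence. *)
Lemma Gamma_gt0 : 0 < Gamma (1 - al).
Proof.
have a0 := al0; have a1 := al1.
rewrite /Gamma; set I := `]0, +oo[%classic; set F := fun t : T1 => t `^ (1 - al - 1) * expR (- t).
have mF D : measurable_fun D (fun t : T1 => (F t)%:E).
  apply/measurable_EFinP; apply: measurable_funTS; apply: measurable_funM; first exact: measurable_powR.
  have mN : measurable_fun [set: T1] (fun t : T1 => - t : T1) by exact: measurable_funN.
  exact: (measurableT_comp (@measurable_expR R) mN).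
have F0 t : 0 <= F t by rewrite mulr_ge0 ?powR_ge0 ?expR_ge0.
have mI : measurable (I : set T1) by exact: measurable_itv.
rewrite /Rintegral fine_gt0//; apply/andP; split.
  apply: (@lt_le_trans _ _ (\int[mu]_(s in `[1%R, 2%R]) (2 `^ (- al) * expR (- 2))%:E)%E).
    rewrite integral_cst//= lebesgue_measure_itv/= lte_fin ifT; last by lra.
    by rewrite -EFinD -EFinM lte_fin !mulr_gt0 ?powR_gt0 ?expR_gt0; lra.
  apply: (@le_trans _ _ (\int[mu]_(s in `[1%R, 2%R]) (F s)%:E)%E).
    apply: ge0_le_integral => //.
    - move=> x; rewrite /= in_itv/= => /andP[x1 x2]; rewrite lee_fin /F.
      have x0 : 0 < x by exact: lt_le_trans x1.
      rewrite ler_pM ?powR_ge0 ?expR_ge0 ?ler_expR ?lerN2//.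
      rewrite (_ : 1 - al - 1 = - al); last by ring.
      rewrite !powRN lef_pV2 ?posrE ?powR_gt0//.
      by rewrite ge0_ler_powR ?nnegrE ?(ltW a0) ?(ltW x0)//.
  apply: ge0_subset_integral => //.
  - by move=> x _; rewrite lee_fin.
  - move=> x; rewrite /I/= !in_itv/= andbT => /andP[x1 _].
    exact: lt_le_trans x1.
(* On ]0, 1[ the exponential is dropped; on [1, +oo[ the power is at most 1 and exp(-t) <= 4 t^(-2),
   which is [flatN2_le] at 1 / t. *)
apply: (@le_lt_trans _ _ (\int[mu]_(s in `]0%R, 1%R[) (s `^ (1 - al - 1))%:E +
   \int[mu]_(s in `[1%R, +oo[) (4%:E * (s `^ (- 2))%:E))%E).
  have mp r D : measurable_fun D (fun t : T1 => (t `^ r)%:E).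
    by apply/measurable_EFinP; apply: measurable_funTS; exact: measurable_powR.
  have -> : I = `]0, 1[%classic `|` `[1, +oo[%classic.
    apply/seteqP; split => x; rewrite /I/= !in_itv/= !andbT.
      by move=> x0; have [x1|x1] := ltP x 1; [left; rewrite x0|right].
    by move=> [/andP[]//|]; exact: lt_le_trans.
  rewrite ge0_integral_setU//=; last 2 first.
  - by move=> x _; rewrite lee_fin.
  - rewrite disj_set2E; apply/eqP/seteqP; split => // x [] /=.
    by rewrite !in_itv/= andbT => /andP[_]; rewrite ltNge => /negP.
  rewrite leeD//.
    apply: ge0_le_integral => //.
    - by move=> x _; rewrite lee_fin.
    - move=> x; rewrite /= in_itv/= => /andP[x0 _]; rewrite lee_fin /F.
      by rewrite ler_piMr ?powR_ge0// -expR0 ler_expR oppr_le0 ltW.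
  apply: ge0_le_integral => //.
  - by move=> x _; rewrite lee_fin.
  - exact: measurable_funeM.
  - move=> x; rewrite /= in_itv/= andbT => x1; rewrite -EFinM lee_fin /F.
    have x0 : 0 < x by exact: lt_le_trans x1.
    apply: (@le_trans _ _ (expR (- x))).
      rewrite ler_piMl ?expR_ge0// (_ : 1 - al - 1 = - al); last by ring.
      rewrite powRN invf_le1 ?powR_gt0//.
      apply: (@le_trans _ _ (1 `^ al)); first by rewrite powR1.
      by rewrite ge0_ler_powR ?nnegrE ?(ltW a0) ?(ltW x0).
    have := @flatN2_le R x^-1; rewrite /flat invr_gt0 x0 div1r invrK.
    rewrite -powR_inv1 ?(ltW x0)// -powRrM mulrNN mul1r => h.
    by rewrite powRN ler_pdivlMr ?powR_gt0// mulrC.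
rewrite lte_add_pinfty//.
  by rewrite (le_lt_trans (integral_powR_near _ _)) ?ltry.
rewrite ge0_integralZl_EFin//.
- rewrite lte_mul_pinfty ?lee_fin//.
  by rewrite (le_lt_trans (integral_powR_far _ _)) ?ltry// ltr1n.
- by move=> x _; rewrite lee_fin powR_ge0.
- by apply/measurable_EFinP; apply: measurable_funTS; exact: measurable_powR.
Qed.

End special_functions.

(** * Tensor-product test functions *)

Section test_products.
Context {R : realType} {d : nat}.
Notation mu := (@lebesgue_measure R).
Notation T1 := (measurableTypeR R).
Notation Z := (R * 'rV[R]_d)%type.
Implicit Types (c dc : 'I_d -> R -> R) (y : 'rV[R]_d).

(** A single number B bounds the values, the derivative and the radius of the support, so that
    finitely many profiles share one constant after enlarging it. *)
Definition profile (B : R) (c dc : R -> R) :=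
  [/\ tame1 (d := d) c, forall x : R, is_derive x (1 : R) c (dc x),
      measurable_fun [set: R] dc &
      forall x, [/\ `|c x| <= B, `|dc x| <= B & B < `|x| -> c x = 0 /\ dc x = 0]].

Definition prodf c y : R := \prod_i c i (y ord0 i).

Definition upd c dc (j : 'I_d) : 'I_d -> R -> R :=
  fun i => if i == j then dc i else c i.

Variables (B : R) (c dc : 'I_d -> R -> R).
Hypothesis hc : forall i, profile B (c i) (dc i).

Lemma profile_measurable i : measurable_fun [set: R] (c i).
Proof.
have [_ h _ _] := hc i; apply: continuous_measurable_fun => x.
apply: differentiable_continuous; apply/derivable1_diffP.
by apply: ex_derive; exact: h.
Qed.

Lemma measurable_prodf (e : 'I_d -> R -> R) : (forall i, measurable_fun [set: R] (e i)) ->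
  measurable_fun [set: 'rV[R]_d] (prodf e).
Proof.
move=> me; apply: measurable_prod => i _.
by apply: (measurableT_comp (me i)); exact: measurable_rV_entry.
Qed.

Lemma measurable_upd j i : measurable_fun [set: R] (upd c dc j i).
Proof. by rewrite /upd; case: ifP => _; [have [] := hc i|exact: profile_measurable]. Qed.

Lemma prodf_bound (e : 'I_d -> R -> R) y : (forall i x, `|e i x| <= B) -> `|prodf e y| <= B ^+ d.
Proof.
move=> h; rewrite /prodf normr_prod.
apply: (@le_trans _ _ (\prod_(i < d) B)); last by rewrite prodr_const card_ord.
by apply: ler_prod => i _; rewrite normr_ge0 h.
Qed.

Lemma prodf_supp (e : 'I_d -> R -> R) y : (forall i x, B < `|x| -> e i x = 0) ->
  (exists i, B < `|y ord0 i|) -> prodf e y = 0.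
Proof. by move=> h [i Bi]; rewrite /prodf (bigD1 i)//= h// mul0r. Qed.

Lemma upd_bound j i x : `|upd c dc j i x| <= B.
Proof. by have [_ _ _ /(_ x)[? ? _]] := hc i; rewrite /upd; case: ifP. Qed.

Lemma upd_supp j i x : B < `|x| -> upd c dc j i x = 0.
Proof. by have [_ _ _ /(_ x)[_ _ h]] := hc i; move=> /h[h1 h2]; rewrite /upd; case: ifP. Qed.

Lemma profile_bound i x : `|c i x| <= B.
Proof. by have [_ _ _ /(_ x)[? ? _]] := hc i. Qed.

Lemma profile_supp i x : B < `|x| -> c i x = 0.
Proof. by have [_ _ _ /(_ x)[_ _ h]] := hc i; move=> /h[]. Qed.

Definition testf (a : R -> R) (z : Z) : R := a z.1 * prodf c z.2.

Lemma D_x_testf (a : R -> R) (j : 'I_d) z :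
  D_x j (testf a) z = a z.1 * prodf (upd c dc j) z.2.
Proof.
pose C := a z.1 * \prod_(i | i != j) c i (z.2 ord0 i).
have h : is_derive z (0, delta_mx ord0 j) (testf a) (C * dc j (z.2 ord0 j)).
  apply: (@is_derive_line _ _ _ _ _ (fun t => C * c j (t + z.2 ord0 j))).
    move=> t; rewrite /testf /= scaler0 add0r /C -mulrA; congr (_ * _).
    rewrite /prodf (bigD1 j)//= mulrC; congr (_ * _).
      apply: eq_bigr => i ij; rewrite !mxE (eq_sym i).
      by rewrite eq_sym (negbTE ij) andbF mulr0 add0r.
    by rewrite !mxE !eqxx mulr1.
  have hl : is_derive (0 : R) (1 : R) (fun t : R => t + z.2 ord0 j) (1 : R).
    by apply: is_derive_eq; rewrite addr0.
  have [_ dj _ _] := hc j.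
  have := @is_derive_chain R (c j) (fun t : R => t + z.2 ord0 j) 0 _ _ (dj _) hl.
  rewrite add0r mulr1 => hh.
  exact: (is_deriveZ C hh).
rewrite /D_x (derive_val (is_derive := h)) /C -mulrA; congr (_ * _).
rewrite /prodf [RHS](bigD1 j)//= /upd eqxx mulrC; congr (_ * _).
by apply: eq_bigr => i /negbTE ->.
Qed.

Lemma D_t_testf (a a' : R -> R) z : (forall x : R, is_derive x (1 : R) a (a' x)) ->
  D_t (testf a) z = a' z.1 * prodf c z.2.
Proof.
move=> da; have h : is_derive z (1, 0) (testf a) (prodf c z.2 * a' z.1).
  apply: (@is_derive_line _ _ _ _ _ (fun t => prodf c z.2 * a (t + z.1))).
    by move=> t; rewrite /testf /= scaler0 add0r /GRing.scale/= mulr1 mulrC.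
  have hl : is_derive (0 : R) (1 : R) (fun t : R => t + z.1) (1 : R).
    by apply: is_derive_eq; rewrite addr0.
  have := @is_derive_chain R a (fun t : R => t + z.1) 0 _ _ (da _) hl.
  rewrite add0r mulr1 => hh.
  exact: (is_deriveZ (prodf c z.2) hh).
by rewrite /D_t (derive_val (is_derive := h)) mulrC.
Qed.

Lemma Cc_smooth_testf (a : R -> R) (A : set R) (lo hi : R) : tame1 (d := d) a ->
  `[lo, hi]%classic `<=` A -> (forall x, A x -> ~ (lo <= x <= hi) -> a x = 0) ->
  Cc_smooth (A `*` setT) (testf a).
Proof.
move=> ta loA a0.
apply: (@tame_Cc_smooth _ _ _ (`[lo, hi]%classic `*`
   [set v : 'rV[R]_d | forall i, `[- B, B]%classic (v ord0 i)])).
- apply: tame_mul.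
    have := ta _ _ (affine_time (d := d) 1 0).
    by under eq_fun do rewrite mul1r addr0.
  apply: tame_prod => i; have [tc _ _ _] := hc i.
  have := tc _ _ (affine_space 1 0 i).
  by under eq_fun do rewrite mul1r addr0.
- apply: compact_setX; first exact: segment_compact.
  by apply: (@rV_compact R d (fun=> `[- B, B]%classic)) => i; exact: segment_compact.
- by move=> [s y] [/= h _]; split => //; exact: loA.
- move=> [s y] /= [As _] /not_andP[h|h].
    by rewrite /testf /= a0 ?mul0r// => h'; apply: h; rewrite in_itv.
  rewrite /testf /= prodf_supp ?mulr0//; first exact: profile_supp.
  apply: contrapT => h'; apply: h => i; rewrite /= in_itv/= -ler_norml leNgt.
  by apply/negP => hi'; apply: h'; exists i.
Qed.

End test_products.

Section local_integrability.
Context {R : realType} {d : nat}.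
Notation mu := (@lebesgue_measure R).
Notation T1 := (measurableTypeR R).
Notation Z := (R * 'rV[R]_d)%type.
Notation tx := (@lebesgue_tx R d).
Variables (p T : R).
Hypotheses (p1 : 1 < p) (T0 : 0 < T).
Local Notation D := (cyl T [set: 'rV[R]_d]).

Lemma measurable_cyl : measurable (D : set (T1 * 'rV[R]_d)).
Proof. by apply: measurableX => //; exact: measurable_itv. Qed.

Lemma in_Lp_measurable (F : Z -> R) : in_Lp p D F ->
  measurable_fun [set: T1 * 'rV[R]_d] (F \_ D).
Proof. by rewrite /in_Lp inE => /andP[]; rewrite inE. Qed.

Lemma in_Lp_fin (F : Z -> R) : in_Lp p D F -> (Lpnorm p D F < +oo)%E.
Proof. by rewrite /in_Lp inE => /andP[_]; rewrite inE. Qed.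

Definition vbox (B : R) : set 'rV[R]_d := [set v | forall i, `[- B, B]%classic (v ord0 i)].

Lemma measurable_vbox B : measurable (vbox B).
Proof.
rewrite [X in measurable X](_ : _ = \bigcap_(i in [set: 'I_d])
    ((fun v : 'rV[R]_d => v ord0 i) @^-1` `[- B, B]%classic)); last first.
  by apply/seteqP; split => v /= h i; [move=> _|]; exact: h.
apply: fin_bigcap_measurable => // i _.
rewrite -[X in measurable X]setTI.
by apply: (measurable_mx_entry ord0 i) => //; exact: measurable_itv.
Qed.

Lemma vbox_fin B : (lebesgue_rV d (vbox B) < +oo)%E.
Proof.
rewrite /vbox (@lebesgue_rV_box R d (fun=> `[- B, B]%classic)); last first.
  by move=> i; exact: measurable_itv.
rewrite (eq_bigr (fun i => (Num.max (B + B) 0)%:E)); last first.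
  move=> i _; rewrite lebesgue_measure_itv/= lte_fin.
  case: ltP => h; first by rewrite -EFinD opprK max_l//; lra.
  by rewrite max_r//; lra.
by rewrite prodEFin ltry.
Qed.

(** On the bounded set E that carries h, |F| <= |F|^p + 1; so the product is dominated by |B| (|F|^p
    + 1_E), and E has finite measure. *)
Lemma integrable_Lp_mul (F h : Z -> R) B : in_Lp p D F ->
  measurable_fun [set: T1 * 'rV[R]_d] h ->
  (forall z, D z -> `|h z| <= B) ->
  (forall z, D z -> (exists i, B < `|z.2 ord0 i|) -> h z = 0) ->
  tx.-integrable D (EFin \o (fun z => F z * h z)).
Proof.
move=> LF mh hB hsupp.
have p0 : 0 < p by exact: lt_trans p1.
have mF := in_Lp_measurable LF.
have mD := measurable_cyl.
have mFD : measurable_fun (D : set (T1 * 'rV[R]_d)) F.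
  by apply/(measurable_restrictT _ mD); exact: mF.
have fin : (\int[tx]_(z in D) (`|F z| `^ p)%:E < +oo)%E.
  have := in_Lp_fin LF; rewrite /Lpnorm => hf.
  have : ('N[tx]_p%:E[EFin \o (F \_ D)] `^ p < +oo)%E by exact: poweR_lty.
  rewrite (poweR_Lnorm tx _ (lt0r_neq0 p0)) => hf'.
  rewrite integral_mkcond; apply: le_lt_trans hf'.
  rewrite le_eqVlt; apply/orP; left; apply/eqP; apply: eq_integral => z _.
  rewrite !patchE /= patchE; case: ifPn => _; rewrite ?poweR_EFin//.
  have -> : (point : \bar R) = (0 : R)%:E by [].
  have -> : (point : R) = 0 by [].
  by rewrite [X in X `^ p]normr0 powR0// gt_eqF.
pose E : set (T1 * 'rV[R]_d) := `]0, T[%classic `*` vbox B.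
have mE : measurable E by apply: measurableX; [exact: measurable_itv|exact: measurable_vbox].
have Efin : (tx E < +oo)%E.
  rewrite /E [X in (X < _)%E](_ : _ = mu `]0%R, T[%classic * lebesgue_rV d (vbox B))%E; last first.
    by apply: product_measure1E; [exact: measurable_itv|exact: measurable_vbox].
  rewrite lte_mul_pinfty//; last exact: vbox_fin.
  by rewrite lebesgue_measure_itv/= lte_fin T0 -EFinD.
have iFp : tx.-integrable D (fun z => (`|F z| `^ p)%:E).
  apply/integrableP; split.
    apply/measurable_EFinP; apply: (measurableT_comp (measurable_powR p)).
    exact: (measurableT_comp (@normr_measurable R setT)).
  by under eq_integral do rewrite gee0_abs ?lee_fin ?powR_ge0//.
have iE : tx.-integrable D (fun z => (\1_E z)%:E).
  apply/integrableP; split; first exact/measurable_EFinP.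
  under eq_integral do rewrite gee0_abs ?lee_fin//.
  rewrite integral_indic//; apply: le_lt_trans Efin.
  by apply: le_measure; rewrite ?inE//; exact: measurableI.
have nB : 0 <= `|B| by [].
apply: (@le_integrable _ _ _ tx D mD (EFin \o (fun z => F z * h z)) (fun z => `|B|%:E * (`|F z| `^ p)%:E + `|B|%:E * (\1_E z)%:E)%E).
- apply/measurable_EFinP; apply: measurable_funM => //; exact: measurable_funTS.
- move=> z Dz /=.
  rewrite lee_fin normrM [leRHS]ger0_norm; last first.
    by rewrite addr_ge0// mulr_ge0// powR_ge0.
  have [Ez|nEz] := pselect (E z); last first.
    rewrite hsupp ?normr0 ?mulr0 ?addr_ge0 ?mulr_ge0 ?powR_ge0//.
    apply: contrapT => hh; apply: nEz; split; first by case: Dz.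
    move=> i; rewrite /= in_itv/= -ler_norml leNgt; apply/negP => hi.
    by apply: hh; exists i.
  rewrite indicE mem_set// -mulrDr [leLHS]mulrC ler_pM//.
    by rewrite (le_trans (hB z Dz))// ler_norm.
  have [h1|h1] := leP `|F z| 1.
    by rewrite (le_trans h1)// lerDr powR_ge0.
  apply: (@le_trans _ _ (`|F z| `^ p)); last by rewrite lerDl.
  rewrite -[leLHS]powRr1 ?normr_ge0 //; apply: ler_powR; exact: ltW.
- by apply: integrableD => //; exact: integrableZl.
Qed.

End local_integrability.

(** * Limits of integrals and exchange of the order of integration *)

Section integral_lemmas.
Context {R : realType}.

Lemma measurable_integral_param d1 d2 (X : measurableType d1) (Y : measurableType d2)
    (m2 : {sigma_finite_measure set Y -> \bar R}) (K : X * Y -> \bar R) :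
  measurable_fun [set: X * Y] K -> measurable_fun [set: X] (fun x => \int[m2]_y K (x, y))%E.
Proof.
move=> mK; rewrite (_ : (fun x => _) = (fun x => \int[m2]_y (K^\+)%E (x, y) - \int[m2]_y (K^\-)%E (x, y))%E); last first.
  apply/funext => x; rewrite [LHS]integralE.
  by congr (_ - _)%E; apply: eq_integral => y _; rewrite ?funeposE ?funenegE.
apply: emeasurable_funB.
  by apply: (measurable_fun_fubini_tonelli_F (K^\+)%E) => //; exact: measurable_funepos.
by apply: (measurable_fun_fubini_tonelli_F (K^\-)%E) => //; exact: measurable_funeneg.
Qed.

Lemma Rintegral_dominated d1 (X : measurableType d1) (m : {measure set X -> \bar R}) (D : set X)
    (f_ : nat -> X -> R) (f : X -> R) (g : X -> \bar R) : measurable D ->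
  (forall n, measurable_fun D (f_ n)) -> measurable_fun D f ->
  (forall x, D x -> f_ n x @[n --> \oo] --> f x) ->
  m.-integrable D g -> (forall n x, D x -> (`|f_ n x|%:E <= g x)%E) ->
  m.-integrable D (EFin \o f) /\
  \int[m]_(x in D) f_ n x @[n --> \oo] --> \int[m]_(x in D) f x.
Proof.
move=> mD mf_ mf ff ig fg.
have mfe n : measurable_fun D (EFin \o f_ n) by apply/measurable_EFinP; exact: mf_.
have mfl : measurable_fun D (EFin \o f) by apply/measurable_EFinP.
have [|h1 _ h2] := dominated_convergence mD mfe mfl _ ig (aeW _ (fun x n Dx => fg n x Dx)).
  by apply: aeW => x Dx; apply: cvg_EFin; [exact: nearW|exact: ff].
split => //; apply: fine_cvg; rewrite fineK; last exact: integrable_fin_num.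
exact: h2.
Qed.

Lemma Rintegral_sum d1 (X : measurableType d1) (m : {measure set X -> \bar R}) (D : set X)
    (I : Type) (r : seq I) (f : I -> X -> R) : measurable D ->
  (forall i, m.-integrable D (EFin \o f i)) ->
  \int[m]_(x in D) (\sum_(i <- r) f i x) = \sum_(i <- r) \int[m]_(x in D) f i x.
Proof.
move=> mD fi; rewrite /Rintegral.
rewrite (eq_integral (fun x => (\sum_(i <- r) (EFin \o f i) x)%E)); last first.
  by move=> x _; rewrite sumEFin.
rewrite (integral_sum mD fi r xpredT).
rewrite (eq_bigr (fun i => (fine (\int[m]_(x in D) (f i x)%:E))%:E)); last first.
  by move=> i _; rewrite fineK//; apply: integrable_fin_num => //; exact: fi.
by rewrite sumEFin.
Qed.

(** Only c K is assumed integrable. If c = 0 the integral of K may be infinite, but both sides are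
    then 0. *)
Lemma fine_integralZl d1 (X : measurableType d1) (m : {measure set X -> \bar R}) (c : R) (K : X -> R) :
  measurable_fun [set: X] K -> (\int[m]_x `|c * K x|%:E < +oo)%E ->
  ((c * fine (\int[m]_x (K x)%:E))%:E = \int[m]_x (c * K x)%:E)%E.
Proof.
move=> mK fK; have [->|c0] := eqVneq c 0.
  by rewrite mul0r; under eq_integral do rewrite mul0r; rewrite integral0.
have icK : m.-integrable setT (fun x => (c * K x)%:E).
  by apply/integrableP; split => //; apply/measurable_EFinP; exact: measurable_funM.
have iK : m.-integrable setT (fun x => (K x)%:E).
  have := integrableZl measurableT c^-1 icK.
  by apply: eq_integrable => // x _; rewrite -EFinM mulKf.
rewrite EFinM fineK ?integrable_fin_num//.
by under [RHS]eq_integral do rewrite EFinM; rewrite integralZl.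
Qed.

Lemma measurable_swap3 d1 d2 d3 (X : measurableType d1) (Y : measurableType d2) (S : measurableType d3)
    (H : (X * Y) * S -> \bar R) : measurable_fun [set: (X * Y) * S] H ->
  measurable_fun [set: (S * Y) * X] (fun w => H ((w.2, w.1.2), w.1.1)).
Proof.
move=> mH; apply: (measurableT_comp mH).
apply/measurable_fun_pairP; split => /=.
  apply/measurable_fun_pairP; split => /=; first exact: measurable_snd.
  exact: (measurableT_comp measurable_snd measurable_fst).
exact: (measurableT_comp measurable_fst measurable_fst).
Qed.

Section fubini_swap.
Context d1 d2 (X : measurableType d1) (Y : measurableType d2).
Variables (m1 : {sigma_finite_measure set X -> \bar R}) (m2 : {sigma_finite_measure set Y -> \bar R}).

Lemma tonelli_swap (H : (X * Y) * X -> \bar R) : measurable_fun [set: (X * Y) * X] H ->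
  (forall w, 0 <= H w)%E ->
  (\int[m1 \x m2]_z \int[m1]_s H (z, s) = \int[m1 \x m2]_z \int[m1]_r H ((r, z.2), z.1))%E.
Proof.
move=> mH H0.
have mS := measurable_swap3 mH.
have mA := measurable_fun_fubini_tonelli_F (m2 := m1) _ mH H0.
have mB := measurable_fun_fubini_tonelli_F (m2 := m1) _ mS (fun w => H0 _).
rewrite (fubini_tonelli2 _ mA); last by move=> z; apply: integral_ge0.
rewrite [RHS](fubini_tonelli2 _ mB); last by move=> z; apply: integral_ge0.
apply: eq_integral => y _; rewrite /fubini_G /=.
rewrite (@fubini_tonelli _ _ _ _ _ m1 m1 (fun w => H ((w.1, y), w.2)))//.
apply: (measurableT_comp mH).
apply/measurable_fun_pairP; split => /=; last exact: measurable_snd.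
by apply/measurable_fun_pairP; split; [exact: measurable_fst|exact: measurable_cst].
Qed.

(** The two time variables trade places while the space variable is a spectator. This is the
    exchange needed between the memory integral, over the earlier time, and the pairing with the
    test function, over the later one; positive and negative parts are treated by [tonelli_swap]. *)
Lemma fubini_swap (H : (X * Y) * X -> R) : measurable_fun [set: (X * Y) * X] H ->
  (\int[m1 \x m2]_z \int[m1]_s `|H (z, s)|%:E < +oo)%E ->
  [/\ (m1 \x m2)%E.-integrable setT (fun z => \int[m1]_r `|H ((r, z.2), z.1)|%:E)%E,
      (m1 \x m2)%E.-integrable setT (fun z => \int[m1]_r (H ((r, z.2), z.1))%:E)%E &
      (\int[m1 \x m2]_z \int[m1]_s (H (z, s))%:E = \int[m1 \x m2]_z \int[m1]_r (H ((r, z.2), z.1))%:E)%E].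
Proof.
move=> mH; set mm := (m1 \x m2)%E => fH.
have mE : measurable_fun [set: (X * Y) * X] (fun w => (H w)%:E) by apply/measurable_EFinP.
have mN : measurable_fun [set: (X * Y) * X] (fun w => `|H w|%:E).
  by apply/measurable_EFinP; exact: (measurableT_comp (@normr_measurable R setT)).
have key (G : (X * Y) * X -> \bar R) : measurable_fun [set: (X * Y) * X] G ->
    (forall w, 0 <= G w)%E -> (forall w, G w <= `|H w|%:E)%E ->
    mm.-integrable setT (fun z => \int[m1]_s G (z, s))%E /\
    mm.-integrable setT (fun z => \int[m1]_r G ((r, z.2), z.1))%E.
  move=> mG G0 GH.
  have fG : (\int[mm]_z \int[m1]_s G (z, s) < +oo)%E.
    apply: le_lt_trans fH; apply: ge0_le_integral => //.
    - by move=> z _; apply: integral_ge0.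
    - exact: (measurable_fun_fubini_tonelli_F (m2 := m1) _ mG G0).
    - exact: (measurable_fun_fubini_tonelli_F (m2 := m1) _ mN (fun=> normr_ge0 _)).
    - move=> z _; apply: ge0_le_integral => //.
      + exact: (measurable_fun_pair2 z mG).
      + exact: (measurable_fun_pair2 z mN).
  split; apply/integrableP; split.
  - exact: (measurable_fun_fubini_tonelli_F (m2 := m1) _ mG G0).
  - by under eq_integral do rewrite gee0_abs ?integral_ge0//.
  - exact: (measurable_fun_fubini_tonelli_F (m2 := m1) _ (measurable_swap3 mG) (fun w => G0 _)).
  - under eq_integral do rewrite gee0_abs ?integral_ge0//.
    by rewrite -(tonelli_swap mG G0).
pose P := (fun w => (H w)%:E)^\+%E; pose Q := (fun w => (H w)%:E)^\-%E.
have mP : measurable_fun [set: (X * Y) * X] P by exact: measurable_funepos.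
have mQ : measurable_fun [set: (X * Y) * X] Q by exact: measurable_funeneg.
have P0 w : (0 <= P w)%E by exact: funepos_ge0.
have Q0 w : (0 <= Q w)%E by exact: funeneg_ge0.
have PH w : (P w <= `|H w|%:E)%E.
  by rewrite /P funeposE -EFin_max lee_fin ge_max normr_ge0 ler_norm.
have QH w : (Q w <= `|H w|%:E)%E.
  by rewrite /Q funenegE -EFinN -EFin_max lee_fin ge_max normr_ge0 -normrN ler_norm.
have [_ iN] := key _ mN (fun=> normr_ge0 _) (fun=> lexx _).
have [iP iP'] := key _ mP P0 PH.
have [iQ iQ'] := key _ mQ Q0 QH.
have e1 z : (\int[m1]_s (H (z, s))%:E = \int[m1]_s P (z, s) - \int[m1]_s Q (z, s))%E.
  rewrite [LHS]integralE.
  by congr (_ - _)%E; apply: eq_integral => s _; rewrite /P /Q ?funeposE ?funenegE.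
have e2 z : (\int[m1]_r (H ((r, z.2), z.1))%:E = \int[m1]_r P ((r, z.2), z.1) - \int[m1]_r Q ((r, z.2), z.1))%E.
  rewrite [LHS]integralE.
  by congr (_ - _)%E; apply: eq_integral => s _; rewrite /P /Q ?funeposE ?funenegE.
split; first exact: iN.
- have := integrableB measurableT iP' iQ'.
  by apply: eq_integrable => // z _; rewrite e2.
- under eq_integral do rewrite e1.
  under [RHS]eq_integral do rewrite e2.
  rewrite (integralB measurableT iP iQ) [RHS](integralB measurableT iP' iQ').
  by congr (_ - _)%E; apply: tonelli_swap.
Qed.

End fubini_swap.

End integral_lemmas.

(** * Consequences of the weak equations *)

Section weak_form.
Context {R : realType} {d : nat}.
Notation mu := (@lebesgue_measure R).
Notation T1 := (measurableTypeR R).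
Notation Z := (R * 'rV[R]_d)%type.
Notation tx := (@lebesgue_tx R d).
Variables (p T : R).
Hypotheses (p1 : 1 < p) (T0 : 0 < T).
Local Notation D := (cyl T [set: 'rV[R]_d]).

Lemma cvg_weight (F : Z -> R) (a_ : nat -> R -> R) (a : R -> R) (b : 'rV[R]_d -> R) A B :
  in_Lp p D F -> (forall n, measurable_fun [set: R] (a_ n)) -> measurable_fun [set: R] a ->
  (forall n s, 0 < s < T -> `|a_ n s| <= A) ->
  (forall s, 0 < s < T -> a_ n s @[n --> \oo] --> a s) ->
  measurable_fun [set: 'rV[R]_d] b -> (forall y, `|b y| <= B) ->
  (forall y : 'rV[R]_d, (exists i, B < `|y ord0 i|) -> b y = 0) ->
  tx.-integrable D (EFin \o (fun z => F z * (a z.1 * b z.2))) /\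
  \int[tx]_(z in D) (F z * (a_ n z.1 * b z.2)) @[n --> \oo] --> \int[tx]_(z in D) (F z * (a z.1 * b z.2)).
Proof.
move=> LF ma_ ma aA aa mb bB bs.
have mD := @measurable_cyl R d T.
have mF := in_Lp_measurable LF.
have mFD : measurable_fun (D : set (T1 * 'rV[R]_d)) F.
  by apply/(measurable_restrictT _ mD); exact: mF.
have mt (e : R -> R) : measurable_fun [set: R] e ->
    measurable_fun (D : set (T1 * 'rV[R]_d)) (fun z : T1 * 'rV[R]_d => F z * (e z.1 * b z.2)).
  move=> me; apply: measurable_funM => //; apply: measurable_funTS; apply: measurable_funM.
    exact: (measurableT_comp me measurable_fst).
  exact: (measurableT_comp mb measurable_snd).
have iFb : tx.-integrable D (EFin \o (fun z => F z * b z.2)).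
  apply: (integrable_Lp_mul (B := B) p1 T0 LF) => //.
  - exact: (measurableT_comp mb measurable_snd).
  - by move=> z _; exact: bs.
have iN := integrableZl mD A (integrable_abse iFb).
apply: (Rintegral_dominated mD _ _ _ iN _) => //=.
- by move=> n; exact: mt.
- exact: mt.
- move=> z [/= hz _]; move: hz; rewrite in_itv/= => hz.
  by apply: cvgMr; apply: cvgMl; exact: aa.
- move=> n z [/= hz _]; move: hz; rewrite in_itv/= => hz.
  rewrite -EFinM lee_fin mulrCA !normrM ler_wpM2r ?mulr_ge0//.
  exact: aA.
Qed.

End weak_form.

Section weak_fractional.
Context {R : realType} {d : nat}.
Notation Z := (R * 'rV[R]_d)%type.

(* Restricting to test functions whose two pairings are integrable makes this
   formulation insensitive to how those pairings are grouped under the integral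
   sign. *)
Definition weak_frac (al T : R) (u f : Z -> R) (g : Z -> 'rV[R]_d) : Prop :=
  forall phi : Z -> R, Cc_smooth (`[0, T[%classic `*` [set: 'rV[R]_d]) phi ->
  (@lebesgue_tx R d).-integrable (cyl T [set: 'rV[R]_d])
    (EFin \o (fun z => \sum_(i < d) g z ord0 i * D_x i phi z)) ->
  (@lebesgue_tx R d).-integrable (cyl T [set: 'rV[R]_d]) (EFin \o (fun z => f z * phi z)) ->
  \int[@lebesgue_tx R d]_(z in cyl T [set: 'rV[R]_d]) (frac_int al u z * D_t phi z) =
  \int[@lebesgue_tx R d]_(z in cyl T [set: 'rV[R]_d]) (\sum_(i < d) g z ord0 i * D_x i phi z)
  - \int[@lebesgue_tx R d]_(z in cyl T [set: 'rV[R]_d]) (f z * phi z).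

End weak_fractional.

Section flat_limits.
Context {R : realType}.

Lemma cvg_expRN (y : R^nat) : y n @[n --> \oo] --> 0 -> expR (- y n) @[n --> \oo] --> (1 : R).
Proof.
move=> y0; rewrite -expR0 -oppr0.
apply: (cvg_comp _ _ (cvgN y0)); exact: continuous_expR.
Qed.

Lemma cvg_flat (b x : R) : flat b (n.+1%:R^-1) x @[n --> \oo] --> riesz (b + 1) x.
Proof.
rewrite /flat /riesz; case: ifPn => x0; last exact: cvg_cst.
rewrite addrK -[X in _ --> X]mulr1; apply: cvgMr.
apply: cvg_expRN; rewrite -(mul0r x^-1); apply: cvgMl.
exact: cvg_harmonic.
Qed.

Lemma cvg_sum_seq (I : Type) (r : seq I) (f : I -> nat -> R) (l : I -> R) :
  (forall i, f i n @[n --> \oo] --> l i) ->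
  \sum_(i <- r) f i n @[n --> \oo] --> \sum_(i <- r) l i.
Proof.
move=> fl; elim: r => [|i r ih].
  by rewrite big_nil; under eq_fun do rewrite big_nil; exact: cvg_cst.
by rewrite big_cons; under eq_fun do rewrite big_cons; exact: cvgD.
Qed.

Lemma flat_le_riesz b l (x : R) : 0 <= l -> flat b l x <= riesz (b + 1) x.
Proof.
move=> l0; rewrite /flat /riesz; case: ifPn => x0 //.
by rewrite addrK ler_piMr ?powR_ge0// -expR0 ler_expR oppr_le0 divr_ge0// ltW.
Qed.

(** With y = l / x this is y exp(-y) <= 1. The term occurs in the derivative of [flat]; it tends to
    0 with l, and the bound supplies a dominating function uniform in l. *)
Lemma flatB2_le b l (x : R) : 0 <= l -> l * flat (b - 2) l x <= riesz b x.
Proof.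
move=> l0; rewrite /flat /riesz; case: ifPn => x0; last by rewrite mulr0.
have -> : x `^ (b - 2) = x `^ (b - 1) / x.
  by rewrite -powR_inv1 ?(ltW x0)// -powRD_gt0//; congr (_ `^ _); ring.
rewrite [leLHS](_ : _ = x `^ (b - 1) * (l / x * expR (- (l / x)))); last by ring.
rewrite ler_piMr ?powR_ge0// expRN ler_pdivrMr ?expR_gt0// mul1r.
by have := expR_ge1Dx (l / x); lra.
Qed.

Lemma measurable_flat b l : 0 < l -> measurable_fun [set: R] (flat b l).
Proof. by move=> l0; apply: continuous_measurable_fun; exact: continuous_flat. Qed.

Lemma riesz_le (b x t : R) : 1 <= b -> x <= t -> 0 <= t -> riesz b x <= t `^ (b - 1).
Proof.
move=> b1 xt t0; rewrite /riesz; case: ifPn => x0; last exact: powR_ge0.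
by rewrite ge0_ler_powR ?nnegrE ?subr_ge0// ltW.
Qed.

End flat_limits.

Section weak_identities.
Context {R : realType} {d : nat}.
Notation mu := (@lebesgue_measure R).
Notation T1 := (measurableTypeR R).
Notation Z := (R * 'rV[R]_d)%type.
Notation tx := (@lebesgue_tx R d).
Variables (p T : R).
Hypotheses (p1 : 1 < p) (T0 : 0 < T).
Local Notation D := (cyl T [set: 'rV[R]_d]).

Variables (B : R) (c dc : 'I_d -> R -> R).
Hypothesis hc : forall i, profile (d := d) B (c i) (dc i).

Lemma cvg_weight_prodf (F : Z -> R) (a_ : nat -> R -> R) (a : R -> R) A (e : 'I_d -> R -> R) :
  e = c \/ (exists j, e = upd c dc j) ->
  in_Lp p D F -> (forall n, measurable_fun [set: R] (a_ n)) -> measurable_fun [set: R] a ->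
  (forall n s, 0 < s < T -> `|a_ n s| <= A) ->
  (forall s, 0 < s < T -> a_ n s @[n --> \oo] --> a s) ->
  tx.-integrable D (EFin \o (fun z => F z * (a z.1 * prodf e z.2))) /\
  \int[tx]_(z in D) (F z * (a_ n z.1 * prodf e z.2)) @[n --> \oo] -->
    \int[tx]_(z in D) (F z * (a z.1 * prodf e z.2)).
Proof.
move=> ec LF ma_ ma aA aa.
have [me eB es] : [/\ forall i, measurable_fun [set: R] (e i), forall i x, `|e i x| <= B &
    forall i x, B < `|x| -> e i x = 0].
  case: ec => [->|[j ->]]; split=> i.
  - exact: (profile_measurable hc).
  - exact: (profile_bound hc).
  - exact: (profile_supp hc).
  - exact: (measurable_upd hc).
  - exact: (upd_bound hc).
  - exact: (upd_supp hc).
pose B' := Num.max B (B ^+ d).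
have BB' : B <= B' by rewrite /B' le_max lexx.
apply: (cvg_weight (B := B') p1 T0 LF ma_ ma aA aa).
- exact: measurable_prodf.
- move=> y; apply: (@le_trans _ _ (B ^+ d)); last by rewrite le_max lexx orbT.
  exact: prodf_bound.
- move=> y [i hi]; apply: (@prodf_supp _ _ B) => //.
  by exists i; exact: le_lt_trans hi.
Qed.

Lemma measurable_lt_natr (t : R) : measurable_fun [set: R] (fun s : R => (s < t)%R%:R : R).
Proof.
rewrite (_ : (fun _ => _) = \1_(`]-oo, t[%classic : set T1)); first exact: measurable_indic.
apply/funext => s; rewrite indicE; congr (nat_of_bool _)%:R.
by apply/idP/idP; rewrite inE/= in_itv.
Qed.

(** The sharp time truncation is a limit of admissible test functions; no regularity of u in time
    enters, because the time factor is not differentiated. *)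
Lemma weak_gradient_trunc (u : Z -> R) (Du : Z -> 'rV[R]_d) t j :
  in_Lp p D u -> in_vLp p D Du -> weak_gradient T setT u Du -> 0 < t < T ->
  \int[tx]_(z in D) (u z * ((z.1 < t)%R%:R * prodf (upd c dc j) z.2)) =
  - \int[tx]_(z in D) (Du z ord0 j * ((z.1 < t)%R%:R * prodf c z.2)).
Proof.
move=> Lu LDu wDu /andP[t0 tT].
pose l n : R := n.+1%:R^-1.
have l0 n : 0 < l n by rewrite invr_gt0.
(* Exponent 0 makes both factors tend to Heaviside functions. The shift by [l n] keeps the support
   inside [[l n], t], hence compact in the open interval ]0, T[, as the definition of the weak
   gradient demands. *)
pose a n (s : R) := flat 0 (l n) (1 * s + - l n) * flat 0 (l n) (-1 * s + t).
have ta n : tame1 (d := d) (a n).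
  by apply: tame1_mul; apply: (tame1_affine (c := flat 0 (l n))); exact: tame1_flat.
have ma n : measurable_fun [set: R] (a n).
  by apply: measurable_funM; apply: (measurableT_comp (measurable_flat 0 (l0 n)));
    apply: measurable_funD => //; exact: measurable_funM.
have fb n x : `|flat 0 (l n) x| <= 1 by rewrite ger0_norm ?flat_ge0// flat0_le1// ltW.
have ba n s : 0 < s < T -> `|a n s| <= 1.
  by move=> _; rewrite normrM -[leRHS]mulr1 ler_pM.
have ca s : 0 < s < T -> a n s @[n --> \oo] --> ((s < t)%R%:R : R).
  move=> /andP[s0 sT].
  have lc : l n @[n --> \oo] --> (0 : R) by exact: cvg_harmonic.
  have h1 : flat 0 (l n) (1 * s + - l n) @[n --> \oo] --> (1 : R).
    have hE : expR (- (l n / (s - l n))) @[n --> \oo] --> (1 : R).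
      apply: cvg_expRN; rewrite -(mul0r (s - 0)^-1); apply: cvgM => //.
      apply: cvgV; first by rewrite subr0 gt_eqF.
      by apply: cvgB => //; exact: cvg_cst.
    apply: cvg_trans hE; apply: near_eq_cvg; near=> n.
    rewrite /flat mul1r subr_gt0 ifT ?powRr0 ?mul1r//.
    by near: n; exact: (cvgr_lt _ lc).
  rewrite -[X in _ --> X]mul1r; apply: cvgM => //.
  have := @cvg_flat R 0 (-1 * s + t); rewrite add0r /riesz.
  rewrite mulN1r addrC subr_gt0 subrr powRr0 => h.
  by case: (s < t) h.
have phi n : Cc_smooth (D : set Z) (testf c (a n)).
  apply: (@Cc_smooth_testf _ _ _ _ _ hc _ _ (l n) t) => //.
    move=> x; rewrite /= !in_itv/= => /andP[h1 h2]; rewrite (lt_le_trans (l0 n))//=.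
    exact: le_lt_trans tT.
  move=> x _ h; rewrite /a; have [h1|h1] := leP x (l n).
    by rewrite (flat_le0 _ _ (_ : 1 * x + - l n <= 0)) ?mul0r//; lra.
  rewrite (flat_le0 _ _ (_ : -1 * x + t <= 0)) ?mulr0//.
  have [h2|h2] := leP x t; last by lra.
  by exfalso; apply: h; rewrite (ltW h1).
have e n : \int[tx]_(z in D) (u z * (a n z.1 * prodf (upd c dc j) z.2)) =
    - \int[tx]_(z in D) (Du z ord0 j * (a n z.1 * prodf c z.2)).
  rewrite -(wDu j _ (phi n)); apply: eq_Rintegral => z _.
  by rewrite (D_x_testf hc).
have [_ c1] := cvg_weight_prodf (or_intror (ex_intro _ j erefl)) Lu ma (measurable_lt_natr t) ba ca.
have [_ c2] := cvg_weight_prodf (or_introl erefl) (LDu j) ma (measurable_lt_natr t) ba ca.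
move: c1; under eq_fun do rewrite e; move=> c1.
exact: (cvg_unique _ c1 (cvgN c2)).
Unshelve. all: by end_near. Qed.

Section fractional.
Variable al : R.
Hypothesis hal : 0 < al < 1.
Variables (u f : Z -> R) (g : Z -> 'rV[R]_d).
Hypotheses (Lu : in_Lp p D u) (Lg : in_vLp p D g) (Lf : in_Lp p D f).
Hypothesis hw : weak_frac al T u f g.
Variable t : R.
Hypothesis ht : 0 < t < T.

Let al0 : 0 < al. Proof. by case/andP: hal. Qed.
Let m := prodf c.
Let ut : T1 * 'rV[R]_d -> R := u \_ D.
(** At ((r, y), s): u at the earlier time r, the memory kernel (s - r)^(-al), and the time weight (t
    - s)^(al - 1). Integrated over s first it gives the Beta integral times u on r < t; over r
    first, the fractional integral times [C]. *)
Let H (w : (T1 * 'rV[R]_d) * T1) : R :=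
  ut w.1 * m w.1.2 * (riesz (1 - al) (w.2 - w.1.1) * riesz al (t - w.2)).
Let K (z : T1 * 'rV[R]_d) (r : T1) : R := riesz (1 - al) (z.1 - r) * ut (r, z.2).
Let M (z : T1 * 'rV[R]_d) : R := fine (\int[mu]_r (K z r)%:E)%E.
Let C (z : T1 * 'rV[R]_d) : R := riesz al (t - z.1) * m z.2.

Let mut : measurable_fun [set: T1 * 'rV[R]_d] ut. Proof. exact: in_Lp_measurable Lu. Qed.

Let mm : measurable_fun [set: 'rV[R]_d] m.
Proof. by apply: measurable_prodf => i; exact: (profile_measurable hc). Qed.

Let mH : measurable_fun [set: (T1 * 'rV[R]_d) * T1] H.
Proof.
apply: measurable_funM; first apply: measurable_funM.
- exact: (measurableT_comp mut measurable_fst).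
- exact: (measurableT_comp mm (measurableT_comp measurable_snd measurable_fst)).
- apply: measurable_funM; apply: (measurableT_comp (measurable_riesz _));
    apply: measurable_funB => //.
  exact: (measurableT_comp measurable_fst measurable_fst).
Qed.

Let mK : measurable_fun [set: (T1 * 'rV[R]_d) * T1] (fun w => K w.1 w.2).
Proof.
apply: measurable_funM.
  apply: (measurableT_comp (measurable_riesz _)); apply: measurable_funB => //.
  exact: (measurableT_comp measurable_fst measurable_fst).
apply: (measurableT_comp mut); apply/measurable_fun_pairP; split => /=; first exact: measurable_snd.
exact: (measurableT_comp measurable_snd measurable_fst).
Qed.

Let mM : measurable_fun [set: T1 * 'rV[R]_d] M.
Proof.
have mf := @fine_measurable R setT measurableT.
rewrite (_ : M = fine \o (fun z => \int[mu]_r (K z r)%:E)%E)//; apply: (measurableT_comp mf).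
apply: (@measurable_integral_param _ _ _ _ _ mu (fun w => (K w.1 w.2)%:E)).
exact/measurable_EFinP.
Qed.

Let mC : measurable_fun [set: T1 * 'rV[R]_d] C.
Proof.
apply: measurable_funM; last exact: (measurableT_comp mm measurable_snd).
by apply: (measurableT_comp (measurable_riesz _)); apply: measurable_funB.
Qed.

Let frac_intE z : D z -> frac_int al u z = (Gamma (1 - al))^-1 * M z.
Proof.
move=> -[/=]; rewrite in_itv/= => /andP[z0 zT] _; rewrite /frac_int /M /Rintegral; congr (_ * fine _).
rewrite integral_mkcond; apply: eq_integral => r _; rewrite patchE /K /ut patchE.
case: ifPn; rewrite ?inE/= ?notin_setE /= in_itv/=.
  move=> /andP[r0 rz]; rewrite ifT; last first.
    by rewrite inE; split => //=; rewrite in_itv/= r0 (lt_trans rz).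
  by rewrite /riesz subr_gt0 rz; congr (_ `^ _ * _)%:E; ring.
move=> h; case: ifPn => [|_]; last by rewrite mulr0.
rewrite inE => -[/=]; rewrite in_itv/= => /andP[r0 rT] _.
rewrite /riesz subr_gt0 ifF ?mul0r//; apply/negP => rz.
by apply: h; rewrite r0.
Qed.

Let HE z r : H ((r, z.2), z.1) = C z * K z r.
Proof. by rewrite /H /C /K/=; ring. Qed.

(** At times z.1 <= 0 the zero extension of u has no past, and at times beyond t the factor
    [riesz al (t - z.1)] vanishes; integrals over the whole space and over the cylinder therefore
    agree. *)
Let CM0 z : ~ D z -> C z * M z = 0.
Proof.
move=> nD; have [t0 tT] := andP ht; rewrite /C /riesz subr_gt0; case: ifPn => zt; last by rewrite mul0r mul0r.
rewrite [M z](_ : _ = 0) ?mulr0// /M; rewrite (eq_integral (cst 0%E)) ?integral0// => r _.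
rewrite /K /ut /riesz subr_gt0; case: ifPn => rz; last by rewrite mul0r.
rewrite patchE ifF ?mulr0//; apply/negP; rewrite inE => -[/=]; rewrite in_itv/= => /andP[r0 _] _.
by apply: nD; split => //=; rewrite in_itv/= (lt_trans r0 rz) (lt_trans zt).
Qed.

Let ltm (z : T1 * 'rV[R]_d) : R := (z.1 < t)%R%:R * m z.2.

Let ium : tx.-integrable D (EFin \o (fun z => u z * ltm z)).
Proof.
have h1 : forall (n : nat) s, 0 < s < T -> `|(s < t)%R%:R : R| <= 1.
  by move=> _ s _; rewrite normr_nat; case: (s < t)%R.
exact: (cvg_weight_prodf (or_introl erefl) Lu (fun=> measurable_lt_natr t) (measurable_lt_natr t) h1
  (fun s _ => cvg_cst _)).1.
Qed.

Let patch_um z : ((fun z => (u z * ltm z)%:E) \_ D) z = (ut z * ltm z)%:E.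
Proof.
rewrite patchE /ut patchE; case: ifPn => _; first by [].
by rewrite [X in X * _](_ : _ = 0) ?mul0r.
Qed.

Let ium' : tx.-integrable setT (fun z => (ut z * ltm z)%:E).
Proof.
have := (integrable_mkcond _ (@measurable_cyl R d T)).1 ium.
by apply: eq_integrable => // z _; exact: patch_um.
Qed.

Let b0 := fine (ebeta al).

Let beta_ltm (z : T1 * 'rV[R]_d) : (\int[mu]_s (riesz (1 - al) (s - z.1) * riesz al (t - s))%:E =
  (b0 * (z.1 < t)%R%:R)%:E)%E.
Proof.
have /andP[e0 e1] := ebeta_fin_gt0 hal.
rewrite (beta_shift hal); case: ifPn => _; rewrite ?mulr0 ?mulr1//.
by rewrite /b0 fineK// ge0_fin_numE// ltW.
Qed.

Let b00 : 0 <= b0.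
Proof. by have /andP[e0 _] := ebeta_fin_gt0 hal; rewrite /b0 fine_ge0// ltW. Qed.

Let rr0 (r s : R) : 0 <= riesz (1 - al) (s - r) * riesz al (t - s).
Proof. by rewrite mulr_ge0 ?riesz_ge0. Qed.

Let mrr r : measurable_fun [set: T1] (fun s : T1 => (riesz (1 - al) (s - r) * riesz al (t - s))%:E).
Proof. by apply/measurable_EFinP; exact: measurable_beta_fun. Qed.

Let intH z : (\int[mu]_s (H (z, s))%:E = b0%:E * (ut z * ltm z)%:E)%E.
Proof.
have ib : mu.-integrable setT (fun s => (riesz (1 - al) (s - z.1) * riesz al (t - s))%:E).
  apply/integrableP; split; first exact: mrr.
  under eq_integral do rewrite gee0_abs ?lee_fin ?rr0//.
  by rewrite beta_ltm ltry.
rewrite (eq_integral (fun s : T1 => (ut z * m z.2)%:E *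
    (riesz (1 - al) (s - z.1) * riesz al (t - s))%:E)%E); last by move=> s _; rewrite -EFinM.
rewrite (integralZl measurableT ib) beta_ltm.
by rewrite -!EFinM; congr EFin; rewrite /ltm; ring.
Qed.

Let intNH z : (\int[mu]_s `|H (z, s)|%:E = b0%:E * `|ut z * ltm z|%:E)%E.
Proof.
rewrite (eq_integral (fun s : T1 => `|ut z * m z.2|%:E *
    (riesz (1 - al) (s - z.1) * riesz al (t - s))%:E)%E); last first.
  by move=> s _; rewrite /H normrM [X in _ * X]ger0_norm ?rr0// EFinM.
rewrite (ge0_integralZl_EFin _ measurableT _ (mrr z.1) (normr_ge0 _)); last first.
  by move=> s _; rewrite lee_fin rr0.
rewrite beta_ltm -!EFinM; congr EFin.
by rewrite /ltm !normrM normr_nat; ring.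
Qed.

Let Hfin : (\int[tx]_z \int[mu]_s `|H (z, s)|%:E < +oo)%E.
Proof.
under eq_integral do rewrite intNH.
rewrite ge0_integralZl_EFin//; last first.
  by have /integrableP[/measurable_EFinP h _] := ium'; apply/measurable_EFinP; exact: (measurableT_comp (@normr_measurable R setT) h).
have /integrableP[_ h] := ium'.
by rewrite lte_mul_pinfty ?lee_fin.
Qed.

Let swapH := fubini_swap mH Hfin.

Let absCM z : (`|C z * M z|%:E <= \int[mu]_r `|H ((r, z.2), z.1)|%:E)%E.
Proof.
have mKz : measurable_fun [set: T1] (fun r => (K z r)%:E).
  by apply/measurable_EFinP; exact: (measurable_fun_pair2 z mK).
rewrite (eq_integral (fun r : T1 => `|C z|%:E * `|K z r|%:E)%E); last first.
  by move=> r _; rewrite HE normrM EFinM.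
rewrite (ge0_integralZl_EFin _ measurableT _ _ (normr_ge0 _)); last 2 first.
- by move=> r _; rewrite lee_fin.
- by apply/measurable_EFinP; apply: (measurableT_comp (@normr_measurable R setT)); apply/measurable_EFinP.
rewrite normrM EFinM lee_wpmul2l ?lee_fin// /M.
apply: le_trans (le_abse_integral mu measurableT mKz).
by case: (integral _ _ _) => [r| |] //=; rewrite normr0 leey.
Qed.

Let mMC : measurable_fun [set: T1 * 'rV[R]_d] (fun z => (C z * M z)%:E).
Proof. by apply/measurable_EFinP; exact: (measurable_funM mC mM). Qed.

Let iCM : tx.-integrable D (EFin \o (fun z => C z * M z)).
Proof.
have [iN _ _] := swapH.
apply: (integrableS measurableT) => //; first exact: measurable_cyl.
apply: (le_integrable measurableT mMC _ iN) => z _.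
by rewrite (le_trans (absCM z))// lee_abs.
Qed.

Let iFC : tx.-integrable D (EFin \o (fun z => frac_int al u z * C z)).
Proof.
have := integrableZl (@measurable_cyl R d T) (Gamma (1 - al))^-1 iCM.
apply: eq_integrable; first exact: measurable_cyl.
move=> z; rewrite inE => Dz; rewrite [LHS]/= -EFinM [RHS]/= frac_intE//.
by congr EFin; ring.
Qed.

(** The composition law of fractional integrals in weak form: the kernels of order 1 - al and al
    combine to the Heaviside function by [beta_shift] after exchanging the two time integrals.
    Mathematically the constant is Gamma(al). *)
Lemma riesz_frac_int :
  \int[tx]_(z in D) (frac_int al u z * C z) =
  (Gamma (1 - al))^-1 * b0 * \int[tx]_(z in D) (u z * ltm z).
Proof.
have [iN iH e] := swapH; have mD := @measurable_cyl R d T.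
(* [M] is the finite part of an integral that may diverge at some points, so pulling [C] out of it
   is justified only almost everywhere, where the absolute integral is finite. *)
have aeE : (\int[tx]_z \int[mu]_r (H ((r, z.2), z.1))%:E = \int[tx]_z (C z * M z)%:E)%E.
  apply: (ae_eq_integral _ _ measurableT (measurable_int _ iH) mMC).
  apply: filterS (integrable_ae measurableT iN) => z /(_ I) h _.
  rewrite (@fine_integralZl _ _ _ mu (C z) (K z)).
  - by apply: eq_integral => r _; rewrite HE.
  - exact: (measurable_fun_pair2 z mK).
  - move: h; rewrite ge0_fin_numE; last by apply: integral_ge0 => r _; rewrite lee_fin.
    by under [X in (X < _)%E -> _]eq_integral => r _ do rewrite HE.
have e1 : (b0%:E * \int[tx]_(z in D) (u z * ltm z)%:E = \int[tx]_(z in D) (C z * M z)%:E)%E.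
  rewrite [in LHS]integral_mkcond [in RHS]integral_mkcond.
  transitivity (\int[tx]_z (b0%:E * (ut z * ltm z)%:E))%E.
    rewrite (integralZl measurableT ium'); congr (_ * _)%E; apply: eq_integral => z _.
    by rewrite -[RHS]patch_um.
  transitivity (\int[tx]_z \int[mu]_s (H (z, s))%:E)%E.
    by apply: eq_integral => z _; rewrite intH.
  rewrite [LHS]e [LHS]aeE; apply: eq_integral => z _; rewrite patchE; case: ifPn; first by [].
  by rewrite notin_setE => /CM0 ->.
rewrite (@eq_Rintegral _ _ _ tx _ (fun z => (Gamma (1 - al))^-1 * (C z * M z))); last first.
  move=> z; rewrite inE => Dz; rewrite (frac_intE Dz) -mulrA.
  by congr (_ * _); exact: mulrC.
rewrite (RintegralZl _ mD iCM) -mulrA; congr (_ * _).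
rewrite /Rintegral -e1.
have /fineK h : (\int[tx]_(z in D) (u z * ltm z)%:E)%E \is a fin_num by exact: integrable_fin_num.
by rewrite -[in LHS]h.
Qed.

(** The equation is tested with [flat al (1/(n+1)) (t - s)] times a spatial profile. These weights
    tend to (t - s)_+^al and their time derivatives to -al (t - s)_+^(al - 1), whose pairing with
    the fractional integral is [riesz_frac_int]. The support may reach time 0, since test functions
    live on [0, T[. *)
Lemma weak_eq_trunc :
  al * ((Gamma (1 - al))^-1 * b0 * \int[tx]_(z in D) (u z * ((z.1 < t)%R%:R * prodf c z.2))) =
  \int[tx]_(z in D) (f z * (riesz (al + 1) (t - z.1) * prodf c z.2)) -
  \sum_(j < d) \int[tx]_(z in D) (g z ord0 j * (riesz (al + 1) (t - z.1) * prodf (upd c dc j) z.2)).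
Proof.
have [t0 tT] := andP ht; have mD := @measurable_cyl R d T; have a0 := al0.
have G0 := Gamma_gt0 hal.
pose l n : R := n.+1%:R^-1.
have l0 n : 0 < l n by rewrite invr_gt0.
pose a n (s : R) := flat al (l n) (-1 * s + t).
pose a' n (s : R) := - (al * flat (al - 1) (l n) (-1 * s + t) + l n * flat (al - 2) (l n) (-1 * s + t)).
have da n (s : R) : is_derive s (1 : R) (a n) (a' n s).
  have h1 : is_derive s (1 : R) (fun s : R => -1 * s + t) (-1 : R).
    by apply: is_derive_eq; rewrite addr0 /GRing.scale/= mulr1.
  have := @is_derive_chain R (flat al (l n)) (fun s : R => -1 * s + t) s _ _ (is_derive_flat al (-1 * s + t) (l0 n)) h1.
  by rewrite mulrN1.
have ta n : tame1 (d := d) (a n) by apply: (tame1_affine (c := flat al (l n))); exact: tame1_flat.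
have mts : measurable_fun [set: R] (fun s : R => -1 * s + t) by apply: measurable_funD => //; exact: measurable_funM.
have ma n : measurable_fun [set: R] (a n) by apply: (measurableT_comp (measurable_flat al (l0 n))).
have ma' n : measurable_fun [set: R] (a' n).
  apply: (measurableT_comp (@oppr_measurable R setT)); apply: measurable_funD; apply: measurable_funM => //.
    exact: (measurableT_comp (measurable_flat (al - 1) (l0 n))).
  exact: (measurableT_comp (measurable_flat (al - 2) (l0 n))).
have sE (s : R) : -1 * s + t = t - s by ring.
have ba n s : 0 < s < T -> `|a n s| <= t `^ (al + 1 - 1).
  move=> /andP[s0 _]; rewrite ger0_norm ?flat_ge0// (le_trans (flat_le_riesz _ _ (ltW (l0 n))))//.
  by apply: riesz_le => //; lra.
have ca s : 0 < s < T -> a n s @[n --> \oo] --> riesz (al + 1) (t - s).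
  by move=> _; rewrite -sE; exact: cvg_flat.
have mr : measurable_fun [set: R] (fun s : R => riesz (al + 1) (t - s)).
  by apply: (measurableT_comp (measurable_riesz _)); apply: measurable_funB.
(* The bound is the singular limit weight itself, uniformly in n. Its product with the fractional
   integral is integrable by [swapH], so dominated convergence works although the weight is
   unbounded near t. *)
have ba' n s : `|a' n s| <= (al + 1) * riesz al (t - s).
  rewrite /a' normrN ger0_norm; last by rewrite addr_ge0// mulr_ge0 ?flat_ge0// ltW.
  rewrite sE mulrDl mul1r; apply: lerD; last exact: (flatB2_le _ _ (ltW (l0 n))).
  rewrite (ler_pM2l a0).
  by have := flat_le_riesz (al - 1) (t - s) (ltW (l0 n)); rewrite subrK.
have lc : l n @[n --> \oo] --> (0 : R) by exact: cvg_harmonic.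
have ca' s : a' n s @[n --> \oo] --> - (al * riesz al (t - s)).
  rewrite -[X in - X](addr0) -sE; apply: cvgN; apply: cvgD.
    by apply: cvgMr; have := @cvg_flat R (al - 1) (-1 * s + t); rewrite subrK.
  rewrite -(mul0r (riesz (al - 2 + 1) (-1 * s + t))); apply: cvgM => //.
  exact: cvg_flat.
have phi n : Cc_smooth (`[0, T[%classic `*` [set: 'rV[R]_d]) (testf c (a n)).
  apply: (@Cc_smooth_testf _ _ _ _ _ hc _ _ 0 t) => //.
    by move=> x; rewrite /= !in_itv/= => /andP[-> h2]; exact: le_lt_trans tT.
  move=> x; rewrite /= in_itv/= => /andP[x0 _] h; rewrite /a.
  rewrite (flat_le0 _ _ (_ : -1 * x + t <= 0))//.
  have [h2|h2] := leP x t; last by lra.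
  by exfalso; apply: h; rewrite x0.
have [iN iH _] := swapH.
have [_ cf] := cvg_weight_prodf (or_introl erefl) Lf ma mr ba ca.
have cg j := (cvg_weight_prodf (or_intror (ex_intro _ j erefl)) (Lg j) ma mr ba ca).2.
have e n : \int[tx]_(z in D) (frac_int al u z * (a' n z.1 * m z.2)) =
    \sum_(j < d) \int[tx]_(z in D) (g z ord0 j * (a n z.1 * prodf (upd c dc j) z.2))
    - \int[tx]_(z in D) (f z * (a n z.1 * prodf c z.2)).
  transitivity (\int[tx]_(z in D) (frac_int al u z * D_t (testf c (a n)) z)).
    by apply: eq_Rintegral => z _; rewrite (D_t_testf c z (da n)).
  have ig j : tx.-integrable D (EFin \o (fun z => g z ord0 j * (a n z.1 * prodf (upd c dc j) z.2))).
    exact: (cvg_weight_prodf (or_intror (ex_intro _ j erefl)) (Lg j) (fun=> ma n) (ma n)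
      (fun _ => ba n) (fun s _ => cvg_cst _)).1.
  have if_ : tx.-integrable D (EFin \o (fun z => f z * testf c (a n) z)).
    exact: (cvg_weight_prodf (or_introl erefl) Lf (fun=> ma n) (ma n)
      (fun _ => ba n) (fun s _ => cvg_cst _)).1.
  have gE : (fun z => \sum_(j < d) g z ord0 j * D_x j (testf c (a n)) z) =
      (fun z => \sum_(j < d) g z ord0 j * (a n z.1 * prodf (upd c dc j) z.2)).
    by apply/funext => z; apply: eq_bigr => j _; rewrite (D_x_testf hc).
  rewrite (hw (phi n) _ if_) gE.
    by congr (_ - _); rewrite Rintegral_sum.
  rewrite (_ : EFin \o _ = (fun z => \sum_(j < d) (g z ord0 j * (a n z.1 * prodf (upd c dc j) z.2))%:E)%E).
    by apply: (integrable_sum mD) => j _; exact: ig.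
  by apply/funext => z; rewrite /= sumEFin.
have cl : \int[tx]_(z in D) (frac_int al u z * (a' n z.1 * m z.2)) @[n --> \oo] -->
    \int[tx]_(z in D) (frac_int al u z * (- (al * riesz al (t - z.1)) * m z.2)).
  have iG := integrableZl measurableT ((Gamma (1 - al))^-1 * (al + 1)) iN.
  have mFr : measurable_fun (D : set (T1 * 'rV[R]_d)) (frac_int al u).
    apply: (@eq_measurable_fun _ _ _ _ _ (fun z => (Gamma (1 - al))^-1 * M z)).
      by move=> z; rewrite inE => Dz; rewrite frac_intE.
    by apply: measurable_funTS; exact: measurable_funM.
  have mb (b : R -> R) : measurable_fun [set: R] b ->
      measurable_fun (D : set (T1 * 'rV[R]_d)) (fun z => frac_int al u z * (b z.1 * m z.2)).
    move=> mb; apply: measurable_funM => //; apply: measurable_funTS; apply: measurable_funM.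
      exact: (measurableT_comp mb measurable_fst).
    exact: (measurableT_comp mm measurable_snd).
  have mr' : measurable_fun [set: R] (fun s => - (al * riesz al (t - s))).
    apply: (measurableT_comp (@oppr_measurable R setT)); apply: measurable_funM => //.
    by apply: (measurableT_comp (measurable_riesz _)); apply: measurable_funB.
  apply: (Rintegral_dominated mD (fun n => mb _ (ma' n)) (mb _ mr') _
    (integrableS measurableT mD (@subsetT _ _) iG) _).2.
    by move=> z _; apply: cvgMr; apply: cvgMl; exact: ca'.
  move=> n z Dz; rewrite frac_intE//.
  apply: (@le_trans _ _ ((Gamma (1 - al))^-1 * (al + 1) * `|C z * M z|)%:E); last first.
    rewrite EFinM lee_wpmul2l ?lee_fin//; first by rewrite mulr_ge0 ?invr_ge0 ?(ltW G0)// addr_ge0 ?(ltW a0).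
  rewrite lee_fin !normrM (ger0_norm (_ : 0 <= (Gamma (1 - al))^-1)); last by rewrite invr_ge0 (ltW G0).
  rewrite -!mulrA ler_wpM2l ?invr_ge0 ?(ltW G0)//.
  rewrite (ger0_norm (riesz_ge0 _ _)) mulrC -!mulrA mulrA [leRHS]mulrA.
  rewrite -[leLHS]mulrA; apply: ler_wpM2r; last exact: ba'.
  by rewrite mulr_ge0.
have cr : \int[tx]_(z in D) (frac_int al u z * (a' n z.1 * m z.2)) @[n --> \oo] -->
    \sum_(j < d) \int[tx]_(z in D) (g z ord0 j * (riesz (al + 1) (t - z.1) * prodf (upd c dc j) z.2))
    - \int[tx]_(z in D) (f z * (riesz (al + 1) (t - z.1) * prodf c z.2)).
  under eq_fun do rewrite e.
  by apply: cvgB => //; apply: cvg_sum_seq => j; exact: cg.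
have h := cvg_unique (@Rhausdorff R) cl cr.
rewrite -opprB -h.
transitivity (al * \int[tx]_(z in D) (frac_int al u z * C z)).
  by congr (_ * _); rewrite riesz_frac_int.
rewrite -(RintegralZl al mD iFC).
rewrite [in RHS](@eq_Rintegral _ _ _ tx _ (fun z => -1 * (al * (frac_int al u z * C z)))); last first.
  by move=> z _; rewrite /C; ring.
rewrite (RintegralZl (-1) mD); first by rewrite mulN1r opprK.
exact: (integrableZl mD al iFC).
Qed.

End fractional.

End weak_identities.

(** * Averages over parabolic boxes *)

Section kernel_estimates.
Context {R : realType}.
Implicit Types (x y z r tau rho al : R).

(* The common majorant of the rescaled kernels. *)
Definition major y : R := if 0 < y then Num.min 1 y^-1 else 0.

Lemma major_ge0 y : 0 <= major y.
Proof. by rewrite /major; case: ifPn => y0 //; rewrite le_min ler01 invr_ge0 ltW. Qed.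

(** Since -1 <= th - 1 <= 0, the power lies above 1 for y <= 1 and above 1 / y for y >= 1. The
    freedom in [th] is what later makes the sum over scales converge. *)
Lemma major_le_powR th y : 0 <= th <= 1 -> major y <= riesz th y.
Proof.
move=> /andP[t0 t1]; rewrite /major /riesz; case: ifPn => y0 //.
have [y1|y1] := leP y 1.
  rewrite (@le_trans _ _ 1) ?ge_min ?lexx//.
  rewrite -opprB powRN -[leLHS]invr1 lef_pV2 ?posrE ?powR_gt0//.
  apply: (@le_trans _ _ (1 `^ (1 - th))); last by rewrite powR1.
  rewrite ge0_ler_powR ?nnegrE ?subr_ge0//; exact: ltW.
rewrite (@le_trans _ _ y^-1) ?ge_min ?lexx ?orbT//.
rewrite -powR_inv1 ?(ltW y0)// ler_powR ?(ltW y1)//; lra.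
Qed.

Lemma major_lb y : 0 < y <= 2 -> 2^-1 <= major y.
Proof.
move=> /andP[y0 y2]; rewrite /major y0 le_min; apply/andP; split; first by lra.
by rewrite lef_pV2 ?posrE.
Qed.

Lemma major1 y : 0 < y <= 1 -> major y = 1.
Proof. by move=> /andP[y0 y1]; rewrite /major y0 min_l// -invr1 lef_pV2 ?posrE. Qed.

Lemma measurable_major : measurable_fun [set: R] major.
Proof.
have -> : major = (fun y => Num.min 1 (riesz 0 y)).
  apply/funext => y; rewrite /major /riesz sub0r; case: ifPn => y0.
    by rewrite powR_inv1// ltW.
  by rewrite min_r.
by apply: measurable_minr => //; exact: measurable_riesz.
Qed.

(** Concavity of y^a drawn from 1 + x <= exp x alone: with s = y^a one has y = s exp((1/a - 1) ln
    s), and s ln s >= s - 1. *)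
Lemma powR_bernoulli (a y : R) : 0 < a < 1 -> 0 < y -> y `^ a <= 1 + a * (y - 1).
Proof.
move=> /andP[a0 a1] y0; set s := y `^ a.
have s0 : 0 < s by exact: powR_gt0.
have ysE : y = s * expR ((a^-1 - 1) * ln s).
  rewrite /s ln_powR mulrA mulrBl mulVf ?gt_eqF// mul1r mulrBl mul1r expRD expRN.
  rewrite lnK ?posrE// /powR gt_eqF// mulrC -mulrA mulVf ?mulr1//.
  by rewrite gt_eqF ?expR_gt0.
have h1 : 1 + (a^-1 - 1) * ln s <= expR ((a^-1 - 1) * ln s) by exact: expR_ge1Dx.
have h2 : s - 1 <= s * ln s.
  have := expR_ge1Dx (- ln s); rewrite expRN lnK ?posrE// => h.
  have := ler_wpM2l (ltW s0) h; rewrite divff ?gt_eqF// mulrDr mulr1 mulrN; lra.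
have a1' : 0 <= a^-1 - 1 by rewrite subr_ge0 -invr1 lef_pV2 ?posrE// ltW.
have h3 : 1 + a^-1 * (s - 1) <= y.
  rewrite [leRHS]ysE; apply: le_trans (ler_wpM2l (ltW s0) h1).
  by have := ler_wpM2l a1' h2; lra.
have := ler_wpM2l (ltW a0) h3; rewrite mulrDr mulrA divff ?gt_eqF// mul1r; lra.
Qed.

Lemma powR_tangent (a x y : R) : 0 < a < 1 -> 0 < x -> 0 < y ->
  x `^ a <= y `^ a + a * y `^ (a - 1) * (x - y).
Proof.
move=> ha x0 y0; have xy0 : 0 < x / y by exact: divr_gt0.
have := powR_bernoulli ha xy0.
rewrite powRM ?invr_ge0 ?(ltW x0) ?(ltW y0)//.
have -> : y^-1 `^ a = (y `^ a)^-1 by rewrite -powR_inv1 ?(ltW y0)// -powRrM mulN1r powRN.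
rewrite -[_ * (y `^ a)^-1]/(_ / _) ler_pdivrMr ?powR_gt0// => h; apply: le_trans h _.
have -> : y `^ (a - 1) = y `^ a / y.
  by rewrite powRD_gt0// powR_inv1// ltW.
rewrite le_eqVlt; apply/orP; left; apply/eqP.
by field; rewrite gt_eqF.
Qed.

(* By the weak equation, averaging u in time with weight [chi tau' - chi tau]
   amounts, up to a constant, to averaging the right-hand side with weight
   [wker al tau' - wker al tau]. *)
Definition wker al tau z : R := tau^-1 * (riesz (al + 1) z - riesz (al + 1) (z - tau)).
Definition chi tau z : R := tau^-1 * ((0 < z)%R%:R - (tau < z)%R%:R).

Lemma wker_le0 al tau z : 0 < tau -> z <= 0 -> wker al tau z = 0.
Proof.
move=> t0 z0; rewrite /wker /riesz !ltNge z0 (_ : z - tau <= 0)/= ?subrr ?mulr0//; lra.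
Qed.

Lemma wker_small al tau z : 0 < al -> 0 < tau -> 0 < z -> 0 <= wker al tau z <= tau^-1 * z `^ al.
Proof.
move=> a0 t0 z0; rewrite /wker.
have h : 0 <= riesz (al + 1) (z - tau) <= z `^ al.
  rewrite riesz_ge0/= /riesz addrK; case: ifPn => h; last exact: powR_ge0.
  by rewrite ge0_ler_powR ?nnegrE ?(ltW a0) ?(ltW h) ?(ltW z0)//; lra.
rewrite {1 3}/riesz z0 addrK; have /andP[h1 h2] := h.
by rewrite mulr_ge0 ?invr_ge0 ?(ltW t0) ?subr_ge0//= ler_pM2l ?invr_gt0//; lra.
Qed.

(** For z > tau, [wker] is the difference quotient of the concave function z^al over [z - tau, z],
    so it lies between the slopes at the two ends. *)
Lemma wker_large al tau z : 0 < al < 1 -> 0 < tau -> tau < z ->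
  al * z `^ (al - 1) <= wker al tau z <= al * (z - tau) `^ (al - 1).
Proof.
move=> ha t0 tz; have z0 : 0 < z by exact: lt_trans tz.
have y0 : 0 < z - tau by rewrite subr_gt0.
rewrite /wker /riesz z0 y0 !addrK.
have h1 := powR_tangent ha z0 y0; have h2 := powR_tangent ha y0 z0.
rewrite (mulrC tau^-1) ler_pdivlMr// ler_pdivrMr//.
by apply/andP; split; lra.
Qed.

(** For large z both weights are close to al z^(al - 1), which does not depend on the scale; the
    leading tails cancel and one factor tau / z is gained. Up to 2 tau each weight is bounded
    separately by [wker_small], which costs the factor lam^(-1) + 1. *)
Lemma wker_diff al tau lam z : 0 < al < 1 -> 0 < tau -> 0 < lam <= 1 ->
  `|wker al (lam * tau) z - wker al tau z| <= 4 * (lam^-1 + 1) * tau `^ (al - 1) * major (z / tau).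
Proof.
move=> ha t0 /andP[l0 l1]; have /andP[a0 a1] := ha.
have lt0 : 0 < lam * tau by rewrite mulr_gt0.
have ltt : lam * tau <= tau by rewrite ler_piMl// ltW.
have [z0|z0] := leP z 0.
  by rewrite !wker_le0// subrr normr0 !mulr_ge0 ?major_ge0 ?powR_ge0 ?addr_ge0 ?invr_ge0 ?(ltW l0).
have tp : 0 <= tau `^ (al - 1) by exact: powR_ge0.
have il : 1 <= lam^-1 by rewrite -invr1 lef_pV2 ?posrE.
have [z2|z2] := leP z (2 * tau).
  have h : 2^-1 <= major (z / tau).
    by apply: major_lb; rewrite divr_gt0//= ler_pdivrMr.
  have /andP[A0 A1] := wker_small a0 lt0 z0.
  have /andP[B0 B1] := wker_small a0 t0 z0.
  have C1 : tau^-1 * z `^ al <= 2 * tau `^ (al - 1).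
    have -> : 2 * tau `^ (al - 1) = tau^-1 * (2 * tau `^ al).
      by rewrite powRD_gt0// powR_inv1 ?(ltW t0)//; ring.
    rewrite ler_pM2l ?invr_gt0//.
    apply: (@le_trans _ _ ((2 * tau) `^ al)).
      by rewrite ge0_ler_powR ?nnegrE ?(ltW a0) ?(ltW z0)// mulr_ge0// ltW.
    rewrite powRM ?(ltW t0)// ler_wpM2r ?powR_ge0//.
    by rewrite -[leRHS]powRr1// ler_powR ?ler1n// ltW.
  have C2 : (lam * tau)^-1 * z `^ al <= lam^-1 * (2 * tau `^ (al - 1)).
    by rewrite invfM -mulrA ler_pM2l ?invr_gt0.
  set W := tau `^ (al - 1) in tp C1 C2 *; set M := major _ in h *; set L := lam^-1 in il C2 *.
  apply: (@le_trans _ _ (4 * (L + 1) * W * 2^-1)); last first.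
    by rewrite ler_wpM2l// !mulr_ge0//; lra.
  by rewrite ler_norml; apply/andP; split; lra.
(* Beyond 2 tau both weights lie between al z^(al - 1) and al (z - tau)^(al - 1), and these bounds
   differ by at most 2 tau^(al - 1) (tau / z). *)
have tz : tau < z by lra.
have ltz : lam * tau < z by exact: le_lt_trans tz.
have /andP[A1 A2] := wker_large ha lt0 ltz.
have /andP[B1 B2] := wker_large ha t0 tz.
have zt0 : 0 < z - tau by rewrite subr_gt0.
have A3 : wker al (lam * tau) z <= al * (z - tau) `^ (al - 1).
  apply: (le_trans A2); rewrite (ler_pM2l a0) -(opprB 1 al) !powRN lef_pV2 ?posrE ?powR_gt0//; last by lra.
  rewrite ge0_ler_powR ?nnegrE ?subr_ge0 ?(ltW a1)//; lra.
have h1 : (z - tau) `^ (al - 1) <= z `^ al / (z - tau).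
  rewrite powRD_gt0// powR_inv1 ?(ltW zt0)// ler_pM2r ?invr_gt0//.
  by rewrite ge0_ler_powR ?nnegrE ?(ltW a0) ?(ltW zt0) ?(ltW z0)//; lra.
have h2 : z `^ (al - 1) = z `^ al / z by rewrite powRD_gt0// powR_inv1 ?(ltW z0).
have h3 : z `^ al / (z - tau) - z `^ al / z <= 2 * tau `^ (al - 1) * (tau / z).
  have -> : z `^ al / (z - tau) - z `^ al / z = z `^ (al - 1) * tau / (z - tau).
    by rewrite h2; field; rewrite !gt_eqF.
  have k1 : z `^ (al - 1) <= tau `^ (al - 1).
    rewrite -(opprB 1 al) !powRN lef_pV2 ?posrE ?powR_gt0//.
    by rewrite ge0_ler_powR ?nnegrE ?subr_ge0 ?(ltW a1) ?(ltW z0) ?(ltW t0)// ltW.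
  have k2 : (z - tau)^-1 <= 2 / z.
    by rewrite -[leRHS]invrK invfM invrK lef_pV2 ?posrE ?divr_gt0//; lra.
  apply: (@le_trans _ _ (tau `^ (al - 1) * tau * (2 / z))).
    by rewrite ler_pM ?mulr_ge0 ?powR_ge0 ?invr_ge0 ?(ltW t0) ?(ltW zt0)// ler_wpM2r// ltW.
  by rewrite le_eqVlt; apply/orP; left; apply/eqP; ring.
have -> : major (z / tau) = tau / z.
  rewrite /major divr_gt0// invf_div min_r// ler_pdivrMr// mul1r; exact: ltW.
have k0 : 0 <= tau / z by rewrite divr_ge0// ltW.
set W := tau `^ (al - 1) in tp h3 *; set K := tau / z in k0 h3 *.
apply: (@le_trans _ _ (2 * W * K)); last first.
  rewrite ler_wpM2r// ler_wpM2r//; lra.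
have ah : al * (z - tau) `^ (al - 1) - al * z `^ (al - 1) <= 2 * W * K.
  have WK : 0 <= W * K by rewrite mulr_ge0.
  have e : (z - tau) `^ (al - 1) - z `^ (al - 1) <= 2 * W * K by rewrite h2; lra.
  rewrite -mulrBr; apply: (le_trans (ler_wpM2l (ltW a0) e)).
  by rewrite ler_piMl ?(ltW a1)// -mulrA mulr_ge0.
by rewrite ler_norml; apply/andP; split; lra.
Qed.

Lemma chi_le tau z : 0 < tau -> `|chi tau z| <= tau^-1 * major (z / tau).
Proof.
move=> t0; rewrite /chi normrM gtr0_norm ?invr_gt0// ler_pM2l ?invr_gt0//.
have [z0|z0] := ltP 0 z; last first.
  by rewrite ltNge (le_trans z0 (ltW t0))/= subrr normr0 major_ge0.
have [zt|zt] := ltP tau z; first by rewrite subrr normr0 major_ge0.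
by rewrite subr0 normr1 major1// divr_gt0//= ler_pdivrMr// mul1r.
Qed.

Definition geoterm y : R := Num.min y y^-1.

(** Telescoping: min(x, 1/x) <= 4 x / (1 + x)^2, which is at most a constant times A(q x) - A(x) for
    A(x) = x / (1 + x). As A takes values in [0, 1], the sum is bounded independently of y and n,
    without locating the index at which y q^k passes 1. *)
Lemma sum_geoterm (q : R) : 1 < q -> forall y n, 0 < y ->
  \sum_(k < n) geoterm (y * q ^+ k) <= 4 * q / (q - 1).
Proof.
move=> q1 y n y0; have q0 : 0 < q by exact: lt_trans q1.
pose A y : R := y / (1 + y).
have key x : 0 < x -> geoterm x <= 4 * q / (q - 1) * (A (x * q) - A x).
  move=> x0; have xq : 0 < x * q by rewrite mulr_gt0.
  have q10 : 0 < q - 1 by rewrite subr_gt0.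
  have h : 4 * x / (1 + x) ^+ 2 <= 4 * q / (q - 1) * (A (x * q) - A x).
    have -> : 4 * q / (q - 1) * (A (x * q) - A x) = 4 * x * (q / (1 + x * q)) / (1 + x).
      by rewrite /A; field; rewrite !gt_eqF// ?addr_gt0.
    have -> : 4 * x / (1 + x) ^+ 2 = 4 * x * (1 + x)^-1 / (1 + x).
      by field; rewrite gt_eqF// addr_gt0.
    rewrite ler_pM2r ?invr_gt0 ?addr_gt0//.
    rewrite ler_pM2l ?mulr_gt0// ler_pdivlMr ?addr_gt0// mulrC ler_pdivrMr ?addr_gt0//.
    by rewrite mulrDr mulr1; lra.
  apply: le_trans h; rewrite ler_pdivlMr ?exprn_gt0 ?addr_gt0//.
  have [x1|x1] := leP x 1.
    apply: (@le_trans _ _ (x * (1 + x) ^+ 2)).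
      by rewrite ler_wpM2r ?sqr_ge0// /geoterm ge_min lexx.
    rewrite (mulrC 4) ler_pM2l// (_ : 4 = 2 ^+ 2); last by rewrite -natrX.
    by rewrite ler_sqr ?nnegrE ?addr_ge0 ?(ltW x0)//; lra.
  apply: (@le_trans _ _ (x^-1 * (1 + x) ^+ 2)).
    by rewrite ler_wpM2r ?sqr_ge0// /geoterm ge_min lexx orbT.
  rewrite mulrC ler_pdivrMr// -mulrA -expr2 (_ : 4 = 2 ^+ 2); last by rewrite -natrX.
  rewrite -exprMn ler_sqr ?nnegrE ?addr_ge0 ?mulr_ge0 ?(ltW x0)//; lra.
have A01 x : 0 < x -> 0 <= A x <= 1.
  by move=> x0; rewrite /A divr_ge0 ?addr_ge0 ?(ltW x0)//= ler_pdivrMr ?addr_gt0// mul1r lerDr.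
have c0 : 0 <= 4 * q / (q - 1) by rewrite divr_ge0 ?mulr_ge0 ?subr_ge0 ?(ltW q0) ?(ltW q1).
have tele : \sum_(k < n) geoterm (y * q ^+ k) <= 4 * q / (q - 1) * (A (y * q ^+ n) - A y).
  elim: n => [|n ih]; first by rewrite big_ord0 expr0 mulr1 subrr mulr0.
  rewrite big_ord_recr/=; have := key (y * q ^+ n); rewrite mulr_gt0 ?exprn_gt0// -(mulrA y) -exprSr.
  move=> /(_ isT) h; have := lerD ih h; rewrite -mulrDr.
  rewrite (_ : A (y * q ^+ n) - A y + (A (y * q ^+ n.+1) - A (y * q ^+ n)) = A (y * q ^+ n.+1) - A y)//.
  by ring.
apply: (le_trans tele); rewrite ler_piMr//.
have /andP[_ h1] : 0 <= A (y * q ^+ n) <= 1 by apply: A01; rewrite mulr_gt0 ?exprn_gt0.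
have /andP[h2 _] := A01 _ y0; lra.
Qed.

End kernel_estimates.

(** * Spatial mollifiers and their size *)

Section mollifiers.
Context {R : realType} {d : nat}.
Implicit Types (rho r x : R).

Definition moll rho r : R := rho^-1 * cutoff (r / rho).
Definition dmoll rho r : R := rho^-1 * (rho^-1 * dcutoff (r / rho)).
(** The primitive of [moll (rho / 2) - moll rho]. Both mollifiers have integral one, so this
    primitive has compact support and may serve as a factor of a test function; that moves the
    difference of two spatial scales onto Du. *)
Definition stepdiff rho r : R := step (r / (rho / 2)) - step (r / rho).

(** One constant for all mollifier bounds: in [dmoll_half_le] a factor 4 comes from (rho / 2)^(-2)
    and another 4 from [dcutoff_le], while the maximum with 1 serves [stepdiff]. *)
Definition cmoll : R := Num.max 1 (16 * (bint (1 : R))^-1).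

Lemma cmoll1 : 1 <= cmoll. Proof. by rewrite /cmoll le_max lexx. Qed.

Let cb0 : 0 < (bint (1 : R))^-1. Proof. by rewrite invr_gt0 bint1_gt0. Qed.

Let cb : 16 * (bint (1 : R))^-1 <= cmoll. Proof. by rewrite /cmoll le_max lexx orbT. Qed.

Let major_sub rho r : 0 < rho -> ~~ ((r / rho <= 0) || (1 <= r / rho)) -> major (r / rho) = 1.
Proof.
by move=> r0; rewrite negb_or -!ltNge => /andP[h1 h2]; rewrite major1// h1 ltW.
Qed.

Lemma moll_ge0 rho r : 0 < rho -> 0 <= moll rho r.
Proof. by move=> r0; rewrite mulr_ge0 ?cutoff_ge0 ?invr_ge0 ?(ltW r0). Qed.

Lemma moll_le rho r : 0 < rho -> `|moll rho r| <= cmoll * rho^-1 * major (r / rho).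
Proof.
move=> r0; rewrite ger0_norm ?moll_ge0// /moll mulrAC mulrC.
rewrite ler_pM2r ?invr_gt0//.
have [h|h] := boolP ((r / rho <= 0) || (1 <= r / rho)).
  by rewrite cutoff_out// mulr_ge0 ?major_ge0// (le_trans ler01 cmoll1).
by rewrite major_sub// mulr1 (le_trans (cutoff_le _))//; have := cb0; have := cb; lra.
Qed.

Lemma moll_half_le rho r : 0 < rho -> `|moll (rho / 2) r| <= cmoll * rho^-1 * major (r / rho).
Proof.
move=> r0; have r20 : 0 < rho / 2 by rewrite divr_gt0.
rewrite ger0_norm ?moll_ge0// /moll.
have [h|h] := boolP ((r / (rho / 2) <= 0) || (1 <= r / (rho / 2))).
  by rewrite cutoff_out// mulr0 !mulr_ge0 ?major_ge0 ?invr_ge0 ?(ltW r0)// (le_trans ler01 cmoll1).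
move: h; rewrite negb_or -!ltNge ltr_pdivrMr// mul1r pmulr_lgt0 ?invr_gt0// => /andP[h1 h2].
rewrite major1; last by rewrite divr_gt0//= ler_pdivrMr// mul1r; lra.
rewrite mulr1 invfM invrK (mulrC _ 2) mulrAC ler_pM2r ?invr_gt0//.
by have := cutoff_le (r * (2 / rho)); have := cb0; have := cb; lra.
Qed.

Lemma dmoll_half_le rho r : 0 < rho ->
  `|dmoll (rho / 2) r| <= cmoll * rho^-1 * major (r / rho) * rho^-1.
Proof.
move=> r0; have r20 : 0 < rho / 2 by rewrite divr_gt0.
rewrite /dmoll.
have [h|h] := boolP ((r / (rho / 2) <= 0) || (1 <= r / (rho / 2))).
  rewrite dcutoff_out// !mulr0 normr0 !mulr_ge0 ?major_ge0 ?invr_ge0 ?(ltW r0)//.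
  exact: (le_trans ler01 cmoll1).
move: h; rewrite negb_or -!ltNge ltr_pdivrMr// mul1r pmulr_lgt0 ?invr_gt0// => /andP[h1 h2].
rewrite major1; last by rewrite divr_gt0//= ler_pdivrMr// mul1r; lra.
rewrite mulr1 mulrA normrM ger0_norm; last by rewrite mulr_ge0// invr_ge0 ltW.
have -> : (rho / 2)^-1 * (rho / 2)^-1 * `|dcutoff (r / (rho / 2))| =
    4 * `|dcutoff (r / (rho / 2))| * rho^-1 * rho^-1 by field; rewrite gt_eqF.
rewrite !ler_pM2r ?invr_gt0//.
by have := dcutoff_le (r / (rho / 2)); have := cb0; have := cb; lra.
Qed.

Lemma stepdiff_le rho r : 0 < rho -> `|stepdiff rho r| <= cmoll * major (r / rho).
Proof.
move=> r0; have r20 : 0 < rho / 2 by rewrite divr_gt0.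
apply: (@le_trans _ _ (major (r / rho))); last by rewrite ler_peMl ?major_ge0// cmoll1.
rewrite /stepdiff.
have [h|h] := leP r 0.
  by rewrite !step_le0 ?subrr ?normr0 ?major_ge0// pmulr_lle0 ?invr_gt0.
have [h'|h'] := leP rho r.
  rewrite !step_ge1 ?subrr ?normr0 ?major_ge0// ler_pdivlMr// mul1r//; lra.
rewrite major1; last by rewrite divr_gt0//= ler_pdivrMr// mul1r ltW.
have := step_ge0 (r / rho); have := step_le1 (r / rho).
have := step_ge0 (r / (rho / 2)); have := step_le1 (r / (rho / 2)).
by move=> a b e f; rewrite ler_norml; apply/andP; split; lra.
Qed.

Lemma is_derive_reflect (f df : R -> R) (x y rho : R) : (forall x : R, is_derive x (1 : R) f (df x)) ->
  is_derive y (1 : R) (fun y : R => f ((x - y) / rho)) (- (rho^-1 * df ((x - y) / rho))).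
Proof.
move=> hf.
have h : is_derive y (1 : R) (fun y : R => - rho^-1 * y + x / rho) (- rho^-1).
  by apply: is_derive_eq; rewrite addr0 /GRing.scale/= mulr1.
have := @is_derive_chain R f (fun y : R => - rho^-1 * y + x / rho) y _ _ (hf _) h.
have e (w : R) : - rho^-1 * w + x / rho = (x - w) / rho by ring.
by under eq_fun do rewrite e; rewrite e mulrN mulrC.
Qed.

Lemma tame1_reflect (f : R -> R) (x rho : R) : tame1 (d := d) f -> tame1 (d := d) (fun y => f ((x - y) / rho)).
Proof.
move=> tf; have := tame1_affine (- rho^-1) (x / rho) tf.
have e (w : R) : - rho^-1 * w + x / rho = (x - w) / rho by ring.
by under eq_fun do rewrite e.
Qed.

Lemma measurable_reflect (f : R -> R) (x rho : R) : measurable_fun [set: R] f ->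
  measurable_fun [set: R] (fun y => f ((x - y) / rho)).
Proof.
move=> mf; apply: (measurableT_comp mf); apply: measurable_funM => //.
exact: measurable_funB.
Qed.

Lemma measurable_cutoff : measurable_fun [set: R] cutoff.
Proof.
apply: continuous_measurable_fun => x; apply: differentiable_continuous; apply/derivable1_diffP.
by apply: ex_derive; exact: is_derive_cutoff.
Qed.

Lemma measurable_dcutoff : measurable_fun [set: R] dcutoff.
Proof.
have m1 : measurable_fun [set: R] (fun x : R => 1 - x) by exact: measurable_funB.
apply: measurable_funM => //; apply: measurable_funB; apply: measurable_funM;
  try exact: measurable_flat; apply: measurableT_comp m1; exact: measurable_flat.
Qed.

Lemma profile_le B B' (c dc : R -> R) : B <= B' -> profile (d := d) B c dc -> profile (d := d) B' c dc.
Proof.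
move=> BB' [h1 h2 h3 h4]; split => // x; have [a b e] := h4 x.
by split; [exact: le_trans BB'|exact: le_trans BB'|move=> h; apply: e; exact: le_lt_trans h].
Qed.

Lemma profiles (c dc : 'I_d -> R -> R) : (forall i, exists B, profile (d := d) B (c i) (dc i)) ->
  exists B, forall i, profile (d := d) B (c i) (dc i).
Proof.
move=> /choice[B hB]; exists (\sum_i `|B i|) => i; apply: profile_le (hB i).
rewrite (bigD1 i)//= (le_trans (ler_norm _))// lerDl; exact: sumr_ge0.
Qed.

Let far (rho x y M : R) : 0 < rho -> `|x| + rho <= M -> M < `|y| ->
  ((x - y) / rho <= 0) || (1 <= (x - y) / rho).
Proof.
move=> r0 hM hy; rewrite ler_pdivrMr// mul0r ler_pdivlMr// mul1r.
have hx := ler_norm x; have hx' := ler_norm (- x); rewrite normrN in hx'.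
case: (ler0P y) hy => y0 hy; apply/orP; [right|left]; lra.
Qed.

Lemma profile_moll rho x : 0 < rho ->
  exists B, profile (d := d) B (fun y => moll rho (x - y)) (fun y => - dmoll rho (x - y)).
Proof.
move=> r0; have i0 : 0 <= rho^-1 by rewrite invr_ge0 ltW.
pose B := `|x| + rho + rho^-1 * (bint (1:R))^-1 + rho^-1 * (rho^-1 * ((bint (1:R))^-1 * 4)).
have B1 : 0 <= rho^-1 * (bint (1:R))^-1 by rewrite mulr_ge0// ltW.
have B2 : 0 <= rho^-1 * (rho^-1 * ((bint (1:R))^-1 * 4)) by rewrite !mulr_ge0// ltW.
have nx := normr_ge0 x.
exists B; split.
- apply: tame1_mul; first exact: tame1_cst.
  exact: (tame1_reflect x rho (@tame1_cutoff R d)).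
- move=> y; have h := is_deriveZ rho^-1 (is_derive_reflect x y rho is_derive_cutoff).
  apply: (is_derive_eq h); rewrite /dmoll /GRing.scale/=; ring.
- apply: (measurableT_comp (@oppr_measurable R setT)).
  do 2 apply: measurable_funM => //.
  exact: (measurable_reflect _ _ measurable_dcutoff).
- move=> y; split.
  + rewrite /moll normrM (ger0_norm i0) ger0_norm ?cutoff_ge0//.
    by have := ler_wpM2l i0 (cutoff_le ((x - y) / rho)); rewrite /B; lra.
  + rewrite normrN /dmoll mulrA normrM (ger0_norm (mulr_ge0 i0 i0)) -mulrA.
    have := ler_wpM2l i0 (ler_wpM2l i0 (dcutoff_le ((x - y) / rho))); rewrite /B; lra.
  + move=> hy; have h : ((x - y) / rho <= 0) || (1 <= (x - y) / rho).
      by apply: (far r0 _ hy); rewrite /B; lra.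
    by rewrite /moll /dmoll cutoff_out// dcutoff_out// !mulr0 oppr0.
Qed.

Lemma profile_stepdiff rho x : 0 < rho -> exists B, profile (d := d) B (fun y => stepdiff rho (x - y))
  (fun y => - (moll (rho / 2) (x - y) - moll rho (x - y))).
Proof.
move=> r0; have r20 : 0 < rho / 2 by rewrite divr_gt0.
have i0 : 0 <= rho^-1 by rewrite invr_ge0 ltW.
have mp r : 0 < r -> measurable_fun [set: R] (fun y => moll r (x - y)).
  by move=> _; apply: measurable_funM => //; exact: (measurable_reflect _ _ measurable_cutoff).
pose B := `|x| + rho + 1 + 2 * (cmoll * rho^-1).
have c0 : 0 <= cmoll * rho^-1 by rewrite mulr_ge0// (le_trans ler01 cmoll1).
have nx := normr_ge0 x.
have maj1 (y : R) : major y <= 1.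
  by rewrite /major; case: ifPn => // _; rewrite ge_min lexx.
exists B; split.
- move=> ell a hl; have := tame1_add (tame1_reflect x (rho / 2) (@tame1_step R d))
    (tame1_mul (tame1_cst (-1)) (tame1_reflect x rho (@tame1_step R d))).
  move=> /(_ _ _ hl); by under eq_fun do rewrite mulN1r.
- move=> y; have h := is_deriveB (is_derive_reflect x y (rho / 2) is_derive_step)
    (is_derive_reflect x y rho is_derive_step).
  apply: (is_derive_eq h); rewrite /moll; ring.
- apply: (measurableT_comp (@oppr_measurable R setT)).
  by apply: measurable_funB; exact: mp.
- move=> y; split.
  + have := step_ge0 ((x - y) / rho); have := step_le1 ((x - y) / rho).
    have := step_ge0 ((x - y) / (rho / 2)); have := step_le1 ((x - y) / (rho / 2)).
    by move=> a b e f; rewrite /stepdiff /B ler_norml; apply/andP; split; lra.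
  + rewrite normrN; apply: (le_trans (ler_normB _ _)).
    have := moll_le (x - y) r0; have := moll_half_le (x - y) r0.
    by have := ler_wpM2l c0 (maj1 ((x - y) / rho)); rewrite /B; lra.
  + move=> hy; have h r : 0 < r -> r <= rho -> ((x - y) / r <= 0) || (1 <= (x - y) / r).
      by move=> r00 rr; apply: (far r00 _ hy); rewrite /B; lra.
    have e : step ((x - y) / (rho / 2)) = step ((x - y) / rho).
      have [hxy|hxy] := leP (x - y) 0; first by rewrite !step_le0// pmulr_lle0// invr_gt0.
      have := h _ r0 (lexx _); rewrite leNgt divr_gt0//= ler_pdivlMr// mul1r => h'.
      rewrite !step_ge1// ler_pdivlMr// mul1r//; lra.
    rewrite /stepdiff e subrr /moll !cutoff_out ?mulr0 ?subrr ?oppr0// h//; lra.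
Qed.

(** Factors are exchanged one coordinate at a time: term j carries new factors before j, old ones
    after it, and the difference in position j. In the application this difference is an
    x_j-derivative. *)
Lemma prod_telescope n (a a' : 'I_n -> R) : \prod_i a' i - \prod_i a i =
  \sum_(j < n) \prod_(i < n) (if (i < j)%N then a' i else if i == j then a' i - a i else a i).
Proof.
elim: n a a' => [|n ih] a a'; first by rewrite !big_ord0 subrr.
rewrite [in LHS]big_ord_recr [X in _ - X]big_ord_recr big_ord_recr/=.
transitivity ((\prod_(i < n) a' (widen_ord (leqnSn n) i) - \prod_(i < n) a (widen_ord (leqnSn n) i)) * a ord_max +
  \prod_(i < n) a' (widen_ord (leqnSn n) i) * (a' ord_max - a ord_max)); first by ring.
congr (_ + _).
  rewrite (ih (a \o widen_ord (leqnSn n)) (a' \o widen_ord (leqnSn n))) mulr_suml.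
  apply: eq_bigr => j _; rewrite big_ord_recr/= ltnNge (ltnW (ltn_ord j))/=.
  by rewrite -val_eqE/= gtn_eqF ?ltn_ord.
rewrite big_ord_recr/= ltnn eqxx; congr (_ * _).
by apply: eq_bigr => i _; rewrite /= ltn_ord.
Qed.

End mollifiers.

Section weight_calculus.
Context {R : realType} {d : nat}.
Notation mu := (@lebesgue_measure R).
Notation T1 := (measurableTypeR R).
Notation Z := (R * 'rV[R]_d)%type.
Notation tx := (@lebesgue_tx R d).
Variables (p T : R).
Hypotheses (p1 : 1 < p) (T0 : 0 < T).
Local Notation D := (cyl T [set: 'rV[R]_d]).

Definition wint (F : Z -> R) (a : R -> R) (e : 'I_d -> R -> R) : R :=
  \int[tx]_(z in D) (F z * (a z.1 * prodf e z.2)).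

Definition weight (a : R -> R) :=
  measurable_fun [set: R] a /\ exists A, forall s, 0 < s < T -> `|a s| <= A.

Lemma weight_lin a b k1 k2 : weight a -> weight b -> weight (fun s => k1 * a s + k2 * b s).
Proof.
move=> [ma [A hA]] [mb [B hB]]; split.
  by apply: measurable_funD; exact: measurable_funM.
exists (`|k1| * A + `|k2| * B) => s hs; apply: (le_trans (ler_normD _ _)).
by rewrite !normrM lerD// ler_wpM2l// ?hA ?hB.
Qed.

Variables (B : R) (c dc : 'I_d -> R -> R).
Hypothesis hc : forall i, profile (d := d) B (c i) (dc i).

Definition admissible (e : 'I_d -> R -> R) := e = c \/ exists j, e = upd c dc j.

Lemma wint_integrable F a e : in_Lp p D F -> weight a -> admissible e ->
  tx.-integrable D (EFin \o (fun z => F z * (a z.1 * prodf e z.2))).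
Proof.
move=> LF [ma [A hA]] he.
by have [] := cvg_weight_prodf p1 T0 hc he LF (fun=> ma) ma (fun _ => hA) (fun s _ => cvg_cst _).
Qed.

Lemma wint_lin F a b k1 k2 e : in_Lp p D F -> weight a -> weight b -> admissible e ->
  wint F (fun s => k1 * a s + k2 * b s) e = k1 * wint F a e + k2 * wint F b e.
Proof.
move=> LF wa wb he; have mD := @measurable_cyl R d T.
have ia := wint_integrable LF wa he; have ib := wint_integrable LF wb he.
rewrite /wint -(RintegralZl k1 mD ia) -(RintegralZl k2 mD ib) -RintegralD//.
- by apply: eq_Rintegral => z _; ring.
- exact: (integrableZl mD k1 ia).
- exact: (integrableZl mD k2 ib).
Qed.

Lemma abs_wint_le F a e : in_Lp p D F -> weight a -> admissible e ->
  (`|wint F a e|%:E <= \int[tx]_(z in D) (`|F z| * (`|a z.1| * `|prodf e z.2|))%:E)%E.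
Proof.
move=> LF wa he; have mD := @measurable_cyl R d T.
have ia := wint_integrable LF wa he.
rewrite /wint /Rintegral -abse_EFin fineK ?integrable_fin_num//.
apply: (le_trans (le_abse_integral tx mD (measurable_int _ ia))).
rewrite le_eqVlt; apply/orP; left; apply/eqP; apply: eq_integral => z _.
by rewrite abse_EFin !normrM.
Qed.

Lemma weight_lt t : weight (fun s => (s < t)%R%:R).
Proof.
split; first exact: measurable_lt_natr.
by exists 1 => s _; rewrite normr_nat; case: (s < t)%R.
Qed.

Lemma weight_riesz b t : 1 <= b -> weight (fun s => riesz b (t - s)).
Proof.
move=> b1; split.
  by apply: (measurableT_comp (measurable_riesz _)); exact: measurable_funB.
exists (Num.max t 0 `^ (b - 1)) => s /andP[s0 _].
rewrite ger0_norm ?riesz_ge0// riesz_le// ?le_max ?lexx ?orbT//.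
by apply/orP; left; lra.
Qed.

Lemma wint0 F a e : (forall s, 0 < s < T -> a s = 0) -> wint F a e = 0.
Proof.
move=> a0; rewrite /wint /Rintegral (eq_integral (cst 0%E)) ?integral0//.
by move=> z; rewrite inE => -[/=]; rewrite in_itv/= => hz _; rewrite a0// mul0r mulr0.
Qed.

Lemma chiE (tau t s : R) : chi tau (t - s) = tau^-1 * (s < t)%R%:R + (- tau^-1) * (s < t - tau)%R%:R.
Proof. by rewrite /chi subr_gt0 ltrBrDl -ltrBrDr; ring. Qed.

Lemma wkerE (al tau t s : R) : wker al tau (t - s) =
  tau^-1 * riesz (al + 1) (t - s) + (- tau^-1) * riesz (al + 1) (t - tau - s).
Proof. by rewrite /wker (addrAC t (- s)); ring. Qed.

Lemma weight_chi tau t : weight (fun s => chi tau (t - s)).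
Proof.
have -> : (fun s => chi tau (t - s)) =
    (fun s => tau^-1 * (s < t)%R%:R + (- tau^-1) * (s < t - tau)%R%:R).
  by apply/funext => s; rewrite chiE.
by apply: weight_lin; exact: weight_lt.
Qed.

Lemma weight_wker al tau t : 0 <= al -> weight (fun s => wker al tau (t - s)).
Proof.
move=> a0; have -> : (fun s => wker al tau (t - s)) =
    (fun s => tau^-1 * riesz (al + 1) (t - s) + (- tau^-1) * riesz (al + 1) (t - tau - s)).
  by apply/funext => s; rewrite wkerE.
by apply: weight_lin; apply: weight_riesz; lra.
Qed.

(** [chi] is a multiple of the difference of the truncations at t and t - tau, and
    [weak_gradient_trunc] handles each. A truncation at a nonpositive time gives 0 on both sides, so
    t - tau may lie before the initial time. *)
Lemma wint_grad (u : Z -> R) (Du : Z -> 'rV[R]_d) tau t j :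
  in_Lp p D u -> in_vLp p D Du -> weak_gradient T setT u Du -> t < T -> 0 < tau ->
  wint u (fun s => chi tau (t - s)) (upd c dc j) = - wint (fun z => Du z ord0 j) (fun s => chi tau (t - s)) c.
Proof.
move=> Lu LDu wDu tT tau0.
have hj : admissible (upd c dc j) by right; exists j.
have hc' : admissible c by left.
have key r : r < T -> wint u (fun s => (s < r)%R%:R) (upd c dc j) =
    - wint (fun z => Du z ord0 j) (fun s => (s < r)%R%:R) c.
  move=> rT; have [r0|r0] := ltP 0 r.
    by apply: (weak_gradient_trunc p1 T0 hc j Lu LDu wDu); rewrite r0.
  rewrite !wint0 ?oppr0// => s /andP[s0 _]; rewrite ltNge (le_trans r0 (ltW s0))//.
have -> : (fun s => chi tau (t - s)) =
    (fun s => tau^-1 * (s < t)%R%:R + (- tau^-1) * (s < t - tau)%R%:R).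
  by apply/funext => s; rewrite chiE.
rewrite !wint_lin//; try exact: weight_lt.
by rewrite !key//; [ring|lra].
Qed.

(** Linear combinations of [weak_eq_trunc] at t, t - tau and t - tau', with nonpositive times
    contributing 0. Two scales are subtracted because only the difference of the weights [wker] has
    usable decay. *)
Lemma wint_frac (al : R) (u f : Z -> R) (g : Z -> 'rV[R]_d) tau tau' t :
  0 < al < 1 -> in_Lp p D u -> in_vLp p D g -> in_Lp p D f ->
  weak_frac al T u f g ->
  t < T -> 0 < tau -> 0 < tau' ->
  let wd s := wker al tau' (t - s) - wker al tau (t - s) in
  al * ((Gamma (1 - al))^-1 * fine (ebeta al)) *
    (wint u (fun s => chi tau' (t - s)) c - wint u (fun s => chi tau (t - s)) c) =
  wint f wd c - \sum_(j < d) wint (fun z => g z ord0 j) wd (upd c dc j).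
Proof.
move=> hal Lu Lg Lf hw tT t0 t0' wd; have /andP[a0 a1] := hal.
set K := al * _.
have alg (U1 U2 F1 F2 S1 S2 k : R) : K * U1 = F1 - S1 -> K * U2 = F2 - S2 ->
    K * (k * U1 + - k * U2) = k * F1 + - k * F2 - (k * S1 + - k * S2).
  move=> h1 h2; transitivity (k * (K * U1) - k * (K * U2)); first by ring.
  by rewrite h1 h2; ring.
have sl (k1 k2 : R) (F G : 'I_d -> R) :
    \sum_j (k1 * F j + k2 * G j) = k1 * \sum_j F j + k2 * \sum_j G j.
  by rewrite big_split !mulr_sumr.
have hj j : admissible (upd c dc j) by right; exists j.
have hc' : admissible c by left.
have b1 : 1 <= al + 1 by lra.
have key r : r < T -> K * wint u (fun s => (s < r)%R%:R) c =
    wint f (fun s => riesz (al + 1) (r - s)) c -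
    \sum_(j < d) wint (fun z => g z ord0 j) (fun s => riesz (al + 1) (r - s)) (upd c dc j).
  move=> rT; have [r0|r0] := ltP 0 r.
    have hr : 0 < r < T by rewrite r0.
    by rewrite /K -mulrA; exact: (weak_eq_trunc p1 T0 hc hal Lu Lg Lf hw hr).
  have rz s : 0 < s < T -> riesz (al + 1) (r - s) = 0.
    by move=> /andP[s0 _]; rewrite /riesz ifF//; apply/negbTE; rewrite -leNgt; lra.
  rewrite !wint0//; last by move=> s /andP[s0 _]; rewrite ltNge (le_trans r0 (ltW s0)).
  by rewrite mulr0 big1 ?subr0// => j _; rewrite wint0.
have key2 ta : 0 < ta -> K * wint u (fun s => chi ta (t - s)) c = wint f (fun s => wker al ta (t - s)) c -
    \sum_(j < d) wint (fun z => g z ord0 j) (fun s => wker al ta (t - s)) (upd c dc j).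
  move=> ta0.
  have -> : (fun s => chi ta (t - s)) =
      (fun s => ta^-1 * (s < t)%R%:R + (- ta^-1) * (s < t - ta)%R%:R).
    by apply/funext => s; rewrite chiE.
  have -> : (fun s => wker al ta (t - s)) =
      (fun s => ta^-1 * riesz (al + 1) (t - s) + (- ta^-1) * riesz (al + 1) (t - ta - s)).
    by apply/funext => s; rewrite wkerE.
  under eq_bigr => j _ do rewrite (wint_lin _ _ (Lg j) (weight_riesz _ b1) (weight_riesz _ b1) (hj j)).
  rewrite sl.
  rewrite (wint_lin _ _ Lu (weight_lt _) (weight_lt _) hc').
  rewrite (wint_lin _ _ Lf (weight_riesz _ b1) (weight_riesz _ b1) hc').
  have k1 := key _ tT; have k2 : t - ta < T by lra.
  have {}k2 := key _ k2.
  exact: (alg _ _ _ _ _ _ _ k1 k2).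
have wdE : wd = (fun s => 1 * wker al tau' (t - s) + (-1) * wker al tau (t - s)).
  by apply/funext => s; rewrite /wd; ring.
have ww ta : weight (fun s => wker al ta (t - s)) by apply: weight_wker; exact: ltW.
rewrite wdE; under eq_bigr => j _ do rewrite (wint_lin _ _ (Lg j) (ww _) (ww _) (hj j)).
rewrite sl (wint_lin _ _ Lf (ww _) (ww _) hc').
have := alg _ _ _ _ _ _ 1 (key2 _ t0') (key2 _ t0).
by rewrite mul1r mulN1r.
Qed.

End weight_calculus.

Section enorm_lemmas.
Context {R : realType} {d : nat}.

Lemma le_enorm (x : 'rV[R]_d) j : `|x ord0 j| <= enorm x.
Proof.
rewrite -sqrtr_sqr /enorm ler_wsqrtr// (bigD1 j)//= lerDl.
by apply: sumr_ge0 => i _; exact: sqr_ge0.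
Qed.

Lemma enorm_ge0 (x : 'rV[R]_d) : 0 <= enorm x.
Proof. exact: sqrtr_ge0. Qed.

Lemma enorm_le_sum (x : 'rV[R]_d) : enorm x <= \sum_i `|x ord0 i|.
Proof.
have s0 : 0 <= \sum_i `|x ord0 i| by exact: sumr_ge0.
rewrite -(ger0_norm s0) -sqrtr_sqr ler_wsqrtr//.
rewrite expr2 mulr_suml; apply: ler_sum => i _.
rewrite -real_normK ?num_real// expr2 ler_wpM2l// (bigD1 i)//= lerDl; exact: sumr_ge0.
Qed.

End enorm_lemmas.

Lemma step_arith {R : realType} (d : nat) (tc a0 r : R) (F G E : \bar R) : 0 <= tc -> 0 <= a0 -> 0 <= r ->
  (0 <= F -> 0 <= G -> 0 <= E ->
  (tc * r ^+ 2)%:E * F + (d%:R * (tc * r))%:E * G + (d%:R * (a0 * r))%:E * E <=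
  ((tc + a0) * d.+1%:R)%:E * (r%:E * (E + G) + (r ^+ 2)%:E * F))%E.
Proof.
move=> t0 a00 r0 F0 G0 E0; have d0 : 0 <= (d%:R : R) by [].
have c0 : 0 <= (tc + a0) * d.+1%:R by rewrite mulr_ge0// addr_ge0.
have r20 : 0 <= r ^+ 2 by exact: sqr_ge0.
rewrite ge0_muleDr ?mule_ge0 ?adde_ge0 ?lee_fin//.
rewrite ge0_muleDr// ge0_muleDr ?mule_ge0 ?lee_fin// !muleA -!EFinM.
rewrite [leLHS]addeC [X in (_ + X)%E]addeC addeA -natr1 leeD//.
  by rewrite leeD// lee_wpmul2r// lee_fin [leLHS]mulrA ler_wpM2r//; nra.
by rewrite lee_wpmul2r// lee_fin ler_wpM2r//; nra.
Qed.

(** * Comparison of averages at consecutive scales *)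

Section approximation.
Context {R : realType} {d : nat}.
Notation mu := (@lebesgue_measure R).
Notation T1 := (measurableTypeR R).
Notation Z := (R * 'rV[R]_d)%type.
Notation tx := (@lebesgue_tx R d).
Variables (al p T : R).
Hypotheses (hal : 0 < al < 1) (p1 : 1 < p) (T0 : 0 < T).
Local Notation D := (cyl T [set: 'rV[R]_d]).

(** The time scale whose power al is rho^2, so that al time derivatives balance two space
    derivatives; see [tscale_pow]. *)
Definition tscale (rho : R) : R := rho `^ (2 / al).

Definition majk (rho : R) (z w : Z) : R :=
  (tscale rho)^-1 * rho^-1 ^+ d *
  (major ((z.1 - w.1) / tscale rho) * \prod_i major ((z.2 ord0 i - w.2 ord0 i) / rho)).

Definition majint (rho : R) (F : Z -> R) (z : Z) : \bar R :=
  (\int[tx]_(w in D) (`|F w| * majk rho z w)%:E)%E.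

(* The average only involves the past of z, so that the test functions behind it
   vanish near T, and only points below z in each coordinate, which makes the
   limiting kernel a product of one-sided Riesz kernels. *)
Definition mollify (u : Z -> R) (rho : R) (z : Z) : R :=
  wint T u (fun s => chi (tscale rho) (z.1 - s)) (fun i y => moll rho (z.2 ord0 i - y)).

Lemma tscale_gt0 rho : 0 < rho -> 0 < tscale rho. Proof. exact: powR_gt0. Qed.

Lemma majk_ge0 rho z w : 0 < rho -> 0 <= majk rho z w.
Proof.
move=> r0; rewrite !mulr_ge0 ?exprn_ge0 ?invr_ge0 ?(ltW r0) ?powR_ge0 ?major_ge0//.
by apply: prodr_ge0 => i _; exact: major_ge0.
Qed.

Lemma measurable_majk rho z : measurable_fun [set: T1 * 'rV[R]_d] (majk rho z).
Proof.
apply: measurable_funM => //; apply: measurable_funM.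
  apply: (measurableT_comp measurable_major); apply: measurable_funM => //.
  exact: measurable_funB.
apply: measurable_prod => i _; apply: (measurableT_comp measurable_major).
apply: measurable_funM => //; apply: measurable_funB => //.
exact: (measurableT_comp (measurable_rV_entry i) measurable_snd).
Qed.

Lemma in_Lp_measurableD F : in_Lp p D F -> measurable_fun (D : set (T1 * 'rV[R]_d)) F.
Proof.
move=> LF; apply/(measurable_restrictT _ (@measurable_cyl R d T)); exact: in_Lp_measurable LF.
Qed.

Lemma majint_ge0 rho F z : 0 < rho -> (0 <= majint rho F z)%E.
Proof. by move=> r0; apply: integral_ge0 => w _; rewrite lee_fin mulr_ge0 ?majk_ge0. Qed.

Lemma measurable_majint_fun rho (F : Z -> R) z : measurable_fun (D : set (T1 * 'rV[R]_d)) F ->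
  measurable_fun (D : set (T1 * 'rV[R]_d)) (fun w => (`|F w| * majk rho z w)%:E).
Proof.
move=> mF; apply/measurable_EFinP; apply: measurable_funM.
  exact: (measurableT_comp (@normr_measurable R setT)).
by apply: measurable_funTS; exact: measurable_majk.
Qed.

Lemma majint_mono rho (F G : Z -> R) z : 0 < rho -> measurable_fun (D : set (T1 * 'rV[R]_d)) F ->
  measurable_fun (D : set (T1 * 'rV[R]_d)) G -> (forall w, `|F w| <= `|G w|) ->
  (majint rho F z <= majint rho G z)%E.
Proof.
move=> r0 mF mG FG; apply: ge0_le_integral => //.
- exact: measurable_cyl.
- by move=> w _; rewrite lee_fin mulr_ge0 ?majk_ge0.
- exact: measurable_majint_fun.
- exact: measurable_majint_fun.
- by move=> w _; rewrite lee_fin ler_wpM2r ?majk_ge0.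
Qed.

Section profile_bounds.
Variables (B : R) (c dc : 'I_d -> R -> R).
Hypothesis hc : forall i, profile (d := d) B (c i) (dc i).

Lemma wint_le_majint F a e k rho z : 0 < rho -> 0 <= k -> in_Lp p D F -> weight T a ->
  admissible c dc e ->
  (forall w, `|a w.1| * `|prodf e w.2| <= k * majk rho z w) ->
  (`|wint T F a e|%:E <= k%:E * majint rho F z)%E.
Proof.
move=> r0 k0 LF wa he hk; have mD := @measurable_cyl R d T.
have mF := in_Lp_measurableD LF.
apply: (le_trans (abs_wint_le p1 T0 hc LF wa he)).
rewrite /majint -ge0_integralZl_EFin//; last 2 first.
- by move=> w _; rewrite lee_fin mulr_ge0 ?majk_ge0.
- exact: measurable_majint_fun.
apply: ge0_le_integral => //.
- have := measurable_int _ (wint_integrable p1 T0 hc LF wa he) => /measurable_EFinP h.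
  apply/measurable_EFinP; have := measurableT_comp (@normr_measurable R setT) h.
  by apply: eq_measurable_fun => w _; rewrite /= !normrM.
- by apply: emeasurable_funM => //; exact: measurable_majint_fun.
- by move=> w _; rewrite -EFinM lee_fin (mulrCA k) ler_wpM2l.
Qed.

End profile_bounds.

Lemma prodf_le (e : 'I_d -> R -> R) (x : 'I_d -> R) rho (th : 'I_d -> R) y : 0 < rho ->
  (forall i y, `|e i y| <= cmoll * rho^-1 * major ((x i - y) / rho) * th i) ->
  `|prodf e y| <= cmoll ^+ d * (\prod_i th i) * (rho^-1 ^+ d * \prod_i major ((x i - y ord0 i) / rho)).
Proof.
move=> r0 he; rewrite /prodf normr_prod.
apply: (@le_trans _ _ (\prod_i (cmoll * rho^-1 * major ((x i - y ord0 i) / rho) * th i))).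
  by apply: ler_prod => i _; rewrite normr_ge0 he.
rewrite !big_split/= !prodr_const card_ord le_eqVlt; apply/orP; left; apply/eqP; ring.
Qed.

Lemma prod_single (j : 'I_d) (th : R) : \prod_(i < d) (if i == j then th else 1) = th.
Proof. by rewrite -big_mkcond big_pred1_eq. Qed.

Lemma majkE rho z w : majk rho z w = ((tscale rho)^-1 * major ((z.1 - w.1) / tscale rho)) *
  (rho^-1 ^+ d * \prod_i major ((z.2 ord0 i - w.2 ord0 i) / rho)).
Proof. by rewrite /majk; ring. Qed.

Let A0 : R := cmoll ^+ d.

Let A00 : 0 <= A0. Proof. by rewrite exprn_ge0// (le_trans ler01 cmoll1). Qed.

(** The numbers [th i] record how the factor in coordinate i deviates from the size of a mollifier:
    rho for the primitive [stepdiff], rho^(-1) for a derivative, 1 otherwise. Their product is the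
    net power of rho in the estimate. *)
Lemma weight_prod_le (e : 'I_d -> R -> R) (a : R -> R) rho (th : 'I_d -> R) k (z w : Z) : 0 < rho -> 0 <= k ->
  (forall i, 0 <= th i) ->
  (forall s, `|a s| <= k * ((tscale rho)^-1 * major ((z.1 - s) / tscale rho))) ->
  (forall i y, `|e i y| <= cmoll * rho^-1 * major ((z.2 ord0 i - y) / rho) * th i) ->
  `|a w.1| * `|prodf e w.2| <= k * A0 * (\prod_i th i) * majk rho z w.
Proof.
move=> r0 k0 t0 ha he; rewrite majkE.
have := ler_pM (normr_ge0 _) (normr_ge0 _) (ha w.1) (prodf_le w.2 r0 he).
by move=> h; apply: (le_trans h); rewrite le_eqVlt; apply/orP; left; apply/eqP; rewrite /A0; ring.
Qed.

Lemma mollify_le u rho z : 0 < rho -> in_Lp p D u -> (`|mollify u rho z|%:E <= A0%:E * majint rho u z)%E.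
Proof.
move=> r0 Lu.
have [B hc] := profiles (fun i : 'I_d => @profile_moll R d rho (z.2 ord0 i) r0).
apply: (wint_le_majint hc r0 A00 Lu); first exact: weight_chi.
  by left.
move=> w; have := @weight_prod_le (fun i y => moll rho (z.2 ord0 i - y))
  (fun s => chi (tscale rho) (z.1 - s)) rho (fun=> 1) 1 z w r0 ler01 (fun=> ler01).
rewrite big1// mul1r mulr1; apply.
- by move=> s; rewrite mul1r chi_le// tscale_gt0.
- by move=> i y; rewrite mulr1 moll_le.
Qed.

Section step.
Variables (u f : Z -> R) (Du g : Z -> 'rV[R]_d).
Hypotheses (Lu : in_Lp p D u) (Lf : in_Lp p D f) (LDu : in_vLp p D Du) (Lg : in_vLp p D g).
Hypothesis wDu : weak_gradient T setT u Du.
Hypothesis hw : weak_frac al T u f g.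

Let menorm (G : Z -> 'rV[R]_d) : in_vLp p D G ->
  measurable_fun (D : set (T1 * 'rV[R]_d)) (fun z => enorm (G z)).
Proof.
move=> LG; apply: (measurableT_comp (continuous_measurable_fun (@sqrt_continuous R))).
apply: measurable_sum => i; apply: measurable_funX; exact: in_Lp_measurableD (LG i).
Qed.

Lemma sum_majint_le (k rho : R) (G : Z -> 'rV[R]_d) z : 0 < rho -> 0 <= k -> in_vLp p D G ->
  (\sum_(j < d) (k%:E * majint rho (fun w => G w ord0 j) z) <=
   (d%:R * k)%:E * majint rho (fun w => enorm (G w)) z)%E.
Proof.
move=> r0 k0 LG.
apply: (@le_trans _ _ (\sum_(j < d) (k%:E * majint rho (fun w => enorm (G w)) z))%E).
  apply: lee_sum => j _; rewrite lee_wpmul2l ?lee_fin//; apply: majint_mono => //.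
  - exact: in_Lp_measurableD.
  - exact: menorm.
  - by move=> w; rewrite (ger0_norm (enorm_ge0 _)) le_enorm.
by rewrite sumr_const card_ord EFinM -muleA mule_natl.
Qed.

(** The time window stays at scale rho while the spatial mollifiers pass from rho to rho / 2
    coordinate by coordinate. Each exchange is minus the x_j-derivative of a test profile containing
    [stepdiff], so [wint_grad] turns it into an average of the j-th component of Du, with a gain of
    rho from the primitive. *)
Lemma space_step rho (z : Z) : 0 < rho -> z.1 < T ->
  (`|wint T u (fun s => chi (tscale rho) (z.1 - s)) (fun i y => moll (rho / 2) (z.2 ord0 i - y))
     - mollify u rho z|%:E <= (d%:R * (A0 * rho))%:E * majint rho (fun w => enorm (Du w)) z)%E.
Proof.
move=> r0 zT; have r20 : 0 < rho / 2 by rewrite divr_gt0.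
set a := (fun s => chi _ _).
have wa : weight T a by exact: weight_chi.
pose x i := z.2 ord0 i.
pose c (j i : 'I_d) (y : R) : R := if (i < j)%N then moll (rho / 2) (x i - y) else
  if i == j then stepdiff rho (x i - y) else moll rho (x i - y).
pose dc (j i : 'I_d) (y : R) : R := if (i < j)%N then - dmoll (rho / 2) (x i - y) else
  if i == j then - (moll (rho / 2) (x i - y) - moll rho (x i - y)) else - dmoll rho (x i - y).
have hcj j : exists B, forall i, profile (d := d) B (c j i) (dc j i).
  apply: profiles => i; rewrite /c /dc; case: (i < j)%N; first exact: profile_moll.
  by case: (i == j); [exact: profile_stepdiff|exact: profile_moll].
have [B1 hc1] := profiles (fun i : 'I_d => @profile_moll R d rho (x i) r0).
have [B2 hc2] := profiles (fun i : 'I_d => @profile_moll R d _ (x i) r20).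
have i1 := wint_integrable p1 T0 hc1 Lu wa (or_introl erefl).
have i2 := wint_integrable p1 T0 hc2 Lu wa (or_introl erefl).
have mD := @measurable_cyl R d T.
have ij j : tx.-integrable D (EFin \o (fun w => - (u w * (a w.1 * prodf (upd (c j) (dc j) j) w.2)))).
  have [B hc] := hcj j.
  have := wint_integrable p1 T0 hc Lu wa (or_intror (ex_intro _ j erefl)).
  by move=> h; have := integrableN h.
rewrite (_ : _ - _ = \sum_(j < d) wint T (fun w => Du w ord0 j) a (c j)); last first.
  rewrite /mollify -/a /wint -RintegralB//.
  transitivity (\int[tx]_(w in D) \sum_(j < d) - (u w * (a w.1 * prodf (upd (c j) (dc j) j) w.2))).
    apply: eq_Rintegral => w _; rewrite -mulrBr -mulrBr sumrN -mulr_sumr -mulr_sumr -!mulrN.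
    congr (_ * (_ * _)); rewrite /prodf prod_telescope -sumrN; apply: eq_bigr => j _.
    rewrite (bigD1 j)// [in RHS](bigD1 j)//= ltnn !eqxx /upd eqxx /dc ltnn eqxx mulNr opprK.
    congr (_ * _); apply: eq_bigr => i nij; rewrite (negbTE nij) /c.
    by case: (i < j)%N; rewrite ?(negbTE nij).
  rewrite Rintegral_sum//; apply: eq_bigr => j _.
  have [B hc] := hcj j.
  have := wint_grad p1 T0 hc j Lu LDu wDu zT (tscale_gt0 r0); rewrite -/a => e.
  rewrite -[RHS]opprK -e /wint -[in RHS]mulN1r -RintegralZl//.
    by apply: eq_Rintegral => w _; rewrite mulN1r.
  exact: (wint_integrable p1 T0 hc Lu wa (or_intror (ex_intro _ j erefl))).
apply: le_trans (sum_majint_le z r0 (mulr_ge0 A00 (ltW r0)) LDu).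
apply: (@le_trans _ _ (\sum_(j < d) `|wint T (fun w => Du w ord0 j) a (c j)|%:E)%E).
  by rewrite sumEFin lee_fin ler_norm_sum.
apply: lee_sum => j _; have [B hc] := hcj j.
apply: (wint_le_majint hc r0 (mulr_ge0 A00 (ltW r0)) (LDu j) wa); first by left.
move=> w; have := @weight_prod_le (c j) a rho (fun i => if i == j then rho else 1) 1 z w r0 ler01.
rewrite prod_single mul1r; apply.
- by move=> i; case: eqP => // _; exact: ltW.
- by move=> s; rewrite mul1r chi_le// tscale_gt0.
- move=> i y; rewrite /c; case: ltngtP => lij.
  + by rewrite -val_eqE/= (ltn_eqF lij) mulr1 moll_half_le.
  + by rewrite -val_eqE/= (gtn_eqF lij) mulr1 moll_le.
  + by rewrite -val_eqE/= lij eqxx mulrAC mulfVK ?gt_eqF// stepdiff_le.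
Qed.

Let K : R := al * ((Gamma (1 - al))^-1 * fine (ebeta al)).

Let lam : R := 2^-1 `^ (2 / al).

Let Cw : R := 4 * (lam^-1 + 1).

Definition time_const : R := K^-1 * Cw * A0.

Let K0 : 0 < K.
Proof.
have /andP[a0 _] := hal; have /andP[e0 e1] := ebeta_fin_gt0 hal.
rewrite !mulr_gt0 ?invr_gt0 ?Gamma_gt0//.
by rewrite fine_gt0// e0.
Qed.

Let lam01 : 0 < lam <= 1.
Proof.
have /andP[a0 _] := hal.
rewrite powR_gt0 ?invr_gt0//=; apply: (@le_trans _ _ (1 `^ (2 / al))); last by rewrite powR1.
by rewrite ge0_ler_powR ?nnegrE ?divr_ge0 ?(ltW a0)//; lra.
Qed.

Let Cw0 : 0 <= Cw.
Proof. by have /andP[l0 _] := lam01; rewrite mulr_ge0// addr_ge0// invr_ge0 ltW. Qed.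

Lemma time_const_ge0 : 0 <= time_const.
Proof.
by rewrite /time_const; apply: mulr_ge0 => //; apply: mulr_ge0 => //; rewrite invr_ge0; exact: ltW.
Qed.

Let tscale_half rho : 0 < rho -> tscale (rho / 2) = lam * tscale rho.
Proof. by move=> r0; rewrite /tscale powRM ?(ltW r0) ?invr_ge0// mulrC. Qed.

Let tscale_pow rho : 0 < rho -> tscale rho `^ (al - 1) = rho ^+ 2 * (tscale rho)^-1.
Proof.
move=> r0; have /andP[a0 _] := hal.
rewrite powRD_gt0 ?tscale_gt0// powR_inv1 ?(ltW (tscale_gt0 r0))//; congr (_ * _).
by rewrite /tscale -powRrM mulfVK ?gt_eqF// powR_mulrn// ltW.
Qed.

(** Now the spatial mollifiers stay at rho / 2 and the time window shrinks. [wint_frac] expresses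
    the change by f and g with the weight of [wker_diff], which [tscale_pow] shows to be rho^2 times
    an average. The spatial derivative falling on the mollifier next to g costs rho^(-1), so f keeps
    rho^2 and g keeps rho. *)
Lemma time_step rho (z : Z) : 0 < rho -> z.1 < T ->
  (`|mollify u (rho / 2) z -
     wint T u (fun s => chi (tscale rho) (z.1 - s)) (fun i y => moll (rho / 2) (z.2 ord0 i - y))|%:E <=
   (time_const * rho ^+ 2)%:E * majint rho f z +
   (d%:R * (time_const * rho))%:E * majint rho (fun w => enorm (g w)) z)%E.
Proof.
move=> r0 zT; have r20 : 0 < rho / 2 by rewrite divr_gt0.
have [B hc] := profiles (fun i : 'I_d => @profile_moll R d _ (z.2 ord0 i) r20).
have /= e := wint_frac p1 T0 hc hal Lu Lg Lf hw zT (tscale_gt0 r0) (tscale_gt0 r20).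
rewrite -/K in e; set c := (fun i y => moll (rho / 2) _) in e *.
set dc := (fun i y => - dmoll (rho / 2) _) in hc e.
set wd := (fun s => wker _ _ _ - _) in e.
have wwd : weight T wd.
  have a0 : 0 <= al by have /andP[a0 _] := hal; exact: ltW.
  have := weight_lin 1 (-1) (weight_wker T (tscale (rho / 2)) z.1 a0) (weight_wker T (tscale rho) z.1 a0).
  rewrite (_ : wd = (fun s => 1 * wker al (tscale (rho / 2)) (z.1 - s) + (-1) * wker al (tscale rho) (z.1 - s)))//.
  by apply/funext => s; rewrite /wd mul1r mulN1r.
have bwd s : `|wd s| <= Cw * rho ^+ 2 * ((tscale rho)^-1 * major ((z.1 - s) / tscale rho)).
  rewrite /wd tscale_half//; apply: (le_trans (wker_diff _ hal (tscale_gt0 r0) lam01)).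
  by rewrite tscale_pow// -/Cw !mulrA.
have k0 : 0 <= Cw * rho ^+ 2 by rewrite mulr_ge0 ?sqr_ge0.
have bf : (`|wint T f wd c|%:E <= (Cw * rho ^+ 2 * A0)%:E * majint rho f z)%E.
  apply: (wint_le_majint hc r0 (mulr_ge0 k0 A00) Lf wwd); first by left.
  move=> w; have := @weight_prod_le c wd rho (fun=> 1) _ z w r0 k0 (fun=> ler01) bwd.
  rewrite big1// mulr1; apply => i y; rewrite mulr1; exact: moll_half_le.
have bg j : (`|wint T (fun w => g w ord0 j) wd (upd c dc j)|%:E <=
    (Cw * rho * A0)%:E * majint rho (fun w => g w ord0 j) z)%E.
  apply: (wint_le_majint hc r0 (mulr_ge0 (mulr_ge0 Cw0 (ltW r0)) A00) (Lg j) wwd); first by right; exists j.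
  move=> w; have := @weight_prod_le (upd c dc j) wd rho (fun i => if i == j then rho^-1 else 1) _ z w r0 k0.
  rewrite prod_single.
  have -> : Cw * rho ^+ 2 * A0 / rho = Cw * rho * A0 by field; rewrite gt_eqF.
  apply => //; first by move=> i; case: eqP => // _; rewrite invr_ge0 ltW.
  move=> i y; rewrite /upd; case: eqP => _.
    by rewrite normrN dmoll_half_le.
  by rewrite mulr1 moll_half_le.
set X := mollify u _ z - _; have XE : X = K^-1 * (wint T f wd c -
    \sum_(j < d) wint T (fun z => g z ord0 j) wd (upd c dc j)).
  by rewrite -e mulKf ?gt_eqF.
have k1 : 0 <= K^-1 * (Cw * rho * A0).
  by apply: mulr_ge0; [rewrite invr_ge0 ltW|exact: (mulr_ge0 (mulr_ge0 Cw0 (ltW r0)) A00)].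
apply: (@le_trans _ _ ((K^-1 * (Cw * rho ^+ 2 * A0))%:E * majint rho f z +
   \sum_(j < d) ((K^-1 * (Cw * rho * A0))%:E * majint rho (fun w => g w ord0 j) z))%E); last first.
  rewrite leeD//; first by rewrite le_eqVlt; apply/orP; left; apply/eqP; congr (_%:E * _)%E; rewrite /time_const; ring.
  apply: (le_trans (sum_majint_le z r0 k1 Lg)).
  by rewrite le_eqVlt; apply/orP; left; apply/eqP; congr (_%:E * _)%E; rewrite /time_const; ring.
have iK : 0 <= K^-1 by rewrite invr_ge0 ltW.
rewrite XE normrM (ger0_norm iK).
apply: (@le_trans _ _ ((K^-1)%:E * (`|wint T f wd c|%:E +
   \sum_(j < d) `|wint T (fun w => g w ord0 j) wd (upd c dc j)|%:E))%E).
  rewrite sumEFin -EFinD -EFinM lee_fin ler_wpM2l// (le_trans (ler_normB _ _))// lerD2l.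
  exact: ler_norm_sum.
rewrite ge0_muleDr//; last by apply: sume_ge0 => j _; rewrite lee_fin.
rewrite leeD//.
  by rewrite EFinM -muleA lee_wpmul2l ?lee_fin.
rewrite ge0_sume_distrr; last by move=> j _; rewrite lee_fin.
by apply: lee_sum => j _; rewrite [in leRHS]EFinM -muleA lee_wpmul2l ?lee_fin.
Qed.

Definition step_const : R := (time_const + A0) * d.+1%:R.

Lemma step_const_ge0 : 0 <= step_const.
Proof. by rewrite mulr_ge0// addr_ge0// time_const_ge0. Qed.

Lemma mollify_step rho (z : Z) : 0 < rho -> z.1 < T ->
  (`|mollify u (rho / 2) z - mollify u rho z|%:E <=
   step_const%:E * (rho%:E * (majint rho (fun w => enorm (Du w)) z + majint rho (fun w => enorm (g w)) z)
     + (rho ^+ 2)%:E * majint rho f z))%E.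
Proof.
move=> r0 zT.
(* The intermediate average: time window at the old scale, spatial mollifiers already at the new
   one. *)
set P1 := wint T u (fun s => chi (tscale rho) (z.1 - s)) (fun i y => moll (rho / 2) (z.2 ord0 i - y)).
have h1 := time_step r0 zT; have h2 := space_step r0 zT; rewrite -/P1 in h1 h2.
have Jf := majint_ge0 f z r0; have Jg := majint_ge0 (fun w => enorm (g w)) z r0.
have JD := majint_ge0 (fun w => enorm (Du w)) z r0.
have t0 := time_const_ge0; have d0 : 0 <= (d%:R : R) by [].
apply: (@le_trans _ _ (`|mollify u (rho / 2) z - P1|%:E + `|P1 - mollify u rho z|%:E)%E).
  by rewrite -EFinD lee_fin (le_trans _ (ler_normD _ _))// addrA subrK.
apply: (le_trans (leeD h1 h2)).
exact: (step_arith d t0 A00 (ltW r0) Jf Jg JD).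
Qed.

End step.

End approximation.

(** * Summation of the kernels over dyadic scales *)

Section summation.
Context {R : realType} {d : nat}.
Notation mu := (@lebesgue_measure R).
Notation T1 := (measurableTypeR R).
Notation Z := (R * 'rV[R]_d)%type.
Notation tx := (@lebesgue_tx R d).
Variables (al dl : R).
Hypotheses (hal : 0 < al < 1) (hdl : 0 < dl < 1).
Notation Dm := (d%:R + 2 / al).
Hypothesis hq : 0 <= 1 - dl * Dm.

Definition kern (z w : Z) : R := riesz dl (z.1 - w.1) * rriesz dl (z.2 - w.2).

Lemma kern_ge0 z w : 0 <= kern z w.
Proof. by rewrite mulr_ge0 ?riesz_ge0 ?rriesz_ge0. Qed.

Lemma powR_prod (I : Type) (s : seq I) (x : I -> R) (r : R) : (forall i, 0 <= x i) ->
  \prod_(i <- s) (x i `^ r) = (\prod_(i <- s) x i) `^ r.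
Proof.
move=> x0; elim: s => [|i s ih]; first by rewrite !big_nil powR1.
by rewrite !big_cons ih powRM// prodr_ge0.
Qed.

Lemma powR_exprn n (x r : R) : 0 <= x -> (x `^ r) ^+ n = (x ^+ n) `^ r.
Proof. by move=> x0; rewrite -(powR_mulrn n (powR_ge0 _ _)) -(powR_mulrn n x0) -!powRrM mulrC. Qed.

Let al0 : 0 < al. Proof. by case/andP: hal. Qed.

Let Dm0 : 0 < Dm. Proof. by rewrite ltr_wpDl ?divr_gt0. Qed.

Definition vol (rho : R) : R := tscale al rho * rho ^+ d.

Lemma volE rho : 0 < rho -> vol rho = rho `^ Dm.
Proof.
move=> r0; rewrite addrC powRD_gt0// /vol /tscale powR_mulrn//; exact: ltW.
Qed.

(** On the cone where all coordinate differences are positive, the tensor kernel depends only on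
    their product: [kern] is gap^(dl - 1), and gap / vol(rho) tells how a pair of points compares
    with the scale rho. *)
Definition gap (z w : Z) : R := (z.1 - w.1) * \prod_i (z.2 ord0 i - w.2 ord0 i).

Let pos (z w : Z) := 0 < z.1 - w.1 /\ forall i, 0 < z.2 ord0 i - w.2 ord0 i.

(** The same exponent [th] is used for [major] in time and in every space coordinate, so the
    one-dimensional bounds multiply to a power of gap / vol(rho). *)
Lemma majk_le_powR th rho z w : 0 <= th <= 1 -> 0 < rho -> pos z w ->
  majk al rho z w <= vol rho `^ (- dl) * (gap z w / vol rho) `^ (th - dl) * kern z w.
Proof.
move=> hth r0 [z0 zi]; have t0 := tscale_gt0 al r0.
have g0 : 0 < gap z w by rewrite mulr_gt0// prodr_gt0.
have v0 : 0 < vol rho by rewrite mulr_gt0// exprn_gt0.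
have hm (y s : R) : 0 < y -> 0 < s -> major (y / s) <= y `^ (th - 1) * s `^ (1 - th).
  move=> y0 s0; apply: (le_trans (major_le_powR _ hth)).
  rewrite /riesz divr_gt0// powRM ?invr_ge0 ?(ltW y0) ?(ltW s0)//.
  by rewrite -powR_inv1 ?(ltW s0)// -powRrM mulN1r opprB.
have kE : kern z w = gap z w `^ (dl - 1).
  rewrite /kern /rriesz /riesz z0 /gap powRM ?(ltW z0) ?prodr_ge0//; last by move=> i _; exact: ltW.
  congr (_ * _); rewrite -powR_prod; last by move=> i; exact: ltW.
  by apply: eq_bigr => i _; rewrite !mxE zi.
apply: (@le_trans _ _ ((tscale al rho)^-1 * rho^-1 ^+ d *
   ((z.1 - w.1) `^ (th - 1) * tscale al rho `^ (1 - th) *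
    \prod_i ((z.2 ord0 i - w.2 ord0 i) `^ (th - 1) * rho `^ (1 - th))))).
  rewrite /majk ler_wpM2l ?mulr_ge0 ?exprn_ge0 ?invr_ge0 ?(ltW r0) ?(ltW t0)//.
  rewrite ler_pM ?major_ge0 ?hm//; first by apply: prodr_ge0 => i _; exact: major_ge0.
  by apply: ler_prod => i _; rewrite major_ge0 hm.
rewrite big_split/= prodr_const card_ord powR_prod; last by move=> i; exact: ltW.
have -> : (rho `^ (1 - th)) ^+ d = (rho ^+ d) `^ (1 - th).
  exact: (powR_exprn _ _ (ltW r0)).
rewrite [leLHS](_ : _ = (vol rho)^-1 * (gap z w `^ (th - 1) * vol rho `^ (1 - th))); last first.
  rewrite /gap /vol !powRM ?(ltW z0) ?(ltW t0) ?exprn_ge0 ?(ltW r0) ?prodr_ge0//; last first.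
    by move=> i _; exact: ltW.
  by rewrite invfM exprVn; ring.
have e1 : gap z w `^ (th - 1) = gap z w `^ (th - dl) * gap z w `^ (dl - 1).
  by rewrite -powRD_gt0//; congr (_ `^ _); ring.
have e2 : vol rho `^ (- dl) * vol rho `^ (dl - th) = (vol rho)^-1 * vol rho `^ (1 - th).
  by rewrite -[(vol rho)^-1]powR_inv1 ?(ltW v0)// -!powRD_gt0//; congr (_ `^ _); ring.
have e3 : (gap z w / vol rho) `^ (th - dl) = gap z w `^ (th - dl) * vol rho `^ (dl - th).
  rewrite powRM ?invr_ge0 ?(ltW g0) ?(ltW v0)//; congr (_ * _).
  by rewrite -[(vol rho)^-1]powR_inv1 ?(ltW v0)// -powRrM mulN1r opprB.
have alg (a b c1 c2 v1 v2 : R) : c1 * c2 = v1 * v2 -> v1 * (a * b * v2) <= c1 * (a * c2) * b.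
  move=> h; have -> : v1 * (a * b * v2) = a * b * (v1 * v2) by ring.
  by rewrite -h (_ : a * b * (c1 * c2) = c1 * (a * c2) * b)//; ring.
by rewrite kE e3 e1; exact: (alg _ _ _ _ _ _ e2).
Qed.

Lemma majk_eq0 rho z w : 0 < rho -> ~ pos z w -> majk al rho z w = 0.
Proof.
move=> r0 np; have t0 := tscale_gt0 al r0.
have m0 (y s : R) : 0 < s -> ~ (0 < y) -> major (y / s) = 0.
  by move=> s0 ny; rewrite /major pmulr_lgt0 ?invr_gt0// ifF//; apply/negP.
have [z0|z0] := pselect (0 < z.1 - w.1); last by rewrite /majk (m0 _ _ t0 z0) mul0r mulr0.
have [i hi] : exists i, ~ (0 < z.2 ord0 i - w.2 ord0 i).
  by apply: contrapT => h; apply: np; split => // i; apply: contrapT => hi; apply: h; exists i.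
by rewrite /majk (bigD1 i)//= (m0 _ _ r0 hi) mul0r !mulr0.
Qed.

(** Small enough that both dl - kappa and dl + kappa are admissible exponents in [0, 1]. *)
Let kappa : R := Num.min dl (1 - dl) / 2.

Let kappaP : 0 < kappa /\ 0 <= dl - kappa /\ dl + kappa <= 1.
Proof.
have /andP[d0 d1] := hdl; rewrite /kappa; case: (leP dl (1 - dl)) => h; lra.
Qed.

Definition scale_const : R := 4 * (2 `^ Dm) `^ kappa / ((2 `^ Dm) `^ kappa - 1).

Let Q1 : 1 < (2 `^ Dm) `^ kappa.
Proof.
have [k0 _] := kappaP; have D0 := Dm0.
rewrite -powRrM /powR gt_eqF// expR_gt1; apply: mulr_gt0; first exact: mulr_gt0.
by apply: ln_gt0; rewrite ltr1n.
Qed.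

Lemma scale_const_ge0 : 0 <= scale_const.
Proof.
have q1 := Q1; rewrite /scale_const divr_ge0 ?mulr_ge0 ?powR_ge0// subr_ge0; exact: ltW.
Qed.

(** Use [majk_le_powR] with th = dl - kappa and with th = dl + kappa and keep the smaller bound: the
    kernel then decays both when the scale is large and when it is small compared with the gap. *)
Lemma majk_le_geoterm rho z w : 0 < rho -> pos z w ->
  majk al rho z w <= vol rho `^ (- dl) * geoterm ((gap z w / vol rho) `^ kappa) * kern z w.
Proof.
move=> r0 hp; have [k0 [k1 k2]] := kappaP; have /andP[d0 d1] := hdl.
have h1 : 0 <= dl + kappa <= 1 by lra.
have h2 : 0 <= dl - kappa <= 1 by lra.
have := majk_le_powR h1 r0 hp; have := majk_le_powR h2 r0 hp.
have -> : dl - kappa - dl = - kappa by ring.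
have -> : dl + kappa - dl = kappa by ring.
by rewrite (powRN _ kappa) /geoterm minElt; case: ifP.
Qed.

Lemma majk_le_kern rho z w : 0 < rho -> majk al rho z w <= rho `^ (- dl * Dm) * kern z w.
Proof.
move=> r0; have [hp|np] := pselect (pos z w); last first.
  by rewrite majk_eq0// mulr_ge0 ?powR_ge0 ?kern_ge0.
have /andP[d0 d1] := hdl; have h : 0 <= dl <= 1 by rewrite !ltW.
have := majk_le_powR h r0 hp; rewrite subrr powRr0 mulr1 volE// -powRrM.
by rewrite (mulrC Dm).
Qed.

(** By [hq] the exponent a - dl Dm is nonnegative for a >= 1, so that power of the scale is at most
    its value at eps. It may be 0 for a = 1, in the case of equality; summability then rests on
    [geoterm] alone. *)
Lemma sum_majk (a : nat) eps z w n : (0 < a)%N -> 0 < eps ->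
  \sum_(k < n) (eps / 2 ^+ k) ^+ a * majk al (eps / 2 ^+ k) z w <=
  scale_const * eps `^ (a%:R - dl * Dm) * kern z w.
Proof.
move=> a0 e0; have rk k : 0 < eps / 2 ^+ k by rewrite divr_gt0// exprn_gt0.
have [hp|np] := pselect (pos z w); last first.
  rewrite big1.
    apply: mulr_ge0; last exact: kern_ge0.
    by apply: mulr_ge0; [exact: scale_const_ge0|exact: powR_ge0].
  by move=> k _; rewrite majk_eq0// mulr0.
have [k0 _] := kappaP; have D0 := Dm0.
have g0 : 0 < gap z w by case: hp => z0 zi; rewrite mulr_gt0// prodr_gt0.
have v0 : 0 < vol eps by rewrite volE// powR_gt0.
set E := eps `^ (a%:R - dl * Dm); set y0 := (gap z w / vol eps) `^ kappa.
set q := (2 `^ Dm) `^ kappa.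
have y00 : 0 < y0 by rewrite powR_gt0// divr_gt0.
(* Halving the scale divides the box volume by 2^Dm, so the argument of [geoterm] grows by the fixed
   ratio q, as [sum_geoterm] requires. *)
apply: (@le_trans _ _ (\sum_(k < n) E * geoterm (y0 * q ^+ k) * kern z w)).
  apply: ler_sum => k _.
  have -> : y0 * q ^+ k = (gap z w / vol (eps / 2 ^+ k)) `^ kappa.
    rewrite /q powR_exprn ?powR_ge0// powR_exprn// -powRM ?divr_ge0 ?powR_ge0 ?(ltW g0) ?(ltW v0)//.
    congr (_ `^ _); rewrite !volE// powRM ?(ltW e0) ?invr_ge0 ?exprn_ge0//.
    rewrite -[(2 ^+ k)^-1]powR_inv1 ?exprn_ge0// -powRrM mulN1r powRN invfM invrK.
    by rewrite mulrA.
  apply: (@le_trans _ _ ((eps / 2 ^+ k) ^+ a * (vol (eps / 2 ^+ k) `^ (- dl) *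
      geoterm ((gap z w / vol (eps / 2 ^+ k)) `^ kappa) * kern z w))).
    by rewrite ler_wpM2l ?exprn_ge0 ?(ltW (rk k))// majk_le_geoterm.
  rewrite mulrA; apply: ler_wpM2r; first exact: kern_ge0.
  rewrite mulrA; apply: ler_wpM2r.
    by rewrite /geoterm le_min powR_ge0 invr_ge0 powR_ge0.
  rewrite volE// -powR_mulrn ?(ltW (rk k))// -powRrM -powRD_gt0//.
  rewrite mulrN (mulrC Dm) ge0_ler_powR ?nnegrE ?(ltW (rk k)) ?(ltW e0)//.
    have : (1 : R) <= a%:R by rewrite ler1n.
    by have := hq; lra.
  by rewrite ler_pdivrMr ?exprn_gt0// ler_peMr ?(ltW e0)// exprn_ege1// ler1n.
rewrite -mulr_suml ler_wpM2r ?kern_ge0// -mulr_sumr mulrC ler_wpM2r ?powR_ge0//.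
exact: sum_geoterm.
Qed.

Variables (p T : R).
Hypotheses (p1 : 1 < p) (T0 : 0 < T).
Local Notation D := (cyl T [set: 'rV[R]_d]).

Definition pot (F : Z -> R) (z : Z) : \bar R := (\int[tx]_(w in D) (`|F w| * kern z w)%:E)%E.

Lemma pot_ge0 F z : (0 <= pot F z)%E.
Proof. by apply: integral_ge0 => w _; rewrite lee_fin mulr_ge0 ?kern_ge0. Qed.

Lemma measurable_kern : measurable_fun [set: (T1 * 'rV[R]_d) * (T1 * 'rV[R]_d)] (fun v => kern v.1 v.2).
Proof.
apply: measurable_funM.
  apply: (measurableT_comp (measurable_riesz _)); apply: measurable_funB.
    exact: (measurableT_comp measurable_fst measurable_fst).
  exact: (measurableT_comp measurable_fst measurable_snd).
have h : measurable_fun [set: (T1 * 'rV[R]_d) * (T1 * 'rV[R]_d)] (fun v => (v.1.2, v.2.2)).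
  apply/measurable_fun_pairP; split; first exact: (measurableT_comp measurable_snd measurable_fst).
  exact: (measurableT_comp measurable_snd measurable_snd).
exact: (measurableT_comp (@measurable_rriesz R dl d) h).
Qed.

Lemma measurable_pot_fun (F : Z -> R) z : measurable_fun (D : set (T1 * 'rV[R]_d)) F ->
  measurable_fun (D : set (T1 * 'rV[R]_d)) (fun w => (`|F w| * kern z w)%:E).
Proof.
move=> mF; apply/measurable_EFinP; apply: measurable_funM.
  exact: (measurableT_comp (@normr_measurable R setT)).
by apply: measurable_funTS; exact: (measurable_fun_pair2 z measurable_kern).
Qed.

Lemma majint_le_pot F eps z : 0 < eps -> measurable_fun (D : set (T1 * 'rV[R]_d)) F ->
  (majint al T eps F z <= (eps `^ (- dl * Dm))%:E * pot F z)%E.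
Proof.
move=> e0 mF; have mD := @measurable_cyl R d T.
rewrite /pot -(ge0_integralZl_EFin _ mD _ (measurable_pot_fun z mF) (powR_ge0 _ _)); last first.
  by move=> w _; rewrite lee_fin mulr_ge0 ?kern_ge0.
apply: ge0_le_integral => //.
- by move=> w _; rewrite lee_fin mulr_ge0 ?majk_ge0.
- exact: measurable_majint_fun.
- by apply: emeasurable_funM => //; exact: measurable_pot_fun.
- move=> w _; rewrite -EFinM lee_fin [leRHS]mulrCA; apply: ler_wpM2l => //.
  exact: majk_le_kern.
Qed.

Lemma sum_majint_le_pot (a : nat) F eps z n : (0 < a)%N -> 0 < eps ->
  measurable_fun (D : set (T1 * 'rV[R]_d)) F ->
  (\sum_(k < n) (((eps / 2 ^+ k) ^+ a)%:E * majint al T (eps / 2 ^+ k) F z) <=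
   (scale_const * eps `^ (a%:R - dl * Dm))%:E * pot F z)%E.
Proof.
move=> a0 e0 mF; have mD := @measurable_cyl R d T.
have rk k : 0 < eps / 2 ^+ k by rewrite divr_gt0// exprn_gt0.
have c0 : 0 <= scale_const * eps `^ (a%:R - dl * Dm) by rewrite mulr_ge0 ?scale_const_ge0 ?powR_ge0.
rewrite /pot -(ge0_integralZl_EFin _ mD _ (measurable_pot_fun z mF) c0); last first.
  by move=> w _; rewrite lee_fin mulr_ge0 ?kern_ge0.
have ra k : 0 <= (eps / 2 ^+ k) ^+ a by rewrite exprn_ge0 ?(ltW (rk k)).
under eq_bigr => k _.
  rewrite /majint -(ge0_integralZl_EFin _ mD _ (measurable_majint_fun al _ z mF) (ra k)); last first.
    by move=> w _; rewrite lee_fin mulr_ge0 ?majk_ge0.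
  over.
have mk (k : 'I_n) : measurable_fun (D : set (T1 * 'rV[R]_d))
    (fun w => (((eps / 2 ^+ k) ^+ a)%:E * (`|F w| * majk al (eps / 2 ^+ k) z w)%:E)%E).
  by apply: emeasurable_funM => //; exact: measurable_majint_fun.
have nk (k : 'I_n) w : D w -> (0 <= ((eps / 2 ^+ k) ^+ a)%:E * (`|F w| * majk al (eps / 2 ^+ k) z w)%:E)%E.
  by move=> _; rewrite -EFinM lee_fin mulr_ge0// mulr_ge0 ?majk_ge0.
rewrite -(ge0_integral_sum tx mD mk nk).
apply: ge0_le_integral => //.
- by move=> w Dw; apply: sume_ge0 => k _; exact: nk.
- by apply: emeasurable_sum.
- by apply: emeasurable_funM => //; exact: measurable_pot_fun.
- move=> w _; under eq_bigr do rewrite -EFinM; rewrite sumEFin -EFinM lee_fin [leRHS]mulrCA.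
  under eq_bigr do rewrite mulrCA; rewrite -mulr_sumr; apply: ler_wpM2l => //.
  exact: sum_majk.
Qed.

End summation.

(** * Pointwise domination by Riesz potentials *)

Section convergence.
Context {R : realType} {d : nat}.
Notation mu := (@lebesgue_measure R).
Notation T1 := (measurableTypeR R).
Notation Z := (R * 'rV[R]_d)%type.
Notation tx := (@lebesgue_tx R d).
Variables (al dl p T : R).
Hypotheses (hal : 0 < al < 1) (hdl : 0 < dl < 1) (p1 : 1 < p) (T0 : 0 < T).
Notation Dm := (d%:R + 2 / al).
Hypothesis hq : 0 <= 1 - dl * Dm.
Local Notation D := (cyl T [set: 'rV[R]_d]).

Lemma is_cvgn_bounded_variation (a : R^nat) (C : R) :
  (forall n, \sum_(k < n) `|a k.+1 - a k| <= C) -> cvgn a.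
Proof.
move=> h.
have hs : cvgn [normed series (telescope a)].
  apply: nondecreasing_is_cvgn.
    apply/nondecreasing_seqP => n; rewrite /= /series/= big_nat_recr//= lerDl//.
  by exists C => _ [n _ <-]; rewrite /= /series/= big_mkord; exact: h.
have /= hc := normed_cvg hs.
rewrite (_ : a = (fun n => a 0%N + series (telescope a) n)).
  by apply: is_cvgD => //; exact: is_cvg_cst.
by apply/funext => n; rewrite -eq_sum_telescope.
Qed.

Variables (u f : Z -> R) (Du g : Z -> 'rV[R]_d).
Hypotheses (Lu : in_Lp p D u) (Lf : in_Lp p D f) (LDu : in_vLp p D Du) (Lg : in_vLp p D g).
Hypothesis wDu : weak_gradient T setT u Du.
Hypothesis hw : weak_frac al T u f g.

Lemma measurable_enorm (G : Z -> 'rV[R]_d) : in_vLp p D G ->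
  measurable_fun (D : set (T1 * 'rV[R]_d)) (fun z => enorm (G z)).
Proof.
move=> LG; apply: (measurableT_comp (continuous_measurable_fun (@sqrt_continuous R))).
apply: measurable_sum => i; apply: measurable_funX; exact: in_Lp_measurableD (LG i).
Qed.

Variable eps : R.
Hypothesis e0 : 0 < eps.

(** Bounds the total variation of the averages along the scales eps / 2^k; [majpot] adds a bound for
    the first average and thus dominates all of them. *)
Definition varpot (z : Z) : \bar R :=
  ((step_const (d := d) al)%:E * ((scale_const (d := d) al dl * eps `^ (1 - dl * Dm))%:E *
     (pot dl T (fun w => enorm (Du w)) z + pot dl T (fun w => enorm (g w)) z) +
   (scale_const (d := d) al dl * eps `^ (2 - dl * Dm))%:E * pot dl T f z))%E.

Definition majpot (z : Z) : \bar R :=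
  ((cmoll ^+ d * eps `^ (- dl * Dm))%:E * pot dl T u z + varpot z)%E.

Let mf k (z : Z) := mollify al T u (eps / 2 ^+ k) z.

Lemma varpot_ge0 z : (0 <= varpot z)%E.
Proof.
have s0 := @step_const_ge0 R d al hal; have c0 := @scale_const_ge0 R d al dl hal hdl.
apply: mule_ge0; first by rewrite lee_fin.
have k0 (e : R) : (0 <= (scale_const (d := d) al dl * eps `^ e)%:E)%E.
  by rewrite lee_fin; apply: mulr_ge0 => //; exact: powR_ge0.
apply: adde_ge0; apply: mule_ge0 => //; last exact: pot_ge0.
by apply: adde_ge0; exact: pot_ge0.
Qed.

Lemma majpot_ge0 z : (0 <= majpot z)%E.
Proof.
apply: adde_ge0; last exact: varpot_ge0.
apply: mule_ge0; last exact: pot_ge0.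
by rewrite lee_fin mulr_ge0 ?powR_ge0// exprn_ge0// (le_trans ler01)// cmoll1.
Qed.

(** [mollify_step] at each scale, then [sum_majint_le_pot] with a = 1 for Du and g and with a = 2
    for f. *)
Lemma mollify_variation (z : Z) n : z.1 < T ->
  (\sum_(k < n) `|mf k.+1 z - mf k z|%:E <= varpot z)%E.
Proof.
move=> zT; have rk k : 0 < eps / 2 ^+ k by rewrite divr_gt0// exprn_gt0.
have s0 := @step_const_ge0 R d al hal.
have mDu := measurable_enorm LDu; have mg := measurable_enorm Lg; have mF := in_Lp_measurableD Lf.
pose a k := ((eps / 2 ^+ k)%:E * majint al T (eps / 2 ^+ k) (fun w => enorm (Du w)) z)%E.
pose b k := ((eps / 2 ^+ k)%:E * majint al T (eps / 2 ^+ k) (fun w => enorm (g w)) z)%E.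
pose c k := (((eps / 2 ^+ k) ^+ 2)%:E * majint al T (eps / 2 ^+ k) f z)%E.
have J0 F k : (0 <= majint al T (eps / 2 ^+ k) F z)%E by exact: majint_ge0.
have a0 k : (0 <= a k)%E by rewrite mule_ge0 ?lee_fin ?J0// ltW.
have b0 k : (0 <= b k)%E by rewrite mule_ge0 ?lee_fin ?J0// ltW.
have c0 k : (0 <= c k)%E by rewrite mule_ge0 ?lee_fin ?J0// sqr_ge0.
apply: (@le_trans _ _ (\sum_(k < n) ((step_const (d := d) al)%:E * (a k + b k + c k)))%E).
  apply: lee_sum => k _.
  have := mollify_step hal p1 T0 Lu Lf LDu Lg wDu hw (rk k) zT.
  rewrite [X in (_ -> `|X - _|%:E <= _)%E](_ : _ = mollify al T u (eps / 2 ^+ k / 2) z); last first.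
    by rewrite /mf exprSr invfM mulrA.
  have -> : ((eps / 2 ^+ k)%:E * (majint al T (eps / 2 ^+ k) (fun w => enorm (Du w)) z +
     majint al T (eps / 2 ^+ k) (fun w => enorm (g w)) z) = a k + b k)%E.
    by rewrite ge0_muleDr ?J0.
  by [].
rewrite -ge0_sume_distrr; last by move=> k _; rewrite !adde_ge0.
rewrite lee_wpmul2l ?lee_fin//.
have -> : (\sum_(k < n) (a k + b k + c k) = \sum_(k < n) a k + \sum_(k < n) b k + \sum_(k < n) c k)%E.
  by rewrite !big_split.
rewrite leeD//; last exact: (sum_majint_le_pot hal hdl hq z n (isT : (0 < 2)%N) e0 mF).
rewrite ge0_muleDr ?pot_ge0//; apply: leeD.
  exact: (sum_majint_le_pot hal hdl hq z n (isT : (0 < 1)%N) e0 mDu).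
exact: (sum_majint_le_pot hal hdl hq z n (isT : (0 < 1)%N) e0 mg).
Qed.

Lemma mollify_le_majpot (z : Z) n : z.1 < T -> (`|mf n z|%:E <= majpot z)%E.
Proof.
move=> zT.
have h0 : (`|mf 0 z|%:E <= (cmoll ^+ d * eps `^ (- dl * Dm))%:E * pot dl T u z)%E.
  have e1 : 0 < eps / 2 ^+ 0 by rewrite expr0 divr1.
  apply: (le_trans (@mollify_le R d al p T p1 T0 u _ z e1 Lu)).
  rewrite expr0 divr1 EFinM -muleA lee_wpmul2l//.
    by rewrite lee_fin exprn_ge0// (le_trans ler01)// cmoll1.
  by apply: majint_le_pot => //; exact: in_Lp_measurableD Lu.
apply: le_trans (leeD h0 (mollify_variation n zT)).
rewrite sumEFin -EFinD lee_fin.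
have -> : mf n z = mf 0 z + \sum_(k < n) (mf k.+1 z - mf k z).
  by rewrite -(big_mkord xpredT (fun k => mf k.+1 z - mf k z)) telescope_sumr// addrC subrK.
by rewrite (le_trans (ler_normD _ _))// lerD2l ler_norm_sum.
Qed.

Lemma mollify_is_cvg (z : Z) : z.1 < T -> (majpot z < +oo)%E -> cvgn (fun n => mf n z).
Proof.
move=> zT hW.
have v0 := varpot_ge0 z.
have vfin : (varpot z < +oo)%E.
  apply: le_lt_trans hW; rewrite /majpot leeDr//.
  apply: mule_ge0; last exact: pot_ge0.
  by rewrite lee_fin mulr_ge0 ?powR_ge0// exprn_ge0// (le_trans ler01)// cmoll1.
apply: (@is_cvgn_bounded_variation _ (fine (varpot z))) => n.
by rewrite -lee_fin fineK ?ge0_fin_numE// -sumEFin; exact: mollify_variation.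
Qed.

End convergence.

Section potential_bound.
Context {R : realType} (d : nat).
Notation mu := (@lebesgue_measure R).
Notation T1 := (measurableTypeR R).
Notation Z := (R * 'rV[R]_d)%type.
Notation tx := (@lebesgue_tx R d).
Variables (p p0 : R).
Hypotheses (p1 : 1 < p) (pp0 : p < p0).
Notation dl := (p^-1 - p0^-1).

Lemma measurable_pot (T : R) (F : Z -> R) :
  measurable_fun (cyl T [set: 'rV[R]_d] : set (T1 * 'rV[R]_d)) F ->
  measurable_fun [set: T1 * 'rV[R]_d] (pot dl T F).
Proof.
move=> mF; have mD := @measurable_cyl R d T.
have mFD : measurable_fun [set: T1 * 'rV[R]_d] (F \_ (cyl T [set: 'rV[R]_d])).
  exact/(measurable_restrictT _ mD).
have mK : measurable_fun [set: (T1 * 'rV[R]_d) * (T1 * 'rV[R]_d)]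
    (fun v => (`|(F \_ (cyl T [set: 'rV[R]_d])) v.2| * kern dl v.1 v.2)%:E).
  apply/measurable_EFinP; apply: measurable_funM; last exact: measurable_kern.
  apply: (measurableT_comp (@normr_measurable R setT)).
  exact: (measurableT_comp mFD measurable_snd).
have := @measurable_integral_param R _ _ _ _ (sfprod mu (lebesgue_rV d)) _ mK.
rewrite (_ : (fun x => _) = pot dl T F)//.
apply/funext => z; rewrite /pot [RHS]integral_mkcond; apply: eq_integral => w _.
rewrite /= !patchE; case: ifPn => // _.
by rewrite [X in `|X|](_ : _ = 0) ?normr0 ?mul0r.
Qed.

(** The bilinear inequality is applied to the dual pair of exponents: G takes the first place with
    P, the conjugate of p0, and F the second, whose exponent is the conjugate of Q, that is, p. The
    order is unchanged because 1/P - 1/Q = 1/p - 1/p0. *)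
Lemma hls_pot : exists2 C : R, 0 < C & forall (T : R) (F : Z -> R) (G : T1 * 'rV[R]_d -> \bar R),
  0 < T ->
  measurable_fun (cyl T [set: 'rV[R]_d] : set (T1 * 'rV[R]_d)) F ->
  measurable_fun [set: T1 * 'rV[R]_d] G -> (forall z, 0 <= G z)%E ->
  (\int[tx]_z (G z * pot dl T F z) <=
   C%:E * ((\int[tx]_z (G z `^ (1 - p0^-1)^-1)) `^ (1 - p0^-1) * Lpnorm p (cyl T [set: 'rV[R]_d]) F))%E.
Proof.
have pp : 0 < p by exact: lt_trans p1.
have p00 : 0 < p0 by exact: lt_trans pp0.
have p01 : 1 < p0 by exact: lt_trans pp0.
have ip : p^-1 < 1 by rewrite invf_lt1.
have ip0 : p0^-1 < p^-1 by rewrite ltf_pV2.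
have ip00 : 0 < p0^-1 by rewrite invr_gt0.
pose P := (1 - p0^-1)^-1; pose Q := (1 - p^-1)^-1.
have P1 : 1 < P by rewrite /P invf_gt1 ?subr_gt0; lra.
have PQ : P < Q by rewrite ltf_pV2 ?posrE ?subr_gt0//; lra.
have dlE : dl = P^-1 - Q^-1 by rewrite /P /Q !invrK; ring.
have QE : (1 - Q^-1)^-1 = p by rewrite /Q invrK opprB addrC subrK invrK.
have [C1 C10 H1] := hls_riesz P1 PQ dlE.
have [C2 C20 H2] := hls_rV P1 PQ dlE d.
exists (C1 * C2); first exact: mulr_gt0.
move=> T F G T0 mF mG G0.
have mD := @measurable_cyl R d T.
have mFD : measurable_fun [set: T1 * 'rV[R]_d] (F \_ (cyl T [set: 'rV[R]_d])).
  exact/(measurable_restrictT _ mD).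
have mk1 : measurable_fun [set: T1 * T1] (fun z : T1 * T1 => riesz dl (z.1 - z.2)).
  by apply: (measurableT_comp (measurable_riesz _)); apply: measurable_funB.
have H := hls_prod P1 PQ C10 C20 mk1 (fun x y => riesz_ge0 _ _) (@measurable_rriesz R dl d)
  (fun x y => rriesz_ge0 _ _) H1 H2.
have mFn : measurable_fun [set: T1 * 'rV[R]_d] (fun w => `|(F \_ (cyl T [set: 'rV[R]_d])) w|%:E).
  by apply/measurable_EFinP; exact: (measurableT_comp (@normr_measurable R setT) mFD).
have {H1 H2} := H G _ mG G0 mFn (fun w => normr_ge0 _).
rewrite QE /P invrK => h.
have e1 : (\int[tx]_z (G z * pot dl T F z) = \int[mu \x lebesgue_rV d]_z \int[mu \x lebesgue_rV d]_w
    (G z * ((riesz dl (z.1 - w.1) * rriesz dl (z.2 - w.2))%:E * `|(F \_ (cyl T [set: 'rV[R]_d])) w|%:E)))%E.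
  apply: eq_integral => z _; rewrite ge0_integralZl//; last 2 first.
  - apply: emeasurable_funM => //; apply/measurable_EFinP.
    exact: (measurable_fun_pair2 z (@measurable_kern R d dl)).
  - by move=> w _; rewrite -EFinM lee_fin mulr_ge0//; exact: (kern_ge0 dl z w).
  congr (_ * _)%E; rewrite /pot [LHS]integral_mkcond; apply: eq_integral => w _.
  rewrite -EFinM mulrC !patchE; case: ifPn => // _.
  by rewrite [X in `|X|](_ : _ = 0) ?normr0 ?mul0r.
have e2 : Lpnorm p (cyl T [set: 'rV[R]_d]) F =
    ((\int[mu \x lebesgue_rV d]_y (`|(F \_ (cyl T [set: 'rV[R]_d])) y|%:E `^ p)) `^ p^-1)%E.
  rewrite -(poweR_Lnorm tx (EFin \o _) (lt0r_neq0 pp)) /Lpnorm.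
  by rewrite -poweRrM divff ?poweRe1// ?Lnorm_ge0// gt_eqF.
by rewrite e1 e2.
Qed.

End potential_bound.

(** * Integrals of the averages over boxes *)

Section windows.
Context {R : realType}.
Notation mu := (@lebesgue_measure R).
Notation T1 := (measurableTypeR R).
Implicit Types (k : R -> R) (rho a b y : R).

Definition unit_kernel rho k := [/\ measurable_fun [set: T1] k, forall r, 0 <= k r,
  forall r, ~ (0 < r <= rho) -> k r = 0 & (\int[mu]_r (k r)%:E = 1)%E].

(** Half-open on the right to match kernels supported in ]0, rho]: a point y only influences
    averages to its right, so the windows converge to this indicator at every point, endpoints
    included. *)
Definition indco a b x : R := (a <= x < b)%R%:R.

Lemma indco_ge0 a b x : 0 <= indco a b x. Proof. by []. Qed.

Lemma measurable_indco a b : measurable_fun [set: T1] (indco a b).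
Proof.
rewrite (_ : indco a b = \1_(`[a, b[%classic : set T1)); first exact: measurable_indic.
apply/funext => x; rewrite indicE /indco; congr (nat_of_bool _)%:R.
by apply/idP/idP; rewrite inE/= in_itv.
Qed.

(** The adjoint of averaging applied to an indicator: integrating the average of a function over [a,
    b[ is integrating the function against this weight. *)
Definition window k a b y : \bar R := (\int[mu]_x (indco a b x * k (x - y))%:E)%E.

Section fixed_kernel.
Variables (rho : R) (k : R -> R).
Hypothesis hk : unit_kernel rho k.

Let mk : measurable_fun [set: T1] k. Proof. by have [] := hk. Qed.

Let mks y : measurable_fun [set: T1] (fun x : T1 => k (x - y)).
Proof. by apply: (measurableT_comp mk); exact: measurable_funB. Qed.

Let k_ge0 r : 0 <= k r. Proof. by have [_ h _ _] := hk. Qed.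

Lemma integral_shift y : (\int[mu]_x (k (x - y))%:E = 1)%E.
Proof.
have [_ _ _ h] := hk.
have m1 : measurable_fun [set: T1] (fun x : T1 => (k x)%:E) by apply/measurable_EFinP.
have := @ge0_integral_affine R 1 (- y) (fun x => (k x)%:E) (oner_neq0 _) m1 (fun x => k_ge0 x).
rewrite h normr1 invr1 mule1; under [X in X = _ -> _]eq_integral do rewrite mul1r.
by [].
Qed.

Lemma window_ge0 a b y : (0 <= window k a b y)%E.
Proof. by apply: integral_ge0 => x _; rewrite lee_fin mulr_ge0 ?indco_ge0. Qed.

Lemma window_le1 a b y : (window k a b y <= 1)%E.
Proof.
rewrite -(integral_shift y); apply: ge0_le_integral => //.
- by move=> x _; rewrite lee_fin mulr_ge0 ?indco_ge0.
- by apply/measurable_EFinP; apply: measurable_funM => //; exact: measurable_indco.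
- by apply/measurable_EFinP.
- move=> x _; rewrite lee_fin ler_piMl// /indco.
  by case: (_ <= _ < _).
Qed.

Lemma window_fin a b y : window k a b y \is a fin_num.
Proof. by rewrite ge0_fin_numE ?window_ge0// (le_lt_trans (window_le1 _ _ _))// ltry. Qed.

Lemma window_out a b y : (b <= y) || (y + rho < a) -> window k a b y = 0%E.
Proof.
have [_ _ hs _] := hk; move=> h; rewrite /window (eq_integral (cst 0%E)) ?integral0// => x _.
rewrite /indco; have [/andP[h1 h2]|_] := boolP (a <= x < b); last by rewrite mul0r.
rewrite hs ?mulr0// => /andP[h3 h4]; case/orP: h => h; lra.
Qed.

Lemma window_in a b y : a <= y -> y + rho < b -> window k a b y = 1%E.
Proof.
have [_ _ hs _] := hk; move=> h1 h2; rewrite -(integral_shift y); apply: eq_integral => x _.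
have [hx|hx] := pselect (0 < x - y <= rho); last by rewrite hs ?mulr0.
rewrite /indco (_ : a <= x < b) ?mul1r//; move/andP: hx => [? ?]; lra.
Qed.

Lemma measurable_window a b : measurable_fun [set: T1] (window k a b).
Proof.
have mK : measurable_fun [set: T1 * T1] (fun z : T1 * T1 => (indco a b z.2 * k (z.2 - z.1))%:E).
  apply/measurable_EFinP; apply: measurable_funM.
    exact: (measurableT_comp (measurable_indco a b) measurable_snd).
  by apply: (measurableT_comp mk); exact: measurable_funB.
exact: (@measurable_integral_param R _ _ _ _ mu _ mK).
Qed.

End fixed_kernel.

Lemma window_cvg (k_ : nat -> R -> R) (rho_ : R^nat) a b y :
  (forall n, unit_kernel (rho_ n) (k_ n)) -> rho_ n @[n --> \oo] --> 0 ->
  fine (window (k_ n) a b y) @[n --> \oo] --> indco a b y.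
Proof.
move=> hk rc; rewrite /indco; have [yb|yb] := leP b y.
  rewrite andbF; apply: (@cvg_trans _ ((cst (0 : R) : nat -> R) @ \oo)); last exact: cvg_cst.
  by apply: near_eq_cvg; near=> n; rewrite (window_out (hk n))//= yb.
have [ya|ya] := leP a y.
  apply: (@cvg_trans _ ((cst (1 : R) : nat -> R) @ \oo)); last exact: cvg_cst.
  apply: near_eq_cvg; near=> n; rewrite (window_in (hk n))//=.
  rewrite -ltrBrDl; near: n; apply: (cvgr_lt _ rc); lra.
apply: (@cvg_trans _ ((cst (0 : R) : nat -> R) @ \oo)); last exact: cvg_cst.
apply: near_eq_cvg; near=> n; rewrite (window_out (hk n))//=; apply/orP; right.
rewrite -ltrBrDl; near: n; apply: (cvgr_lt _ rc); lra.
Unshelve. all: by end_near. Qed.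

Lemma unit_kernel_chi tau : 0 < tau -> unit_kernel tau (chi tau).
Proof.
move=> t0; have cE : chi tau = (fun r => tau^-1 * \1_(`]0, tau]%classic : set T1) r).
  apply/funext => r; rewrite /chi indicE; congr (_ * _).
  have -> : (r \in `]0, tau]%classic) = (0 < r <= tau) by apply/idP/idP; rewrite inE/= in_itv.
  have [r0|r0] := ltP 0 r; last by rewrite ltNge (le_trans r0 (ltW t0))/= subrr.
  by rewrite ltNge; case: (r <= tau); rewrite ?subr0 ?subrr.
have i0 : 0 <= tau^-1 by rewrite invr_ge0 ltW.
split.
- by rewrite cE; apply: measurable_funM => //; exact: measurable_indic.
- by move=> r; rewrite cE mulr_ge0.
- move=> r hr; rewrite cE indicE memNset ?mulr0// /= in_itv/=; exact: hr.
- rewrite cE; under eq_integral do rewrite EFinM.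
  rewrite ge0_integralZl_EFin//; last first.
    by apply/measurable_EFinP; exact: measurable_indic.
  have -> : (\int[mu]_r (\1_(`]0, tau]%classic : set T1) r)%:E = tau%:E)%E.
    transitivity (mu `]0, tau]%classic); first by rewrite integral_indic// setIT.
    by rewrite lebesgue_measure_itv/= lte_fin t0 -EFinD subr0.
  by rewrite -EFinM mulVf// gt_eqF.
Qed.

Lemma unit_kernel_moll rho : 0 < rho -> unit_kernel rho (moll rho).
Proof.
move=> r0; have i0 : 0 <= rho^-1 by rewrite invr_ge0 ltW.
have mb : measurable_fun [set: T1] (fun r : T1 => (cutoff r)%:E).
  by apply/measurable_EFinP; exact: measurable_cutoff.
split.
- apply: measurable_funM => //; apply: (measurableT_comp measurable_cutoff).
  exact: measurable_funM.
- by move=> r; exact: moll_ge0.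
- move=> r hr; rewrite /moll cutoff_out ?mulr0// -[_ || _]negbK negb_or -!ltNge.
  apply/negP => /andP[h1 h2]; apply: hr.
  by move: h1 h2; rewrite ltr_pdivrMr// mul1r pmulr_lgt0 ?invr_gt0// => -> /ltW.
- have := @ge0_integral_affine R rho^-1 0 (fun x => (cutoff x)%:E) _ mb (fun x => cutoff_ge0 x).
  rewrite gt_eqF ?invr_gt0// => /(_ isT).
  under [X in X = _ -> _]eq_integral do rewrite addr0.
  rewrite normfV invrK (gtr0_norm r0) => h.
  under eq_integral => r _ do rewrite /moll EFinM (mulrC r).
  rewrite ge0_integralZl_EFin//; last 2 first.
  + by move=> r _; rewrite lee_fin cutoff_ge0.
  + apply: (measurableT_comp mb); exact: measurable_funM.
  rewrite h muleA -EFinM mulVf ?gt_eqF// mul1e /cutoff.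
  have b0 : 0 <= (bint (1 : R))^-1 by rewrite invr_ge0 ltW// bint1_gt0.
  have mb0 : measurable_fun [set: T1] (fun r : T1 => (cutoff0 r)%:E).
    by apply/measurable_EFinP; exact: measurable_cutoff0.
  under eq_integral do rewrite EFinM.
  rewrite (ge0_integralZl_EFin mu measurableT _ mb0 b0); last by move=> r _; rewrite lee_fin cutoff0_ge0.
  have -> : (\int[mu]_r (cutoff0 r)%:E = (bint (1 : R))%:E)%E.
    have ib := @integrable_cutoff0 R _ (measurable_itv (Interval -oo%O (BRight (1 : R)))).
    rewrite /bint /Rintegral fineK; last exact: integrable_fin_num.
    rewrite [RHS]integral_mkcond; apply: eq_integral => r _; rewrite patchE.
    case: ifPn => //; rewrite notin_setE/= in_itv/= => /negP; rewrite -ltNge => r1.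
    by rewrite cutoff0_out// (ltW r1) orbT.
  by rewrite -EFinM mulVf// gt_eqF// bint1_gt0.
Qed.

Lemma ge0_integral_rV_prod n (h : 'I_n -> R -> R) (c : 'I_n -> R) :
  (forall i, measurable_fun [set: T1] (h i)) -> (forall i r, 0 <= h i r) ->
  (forall i, (\int[mu]_r (h i r)%:E = (c i)%:E)%E) ->
  (\int[lebesgue_rV n]_x (\prod_i h i (x ord0 i))%:E = (\prod_i c i)%:E)%E.
Proof.
move=> mh h0 hc.
have c0 i : 0 <= c i by rewrite -lee_fin -hc; apply: integral_ge0 => r _; rewrite lee_fin.
elim: n h c mh h0 hc c0 => [|n ih] h c mh h0 hc c0.
  rewrite integral_rV0; last by apply/measurable_EFinP; under eq_fun do rewrite big_ord0; exact: measurable_cst.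
  by rewrite !big_ord0.
have mp m (e : 'I_m -> R -> R) : (forall i, measurable_fun [set: T1] (e i)) ->
    measurable_fun [set: 'rV[R]_m] (fun x => (\prod_i e i (x ord0 i))%:E).
  move=> me; apply/measurable_EFinP; apply: measurable_prod => i _.
  by apply: (measurableT_comp (me i)); exact: measurable_rV_entry.
rewrite ge0_integral_rV_succ; last 2 first.
- exact: mp.
- by move=> x; rewrite lee_fin prodr_ge0.
pose h' (i : 'I_n) := h (lift ord0 i).
have e (z : T1 * 'rV[R]_n) : (\prod_i h i (cons_rV z ord0 i))%:E =
    ((h ord0 z.1)%:E * (\prod_i h' i (z.2 ord0 i))%:E)%E.
  rewrite -EFinM big_ord_recl /cons_rV mxE unlift_none; congr (_ * _)%:E.
  by apply: eq_bigr => i _; rewrite mxE liftK.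
under eq_integral do rewrite e.
rewrite (fubini_tonelli1 (fun z : T1 * 'rV[R]_n => ((h ord0 z.1)%:E * (\prod_i h' i (z.2 ord0 i))%:E)%E)); first last.
- by move=> z; rewrite -EFinM lee_fin; apply: mulr_ge0 => //; apply: prodr_ge0 => i _; exact: h0.
- apply: emeasurable_funM.
    by apply/measurable_EFinP; exact: (measurableT_comp (mh ord0) measurable_fst).
  exact: (measurableT_comp (mp _ h' (fun i => mh _)) measurable_snd).
have ih' := ih h' (fun i => c (lift ord0 i)) (fun i => mh _) (fun i => h0 _) (fun i => hc _) (fun i => c0 _).
rewrite big_ord_recl EFinM -hc -ih' -ge0_integralZr//; last first.
  by apply: integral_ge0 => x _; rewrite lee_fin; apply: prodr_ge0 => i _; exact: h0.
- by move=> x _; rewrite lee_fin.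
- by apply/measurable_EFinP; exact: mh.
apply: eq_integral => x _; rewrite /fubini_F/=.
rewrite (ge0_integralZl_EFin _ measurableT _ (mp _ h' (fun i => mh _)) (h0 _ _))//.
by move=> y _; rewrite lee_fin; apply: prodr_ge0 => i _; exact: h0.
Qed.

End windows.

Section boxes.
Context {R : realType} {d : nat}.
Notation mu := (@lebesgue_measure R).
Notation T1 := (measurableTypeR R).
Notation Z := (R * 'rV[R]_d)%type.
Notation tx := (@lebesgue_tx R d).
Variables (al p T : R).
Hypotheses (hal : 0 < al < 1) (p1 : 1 < p) (T0 : 0 < T).
Local Notation D := (cyl T [set: 'rV[R]_d]).

Definition box (a b : R) (xa xb : 'I_d -> R) : set (T1 * 'rV[R]_d) :=
  [set z : T1 * 'rV[R]_d | a <= z.1 < b /\ forall i, xa i <= z.2 ord0 i < xb i].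

Variables (a b : R) (xa xb : 'I_d -> R).

Definition boxco (z : Z) : R := indco a b z.1 * \prod_i indco (xa i) (xb i) (z.2 ord0 i).

Lemma boxcoE z : boxco z = \1_(box a b xa xb) z.
Proof.
rewrite /boxco indicE; have [hz|hz] := pselect (box a b xa xb z).
  rewrite mem_set//; case: hz => h1 h2; rewrite /indco h1 mul1r big1// => i _.
  by rewrite h2.
rewrite memNset//; have [h1|h1] := boolP (a <= z.1 < b); last by rewrite /indco (negbTE h1) mul0r.
have [i hi] : exists i, ~ (xa i <= z.2 ord0 i < xb i).
  apply: contrapT => h; apply: hz; split => // i; apply: contrapT => hi.
  by apply: h; exists i.
by rewrite (bigD1 i)//= {2}/indco (negbTE (introN idP hi)) mul0r mulr0.
Qed.

Lemma measurable_boxco : measurable_fun [set: T1 * 'rV[R]_d] boxco.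
Proof.
apply: measurable_funM; first exact: (measurableT_comp (measurable_indco _ _) measurable_fst).
apply: measurable_prod => i _; apply: (measurableT_comp (measurable_indco _ _)).
exact: (measurableT_comp (measurable_rV_entry i) measurable_snd).
Qed.

Lemma measurable_box : measurable (box a b xa xb).
Proof.
have -> : box a b xa xb = boxco @^-1` [set 1].
  apply/seteqP; split => z /=; rewrite boxcoE indicE.
    by move=> h; rewrite mem_set.
  have [h|h] := pselect (box a b xa xb z); first by [].
  by rewrite memNset// => /eqP; rewrite eq_sym oner_eq0.
by rewrite -[X in measurable X]setTI; exact: measurable_boxco.
Qed.

Definition boxwin (rho : R) (w : Z) : R :=
  fine (window (chi (tscale al rho)) a b w.1) *
  \prod_i fine (window (moll rho) (xa i) (xb i) (w.2 ord0 i)).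

Section fixed_scale.
Variable rho : R.
Hypothesis r0 : 0 < rho.

Let uc := unit_kernel_chi (tscale_gt0 al r0).
Let um := unit_kernel_moll r0.

Lemma boxwin_ge0 w : 0 <= boxwin rho w.
Proof.
rewrite mulr_ge0 ?fine_ge0 ?(window_ge0 uc)//.
by apply: prodr_ge0 => i _; rewrite fine_ge0// (window_ge0 um).
Qed.

Let win1 k r x y s : unit_kernel r k -> fine (window k x y s) <= 1 :> R.
Proof. by move=> hk; rewrite -lee_fin fineK ?(window_fin hk)// (window_le1 hk). Qed.

Lemma boxwin_le1 w : boxwin rho w <= 1.
Proof.
rewrite -[leRHS]mulr1 ler_pM ?fine_ge0 ?(window_ge0 uc) ?(win1 _ _ _ uc)//.
  by apply: prodr_ge0 => i _; rewrite fine_ge0// (window_ge0 um).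
apply: prodr_ile1 => i _; by rewrite fine_ge0 ?(window_ge0 um)//= (win1 _ _ _ um).
Qed.

Lemma boxwin_supp (B : R) (w : Z) : (forall i, `|xa i| + `|xb i| + rho <= B) ->
  (exists i, B < `|w.2 ord0 i|) -> boxwin rho w = 0.
Proof.
move=> hB [i hi]; rewrite /boxwin (bigD1 i)//= (window_out um) ?mul0r ?mulr0//.
have := hB i; have := ler_norm (- xa i); have := ler_norm (xb i); rewrite normrN.
have := normr_ge0 (xb i); have := normr_ge0 (xa i).
move=> n1 n2 h1 h2 h3; have r0' := r0; case: (ler0P (w.2 ord0 i)) hi => h hi; apply/orP; [right|left]; lra.
Qed.

Lemma measurable_boxwin : measurable_fun [set: T1 * 'rV[R]_d] (boxwin rho).
Proof.
have mw k r x y : unit_kernel r k -> measurable_fun [set: T1] (fun s => fine (window k x y s)).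
  move=> hk; have mf := @fine_measurable R setT measurableT.
  exact: (measurableT_comp mf (measurable_window hk x y)).
apply: measurable_funM; first exact: (measurableT_comp (mw _ _ a b uc) measurable_fst).
apply: measurable_prod => i _; apply: (measurableT_comp (mw _ _ _ _ um)).
exact: (measurableT_comp (measurable_rV_entry i) measurable_snd).
Qed.

Definition boxker (z w : Z) : R := boxco z *
  (chi (tscale al rho) (z.1 - w.1) * prodf (fun i y => moll rho (z.2 ord0 i - y)) w.2).

Lemma boxker_ge0 z w : 0 <= boxker z w.
Proof.
have [_ c0 _ _] := uc; have [_ m0 _ _] := um.
rewrite /boxker boxcoE; apply: mulr_ge0 => //; apply: mulr_ge0 => //.
by apply: prodr_ge0.
Qed.

Lemma measurable_boxker : measurable_fun [set: (T1 * 'rV[R]_d) * (T1 * 'rV[R]_d)] (fun v => boxker v.1 v.2).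
Proof.
have [mc _ _ _] := uc; have [mm _ _ _] := um.
apply: measurable_funM; first exact: (measurableT_comp measurable_boxco measurable_fst).
apply: measurable_funM.
  apply: (measurableT_comp mc); apply: measurable_funB.
    exact: (measurableT_comp measurable_fst measurable_fst).
  exact: (measurableT_comp measurable_fst measurable_snd).
apply: measurable_prod => i _; apply: (measurableT_comp mm); apply: measurable_funB.
  exact: (measurableT_comp (measurable_rV_entry i) (measurableT_comp measurable_snd measurable_fst)).
exact: (measurableT_comp (measurable_rV_entry i) (measurableT_comp measurable_snd measurable_snd)).
Qed.

Lemma integral_boxker w : (\int[tx]_z (boxker z w)%:E = (boxwin rho w)%:E)%E.
Proof.
have [mc c0 _ _] := uc; have [mm m0 _ _] := um.
pose A (t : T1) := indco a b t * chi (tscale al rho) (t - w.1).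
pose h i (x : R) := indco (xa i) (xb i) x * moll rho (x - w.2 ord0 i).
have mA : measurable_fun [set: T1] A.
  apply: measurable_funM; first exact: measurable_indco.
  by apply: (measurableT_comp mc); exact: measurable_funB.
have mh i : measurable_fun [set: T1] (h i).
  apply: measurable_funM; first exact: measurable_indco.
  by apply: (measurableT_comp mm); exact: measurable_funB.
have A0 t : 0 <= A t by rewrite mulr_ge0.
have h0 i x : 0 <= h i x by rewrite mulr_ge0.
have mp : measurable_fun [set: 'rV[R]_d] (fun x : 'rV[R]_d => (\prod_i h i (x ord0 i))%:E).
  apply/measurable_EFinP; apply: measurable_prod => i _.
  by apply: (measurableT_comp (mh i)); exact: measurable_rV_entry.
have e z : (boxker z w)%:E = ((A z.1)%:E * (\prod_i h i (z.2 ord0 i))%:E)%E.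
  rewrite -EFinM; congr EFin; rewrite /boxker /boxco mulrACA; congr (_ * _).
  by rewrite /prodf /h -big_split.
under eq_integral do rewrite e.
have mAh : measurable_fun [set: T1 * 'rV[R]_d]
    (fun z : T1 * 'rV[R]_d => ((A z.1)%:E * (\prod_i h i (z.2 ord0 i))%:E)%E).
  apply: emeasurable_funM; last exact: (measurableT_comp mp measurable_snd).
  by apply/measurable_EFinP; exact: (measurableT_comp mA measurable_fst).
have p0 (x : 'rV[R]_d) : (0 <= (\prod_i h i (x ord0 i))%:E)%E by rewrite lee_fin prodr_ge0.
rewrite (fubini_tonelli1 _ mAh); last by move=> z; apply: mule_ge0; [rewrite lee_fin; exact: A0|exact: p0].
have ih := ge0_integral_rV_prod mh h0 (fun i => esym (fineK (window_fin um (xa i) (xb i) (w.2 ord0 i)))).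
rewrite /boxwin EFinM -ih fineK ?(window_fin uc)// /window -ge0_integralZr//; last 3 first.
- by apply/measurable_EFinP.
- by move=> t _; rewrite lee_fin; exact: A0.
- by apply: integral_ge0 => x _; exact: p0.
apply: eq_integral => t _; rewrite /fubini_F/= ge0_integralZl_EFin//.
Qed.

Variable u : Z -> R.
Hypothesis Lu : in_Lp p D u.

Lemma integrable_boxwin : tx.-integrable D (EFin \o (fun w => u w * boxwin rho w)).
Proof.
pose B := 1 + \sum_i (`|xa i| + `|xb i|) + rho.
have s0 : 0 <= \sum_i (`|xa i| + `|xb i|) by apply: sumr_ge0 => i _; exact: addr_ge0.
apply: (integrable_Lp_mul (B := B) p1 T0 Lu).
- exact: measurable_boxwin.
- move=> z _; rewrite ger0_norm ?boxwin_ge0// (le_trans (boxwin_le1 z))// /B -addrA lerDl.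
  exact: addr_ge0 s0 (ltW r0).
- move=> z _; apply: boxwin_supp => i; rewrite /B lerD2r (@le_trans _ _ (\sum_i (`|xa i| + `|xb i|)))//.
    by rewrite (bigD1 i)//= lerDl; apply: sumr_ge0 => j _; exact: addr_ge0.
  by rewrite lerDr.
Qed.

(** Fubini's theorem moves the averaging from u to the indicator of the box. Absolute integrability
    of the joint integrand follows by integrating over z first, since the kernel is nonnegative and
    [boxwin] is bounded with bounded spatial support. *)
Lemma integral_box_mollify : box a b xa xb `<=` D ->
  (\int[tx]_(z in box a b xa xb) (mollify al T u rho z)%:E =
   \int[tx]_(w in D) (u w * boxwin rho w)%:E)%E.
Proof.
move=> ED; have mD := @measurable_cyl R d T.
pose ut : T1 * 'rV[R]_d -> R := u \_ D.
have mut : measurable_fun [set: T1 * 'rV[R]_d] ut := in_Lp_measurable Lu.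
pose nu := sfprod mu (lebesgue_rV d).
pose H (v : (T1 * 'rV[R]_d) * (T1 * 'rV[R]_d)) : R := ut v.2 * boxker v.1 v.2.
have mH : measurable_fun [set: (T1 * 'rV[R]_d) * (T1 * 'rV[R]_d)] (EFin \o H).
  apply/measurable_EFinP; apply: measurable_funM; last exact: measurable_boxker.
  exact: (measurableT_comp mut measurable_snd).
have mk w : measurable_fun [set: T1 * 'rV[R]_d] (fun z => (boxker z w)%:E).
  by apply/measurable_EFinP; exact: (measurable_fun_pair1 w measurable_boxker).
have patch_u : (fun w => (u w * boxwin rho w)%:E) \_ D = (fun w => (ut w * boxwin rho w)%:E).
  apply/funext => v; rewrite patchE /ut patchE; case: ifPn => // _.
  by rewrite [X in X * _](_ : _ = 0) ?mul0r.
have iw : nu.-integrable setT (fun w => (ut w * boxwin rho w)%:E).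
  have := (integrable_mkcond _ mD).1 integrable_boxwin.
  by rewrite -[X in X \_ _]/(fun w => (u w * boxwin rho w)%:E) patch_u.
have nk w : (\int[nu]_z (boxker z w)%:E = (boxwin rho w)%:E)%E := integral_boxker w.
have iH : (nu \x nu)%E.-integrable setT (EFin \o H).
  apply/integrable21ltyP => //.
  have /integrableP[_] := iw; apply: le_lt_trans.
  rewrite le_eqVlt; apply/orP; left; apply/eqP; apply: eq_integral => w _.
  under eq_integral => z _ do rewrite /H/= normrM (ger0_norm (boxker_ge0 _ _)) EFinM.
  rewrite ge0_integralZl_EFin//; last by move=> z _; rewrite lee_fin boxker_ge0.
  by rewrite nk -EFinM /= normrM (ger0_norm (boxwin_ge0 w)).
have := Fubini iH.
have -> : (\int[nu]_y \int[nu]_x (EFin \o H) (x, y) = \int[tx]_(w in D) (u w * boxwin rho w)%:E)%E.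
  rewrite [RHS]integral_mkcond patch_u; apply: eq_integral => w _.
  have ik : nu.-integrable setT (fun z => (boxker z w)%:E).
    apply/integrableP; split => //.
    under eq_integral do rewrite gee0_abs ?lee_fin ?boxker_ge0//.
    by rewrite nk ltry.
  rewrite [RHS]EFinM -nk -(integralZl measurableT ik).
  by apply: eq_integral => z _; rewrite /H/= EFinM.
move=> <-; rewrite [LHS]integral_mkcond; apply: eq_integral => z _; rewrite patchE.
case: ifPn => [|]; rewrite ?inE ?notin_setE => hz.
  have [B hc] := profiles (fun i : 'I_d => @profile_moll R d rho (z.2 ord0 i) r0).
  have iz := wint_integrable p1 T0 hc Lu (weight_chi T (tscale al rho) z.1) (or_introl erefl).
  rewrite /mollify /wint /Rintegral fineK; last exact: integrable_fin_num iz.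
  rewrite [LHS]integral_mkcond; apply: eq_integral => w _; rewrite /H/= /boxker boxcoE indicE mem_set// mul1r.
  rewrite patchE /ut patchE; case: ifPn => // _.
  by rewrite [X in X * _](_ : _ = 0) ?mul0r.
rewrite (eq_integral (cst 0%E)) ?integral0// => w _.
by rewrite /H/= /boxker boxcoE indicE memNset// mul0r mulr0.
Qed.

End fixed_scale.

Lemma cvg_prod_seq (I : Type) (r : seq I) (f : I -> nat -> R) (l : I -> R) :
  (forall i, f i n @[n --> \oo] --> l i) ->
  \prod_(i <- r) f i n @[n --> \oo] --> \prod_(i <- r) l i.
Proof.
move=> fl; elim: r => [|i r ih].
  by rewrite big_nil; under eq_fun do rewrite big_nil; exact: cvg_cst.
by rewrite big_cons; under eq_fun do rewrite big_cons; exact: cvgM.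
Qed.

Lemma boxwin_cvg (rho_ : R^nat) w : (forall n, 0 < rho_ n) -> rho_ n @[n --> \oo] --> 0 ->
  boxwin (rho_ n) w @[n --> \oo] --> boxco w.
Proof.
move=> r0 rc; apply: cvgM; last first.
  apply: cvg_prod_seq => i.
  apply: (@window_cvg R (fun n => moll (rho_ n)) rho_) => // n; exact/unit_kernel_moll.
apply: (@window_cvg R (fun n => chi (tscale al (rho_ n))) (fun n => tscale al (rho_ n))).
  by move=> n; exact/unit_kernel_chi/tscale_gt0.
(* Since 2 / al >= 1, the time scale is at most rho as soon as rho <= 1. *)
apply: (@squeeze_cvgr _ _ _ _ (fun=> 0) rho_) => //; last exact: cvg_cst.
near=> n; rewrite powR_ge0/= /tscale -[leRHS]powRr1 ?(ltW (r0 n))//.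
have /andP[a0 a1] := hal.
have h1 : rho_ n <= 1 by apply/ltW; near: n; exact: (cvgr_lt _ rc).
have h2 : 1 <= 2 / al by rewrite ler_pdivlMr//; lra.
rewrite -(subrK 1 (2 / al)) powRD_gt0// powRr1 ?(ltW (r0 n))// ler_piMl ?(ltW (r0 n))//.
apply: (@le_trans _ _ (1 `^ (2 / al - 1))); last by rewrite powR1.
by rewrite ge0_ler_powR ?nnegrE ?subr_ge0 ?(ltW (r0 n)).
Unshelve. all: by end_near. Qed.

(** After [integral_box_mollify] only the bounded weights [boxwin] vary with n. All of them live
    over one box [vbox B], so |u| restricted there dominates; the averages of u need not be known to
    converge pointwise. *)
Lemma cvg_box_mollify (u : Z -> R) eps : 0 < eps -> in_Lp p D u -> box a b xa xb `<=` D ->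
  tx.-integrable (box a b xa xb) (EFin \o u) /\
  (\int[tx]_(z in box a b xa xb) (mollify al T u (eps / 2 ^+ n) z)%:E @[n --> \oo] -->
  \int[tx]_(z in box a b xa xb) (u z)%:E)%E.
Proof.
move=> e0 Lu ED; have mD := @measurable_cyl R d T.
have rk k : 0 < eps / 2 ^+ k by rewrite divr_gt0// exprn_gt0.
have re k : eps / 2 ^+ k <= eps.
  by rewrite ler_pdivrMr ?exprn_gt0// ler_peMr ?(ltW e0)// exprn_ege1// ler1n.
have rc : eps / 2 ^+ n @[n --> \oo] --> 0.
  rewrite -(mulr0 eps); apply: cvgMr; under eq_fun do rewrite -exprVn.
  by apply: cvg_expr; rewrite ger0_norm// invf_lt1// ltr1n.
pose B := 1 + \sum_i (`|xa i| + `|xb i|) + eps.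
have s0 : 0 <= \sum_i (`|xa i| + `|xb i|) by apply: sumr_ge0 => i _; exact: addr_ge0.
have B1 : 1 <= B by rewrite /B -addrA lerDl; exact: addr_ge0 s0 (ltW e0).
have hB k i : `|xa i| + `|xb i| + eps / 2 ^+ k <= B.
  rewrite /B lerD// (@le_trans _ _ (\sum_i (`|xa i| + `|xb i|)))//.
    by rewrite (bigD1 i)//= lerDl; apply: sumr_ge0 => j _; exact: addr_ge0.
  by rewrite lerDr.
pose h (w : T1 * 'rV[R]_d) : R := \1_(vbox B : set 'rV[R]_d) w.2.
have mh : measurable_fun [set: T1 * 'rV[R]_d] h.
  have mi : measurable_fun [set: 'rV[R]_d] (\1_(vbox B) : 'rV[R]_d -> R).
    by apply: measurable_indic; exact: measurable_vbox.
  exact: (measurableT_comp mi measurable_snd).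
have ih : tx.-integrable D (EFin \o (fun w => u w * h w)).
  apply: (integrable_Lp_mul (B := B) p1 T0 Lu mh).
    by move=> z _; rewrite /h indicE normr_nat (le_trans _ B1)//; case: (_ \in _).
  move=> z _ [i hi]; rewrite /h indicE memNset// => /(_ i)/=.
  by rewrite in_itv/= -ler_norml leNgt hi.
have mu_ := in_Lp_measurableD Lu.
have mf k : measurable_fun (D : set (T1 * 'rV[R]_d)) (fun w => (u w * boxwin (eps / 2 ^+ k) w)%:E).
  by apply/measurable_EFinP; apply: measurable_funM => //; apply: measurable_funTS; exact: measurable_boxwin.
have mfl : measurable_fun (D : set (T1 * 'rV[R]_d)) (fun w => (u w * boxco w)%:E).
  by apply/measurable_EFinP; apply: measurable_funM => //; apply: measurable_funTS; exact: measurable_boxco.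
have dom k w : (`|(u w * boxwin (eps / 2 ^+ k) w)%:E| <= (abse \o (EFin \o (fun w => (u w * h w)%R))) w)%E.
  rewrite /= lee_fin [leLHS]normrM [leRHS]normrM; apply: ler_wpM2l => //.
  rewrite (ger0_norm (boxwin_ge0 (rk k) w)) /h indicE normr_nat.
  have [hw|hw] := boolP (w.2 \in vbox B); first exact: boxwin_le1.
  rewrite (boxwin_supp (rk k) (hB k))//; apply: contrapT => hn; move: hw; rewrite notin_setE; apply => i.
  rewrite /= in_itv/= -ler_norml leNgt; apply/negP => hi; apply: hn; by exists i.
have dom' : {ae tx, forall w n, D w -> (`|(u w * boxwin (eps / 2 ^+ n) w)%:E| <=
    (abse \o (EFin \o (fun w => (u w * h w)%R))) w)%E}.
  by apply: aeW => w n _; exact: dom.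
have [|i1 _ i2] := dominated_convergence mD mf mfl _ (integrable_abse ih) dom'.
  apply: aeW => w Dw; apply: cvg_EFin; first exact: nearW.
  by apply: cvgMr; exact: boxwin_cvg.
have pE (F : Z -> R) : (fun w => (F w * boxco w)%:E) \_ D = (EFin \o F) \_ (box a b xa xb).
  apply/funext => w; rewrite !patchE boxcoE indicE; have [hw|hw] := pselect (box a b xa xb w).
    by rewrite !mem_set ?mulr1//; exact: ED.
  by rewrite (memNset hw) mulr0; case: ifP.
split.
  apply/(integrable_mkcond _ measurable_box); rewrite -pE.
  by apply/(integrable_mkcond _ mD).
rewrite (_ : (\int[tx]_(z in box a b xa xb) (u z)%:E = \int[tx]_(w in D) (u w * boxco w)%:E)%E); last first.
  by rewrite [RHS]integral_mkcond pE -integral_mkcond.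
by under eq_fun do rewrite (integral_box_mollify (rk _) Lu ED).
Qed.

End boxes.

(** * Functions determined by their integrals over boxes *)

Section box_determine.
Context {R : realType} {d : nat}.
Notation mu := (@lebesgue_measure R).
Notation T1 := (measurableTypeR R).
Notation Z := (R * 'rV[R]_d)%type.
Notation tx := (@lebesgue_tx R d).

Definition boxes : set (set (T1 * 'rV[R]_d)) :=
  [set A | exists a b xa xb, A = box (d := d) a b xa xb].

Lemma boxI a b xa xb a' b' xa' xb' : box (d := d) a b xa xb `&` box a' b' xa' xb' =
  box (Num.max a a' : R) (Num.min b b') (fun i => Num.max (xa i) (xa' i)) (fun i => Num.min (xb i) (xb' i)).
Proof.
apply/seteqP; split => z /=; rewrite /box/=.
  move=> [[/andP[h1 h2] h3] [/andP[h4 h5] h6]].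
  rewrite ge_max lt_min h1 h2 h4 h5; split => // i.
  by have /andP[? ?] := h3 i; have /andP[? ?] := h6 i; rewrite ge_max lt_min; apply/andP; split; apply/andP.
rewrite ge_max lt_min => -[/andP[/andP[-> ->] /andP[-> ->]] h].
by split; split => // i; have := h i; rewrite ge_max lt_min => /andP[/andP[? ?] /andP[? ?]]; apply/andP.
Qed.

Lemma boxes_setI : setI_closed boxes.
Proof.
move=> _ _ [a [b [xa [xb ->]]]] [a' [b' [xa' [xb' ->]]]]; rewrite boxI.
by eexists; eexists; eexists; eexists.
Qed.

(** The coordinates are measurable for the sigma-algebra generated by boxes, because a set of the
    form {x <= c z} is a countable union of bounded boxes; coordinates generate the product
    sigma-algebra. *)
Lemma measurable_boxes : @measurable _ (T1 * 'rV[R]_d)%type = <<s boxes >>.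
Proof.
apply/seteqP; split; last first.
  apply: smallest_sub; first exact: sigma_algebra_measurable.
  by move=> _ [a [b [xa [xb ->]]]]; exact: measurable_box.
pose S := g_sigma_algebraType boxes.
have mI (c : Z -> R) : (forall x n, boxes [set z : T1 * 'rV[R]_d | x <= c z < n%:R /\
      (- n%:R <= z.1 < n%:R /\ forall i, - n%:R <= z.2 ord0 i < n%:R)]) ->
    measurable_fun [set: S] (c : S -> T1).
  move=> hc; apply: (measurability (@RGenCInfty.G R)); first exact: RGenCInfty.measurableE.
  move=> _ [_ [x ->] <-]; rewrite setTI.
  rewrite [X in measurable X](_ : _ = \bigcup_n [set z : T1 * 'rV[R]_d | x <= c z < n%:R /\
      (- n%:R <= z.1 < n%:R /\ forall i, - n%:R <= z.2 ord0 i < n%:R)]).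
    by apply: bigcup_measurable => n _; exact: sub_sigma_algebra.
  apply/seteqP; split => z /=; rewrite in_itv/= andbT; last by move=> [n _ [/andP[]]].
  move=> xz; pose M := `|c z| + `|z.1| + \sum_i `|z.2 ord0 i|.
  have s0 : 0 <= \sum_i `|z.2 ord0 i| by exact: sumr_ge0.
  have M0 : 0 <= M by rewrite !addr_ge0.
  have hM (y : R) : `|y| <= M -> - (Num.bound M)%:R <= y < (Num.bound M)%:R.
    move=> hy; have := archi_boundP M0; move/(le_lt_trans hy); rewrite ltr_norml => /andP[h1 ->].
    by rewrite andbT ltW.
  exists (Num.bound M) => //; split; first last.
    split; first by apply: hM; rewrite /M -addrA addrCA lerDl addr_ge0.
    move=> i; apply: hM; rewrite /M (bigD1 i)//= addrCA lerDl addr_ge0 ?addr_ge0//.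
    by apply: sumr_ge0.
  have hc1 : `|c z| <= M by rewrite /M -addrA lerDl addr_ge0.
  by have /andP[_ h2] := hM _ hc1; rewrite xz.
have m1 : measurable_fun [set: S] (fun z : S => z.1 : T1).
  apply: (mI fst) => x n; exists (Num.max x (- n%:R)), n%:R, (fun=> - n%:R), (fun=> n%:R).
  apply/seteqP; split => z; rewrite /box/= ge_max.
    by move=> [/andP[-> h] [/andP[-> _] h3]].
  by move=> [/andP[/andP[-> ->] ->] h3].
have m2 j : measurable_fun [set: S] (fun z : S => z.2 ord0 j : T1).
  apply: (mI (fun z => z.2 ord0 j)) => x n.
  exists (- n%:R), n%:R, (fun i => if i == j then Num.max x (- n%:R) else - n%:R), (fun=> n%:R).
  apply/seteqP; split => z; rewrite /box/=.
    move=> [/andP[h1 h2] [h3 h4]]; split => // i; case: eqP => [->|_]; last exact: h4.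
    by have /andP[h5 h6] := h4 j; rewrite ge_max h1 h5.
  move=> [h1 h2]; have := h2 j; rewrite eqxx ge_max => /andP[/andP[-> h3] ->]; split => //; split => // i.
  have := h2 i; case: eqP => [->|_] //; by rewrite ge_max => /andP[/andP[_ ->] ->].
have mid : measurable_fun [set: S] (fun z : S => (z.1, z.2) : T1 * 'rV[R]_d).
  apply/measurable_fun_pairP; split; first exact: m1.
  by apply: measurable_fun_mxP => i j; rewrite (ord1 i); exact: m2.
move=> A mA; have := mid measurableT A mA; rewrite setTI.
rewrite [X in measurable X -> _](_ : _ = A)//.
by apply/seteqP; split => -[].
Qed.

Section ae_zero.
Variables (T : R) (h : T1 * 'rV[R]_d -> \bar R).
Local Notation D := (cyl T [set: 'rV[R]_d]).
Hypothesis hi : forall a b xa xb, box a b xa xb `<=` D ->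
  tx.-integrable (box a b xa xb) h /\ (\int[tx]_(z in box a b xa xb) h z = 0)%E.

(** Boxes are closed on the left, so they start at 1/(n + 1) rather than 0 to stay inside the open
    cylinder, which they exhaust. *)
Let E n : set (T1 * 'rV[R]_d) := box (n.+1%:R^-1) T (fun=> - n%:R) (fun=> n%:R).

Let ED n : E n `<=` D.
Proof.
move=> z [/andP[h1 h2] _]; split => //=; rewrite in_itv/= h2 andbT.
by apply: lt_le_trans h1; rewrite invr_gt0.
Qed.

(** A pi-lambda argument on each [E n]: boxes are stable under intersection and generate the
    measurable sets, so the integral of h restricted to [E n] vanishes over every measurable set,
    whence h = 0 almost everywhere on [E n]. *)
Lemma ae_zero_boxes : {ae tx, forall z, D z -> h z = 0%E}.
Proof.
have key n : {ae tx, forall z, E n z -> h z = 0%E}.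
  have [iE _] := hi (@ED n).
  have mE : measurable (E n) by exact: measurable_box.
  have iT := (integrable_mkcond _ mE).1 iE.
  have z0 S : measurable S -> (\int[tx]_(z in S) (h \_ (E n)) z = 0)%E.
    move=> mS; have := mS; rewrite measurable_boxes => sS.
    have iS A : measurable A -> tx.-integrable A (h \_ (E n)).
      by move=> mA; apply: (integrableS measurableT) iT.
    have t0 : (\int[tx]_(z in setT) (h \_ (E n)) z = 0)%E.
      by rewrite -integral_mkcond; have [] := hi (@ED n).
    apply: (@dynkin_induction _ _ boxes (fun S => \int[tx]_(z in S) (h \_ (E n)) z = 0)%E
       measurable_boxes boxes_setI) => //.
    - move=> _ [a [b [xa [xb ->]]]]; rewrite -integral_mkcondr.
      have sub : box a b xa xb `&` E n `<=` D by move=> z [_ Ez]; exact: ED Ez.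
      by move: sub; rewrite /E boxI => sub; have [] := hi sub.
    - move=> A mA A0; move: t0; rewrite -(setUv A) integral_setU//; last 3 first.
      + exact: measurableC.
      + by rewrite setUv; exact: (measurable_int _ iT).
      + by rewrite disj_set2E setICr.
      by rewrite A0 add0e.
    - move=> F mF tF F0; rewrite integral_bigcup//; last by apply: iS; exact: bigcupT_measurable.
      by rewrite eseries0.
  have z0' A : A `<=` setT -> measurable A ->
      (\int[tx]_(z in A) (h \_ (E n)) z = \int[tx]_(z in A) (cst 0%E : _ -> \bar R) z)%E.
    by move=> _ mA; rewrite z0// integral0.
  have := integral_ae_eq measurableT iT (measurable_cst _) z0'.
  move=> [N [mN N0 sN]]; exists N; split => //; apply: subset_trans sN => z /= hz h2; apply: hz => Ez.
  by have := h2 I; rewrite patchE mem_set.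
have /ae_foralln := key; apply: filterS => z hz Dz.
have [n En] : exists n, E n z.
  have s0 : 0 <= \sum_i `|z.2 ord0 i| by exact: sumr_ge0.
  have [] := Dz; rewrite /= in_itv/= => /andP[z0 zT] _.
  have i0 : 0 <= z.1^-1 by rewrite invr_ge0 ltW.
  have M0 : 0 <= z.1^-1 + \sum_i `|z.2 ord0 i| by rewrite addr_ge0.
  exists (Num.bound (z.1^-1 + \sum_i `|z.2 ord0 i|)).
  have := archi_boundP M0; set n := Num.bound _ => hn; split.
    rewrite zT andbT -[leRHS]invrK lef_pV2 ?posrE ?invr_gt0// -natr1; lra.
  move=> i; have : `|z.2 ord0 i| < n%:R.
    apply: le_lt_trans hn; rewrite (bigD1 i)//= addrCA lerDl addr_ge0//; exact: sumr_ge0.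
  by rewrite ltr_norml => /andP[h1 ->]; rewrite andbT ltW.
exact: hz En.
Qed.

End ae_zero.

End box_determine.

Section dual_bound.
Context d (X : measurableType d) (R : realType) (m : {measure set X -> \bar R}).
Variables (C s r : R).

(** The dual form of a norm bound on W by N. It is stable under sums and nonnegative multiples, so
    the bound for [majpot] can be assembled term by term from [hls_pot]. *)
Definition dual_bound (W : X -> \bar R) (N : \bar R) :=
  [/\ measurable_fun [set: X] W, (forall x, 0 <= W x)%E, (0 <= N)%E &
    forall G : X -> \bar R, measurable_fun [set: X] G -> (forall x, 0 <= G x)%E ->
    (\int[m]_x (G x * W x) <= C%:E * ((\int[m]_x (G x `^ s)) `^ r * N))%E].

Lemma dual_boundD W W' N N' : dual_bound W N -> dual_bound W' N' ->
  dual_bound (fun x => W x + W' x)%E (N + N')%E.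
Proof.
move=> [mW W0 N0 h] [mW' W'0 N'0 h']; split.
- exact: emeasurable_funD.
- by move=> x; exact: adde_ge0.
- exact: adde_ge0.
move=> G mG G0.
have -> : (\int[m]_x (G x * (W x + W' x)) = \int[m]_x (G x * W x) + \int[m]_x (G x * W' x))%E.
  rewrite -ge0_integralD//.
  - by apply: eq_integral => x _; rewrite ge0_muleDr.
  - by move=> x _; exact: mule_ge0.
  - exact: emeasurable_funM.
  - by move=> x _; exact: mule_ge0.
  - exact: emeasurable_funM.
rewrite (ge0_muleDr _ N0 N'0) ge0_muleDr; last 2 first.
- by apply: mule_ge0 => //; exact: poweR_ge0.
- by apply: mule_ge0 => //; exact: poweR_ge0.
by apply: leeD; [exact: h|exact: h'].
Qed.

Lemma dual_boundZ k W N : 0 <= k -> dual_bound W N ->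
  dual_bound (fun x => k%:E * W x)%E (k%:E * N)%E.
Proof.
move=> k0 [mW W0 N0 h]; split.
- exact: measurable_funeM.
- by move=> x; apply: mule_ge0.
- by apply: mule_ge0.
move=> G mG G0.
have -> : (\int[m]_x (G x * (k%:E * W x)) = k%:E * \int[m]_x (G x * W x))%E.
  rewrite -ge0_integralZl//.
  - by apply: eq_integral => x _; rewrite muleCA.
  - exact: emeasurable_funM.
  - by move=> x _; exact: mule_ge0.
have -> : (C%:E * ((\int[m]_x (G x `^ s)) `^ r * (k%:E * N)) =
    k%:E * (C%:E * ((\int[m]_x (G x `^ s)) `^ r * N)))%E.
  by rewrite [in RHS]muleCA [X in (_ * X)%E]muleCA.
by apply: lee_wpmul2l; [rewrite lee_fin|exact: h].
Qed.

(** Test the bound with the indicator of E, whose power s is itself and has integral m E. *)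
Lemma dual_bound_integrable W N (E : set X) : s != 0 -> dual_bound W N -> (N < +oo)%E ->
  measurable E -> (m E < +oo)%E -> m.-integrable E W.
Proof.
move=> s0 [mW W0 N0 h] Nfin mE Efin.
apply/integrableP; split; first exact: measurable_funTS.
have -> : (\int[m]_(x in E) `|W x| = \int[m]_x ((\1_E x)%:E * W x))%E.
  rewrite integral_mkcond; apply: eq_integral => x _.
  by rewrite patchE indicE; case: ifP => _; rewrite ?mul1e ?mul0e// gee0_abs.
have mi : measurable_fun [set: X] (EFin \o (\1_E : X -> R)).
  by apply/measurable_EFinP; exact: measurable_indic.
have i0 x : (0 <= (EFin \o (\1_E : X -> R)) x)%E by rewrite /= lee_fin.
apply: le_lt_trans (h _ mi i0) _.
have -> : (\int[m]_x ((EFin \o (\1_E : X -> R)) x `^ s) = m E)%E.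
  rewrite -[in RHS](setIT E) -integral_indic//; apply: eq_integral => x _.
  by rewrite /= indicE; case: (_ \in _); rewrite ?poweR_EFin ?powR1 ?powR0.
have fr : ((m E `^ r) \is a fin_num)%E.
  by rewrite fin_num_poweR// ge0_fin_numE.
rewrite ltey_eq !fin_numM// ge0_fin_numE//.
Qed.

End dual_bound.

Section vector_norm.
Context {R : realType} {d : nat}.
Notation T1 := (measurableTypeR R).
Notation Z := (R * 'rV[R]_d)%type.
Variables (p T : R).
Hypothesis p1 : 1 <= p.
Local Notation D := (cyl T [set: 'rV[R]_d]).

(** The Euclidean norm is at most the sum of the absolute entries, and Minkowski's inequality does
    the rest. It links the estimate, stated with Euclidean norms, to [Hm1_norm], which adds the
    norms of the components. *)
Lemma vLpnorm_le_sum (G : Z -> 'rV[R]_d) : in_vLp p D G ->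
  (vLpnorm p D G <= \sum_(i < d) Lpnorm p D (fun z => G z ord0 i))%E.
Proof.
move=> LG; have mD := @measurable_cyl R d T.
have p0 : 0 <= p by exact: le_trans p1.
pose a i (z : T1 * 'rV[R]_d) : R := `|((fun z => G z ord0 i) \_ D) z|.
have ma i : measurable_fun [set: T1 * 'rV[R]_d] (a i).
  exact: (measurableT_comp (@normr_measurable R setT) (in_Lp_measurable (LG i))).
have mE : measurable_fun [set: T1 * 'rV[R]_d] ((fun z => enorm (G z)) \_ D).
  apply/(measurable_restrictT _ mD).
  apply: (measurableT_comp (continuous_measurable_fun (@sqrt_continuous R))).
  apply: measurable_sum => i; apply: measurable_funX; exact: in_Lp_measurableD (LG i).
have mS (r : seq 'I_d) : measurable_fun [set: T1 * 'rV[R]_d] (fun z => \sum_(i <- r) a i z).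
  by apply: measurable_sum.
apply: (@le_trans _ _ ('N[lebesgue_tx]_p%:E[EFin \o (fun z => \sum_i a i z)%R])%E).
  rewrite /vLpnorm /Lpnorm unlock.
  apply: gt0_ler_poweR; rewrite ?invr_ge0//.
  - by rewrite in_itv/= leey integral_ge0// => z _; exact: poweR_ge0.
  - by rewrite in_itv/= leey integral_ge0// => z _; exact: poweR_ge0.
  have mp (b : T1 * 'rV[R]_d -> R) : measurable_fun [set: T1 * 'rV[R]_d] b ->
      measurable_fun [set: T1 * 'rV[R]_d] (fun z => (`|b z| `^ p)%:E).
    move=> mb; apply/measurable_EFinP; apply: (measurableT_comp (measurable_powR p)).
    exact: (measurableT_comp (@normr_measurable R setT) mb).
  apply: ge0_le_integral.
  - exact: measurableT.
  - by move=> z _; exact: poweR_ge0.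
  - exact: (mp _ mE).
  - exact: (mp _ (mS _)).
  move=> z _; rewrite lee_fin; apply: ge0_ler_powR; rewrite ?nnegrE//.
  rewrite patchE; case: ifPn => zD.
    rewrite ger0_norm ?sqrtr_ge0// (le_trans (enorm_le_sum _))// (le_trans _ (ler_norm _))//.
    by apply: ler_sum => i _; rewrite /a patchE zD.
  by rewrite [X in `|X|](_ : _ = 0) ?normr0.
elim: (index_enum 'I_d) => [|i r IH].
  rewrite big_nil (_ : EFin \o _ = cst 0%E); last by apply/funext => z; rewrite /= big_nil.
  by rewrite Lnorm0// eqe gt_eqF// (lt_le_trans _ p1).
rewrite big_cons.
have -> : (fun z => (\sum_(j <- i :: r) a j z)%R) = (a i \+ (fun z => (\sum_(j <- r) a j z)%R))%R.
  by apply/funext => z; rewrite big_cons.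
apply: (le_trans (minkowski_EFin _ (ma i) (mS r) p1)).
apply: leeD; last exact: IH.
by rewrite -[leRHS]Lnorm_abse.
Qed.

Lemma vLpnorm_fin (G : Z -> 'rV[R]_d) : in_vLp p D G -> (vLpnorm p D G < +oo)%E.
Proof.
move=> LG; apply: le_lt_trans (vLpnorm_le_sum LG) _.
by apply: lte_sum_pinfty => i _; exact: in_Lp_fin.
Qed.

End vector_norm.

Section majorant.
Context {R : realType} (d : nat).
Notation mu := (@lebesgue_measure R).
Notation T1 := (measurableTypeR R).
Notation Z := (R * 'rV[R]_d)%type.
Notation tx := (@lebesgue_tx R d).
Variables (al p p0 : R).
Hypotheses (hal : 0 < al < 1) (p1 : 1 < p) (pp0 : p < p0).
Notation dl := (p^-1 - p0^-1).
Notation Dm := (d%:R + 2 / al).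
Hypothesis hq : 0 <= 1 - dl * Dm.

Lemma exponent_gap : 0 < dl < 1.
Proof.
have pp : 0 < p by exact: lt_trans p1.
have p00 : 0 < p0 by exact: lt_trans pp0.
have ip : p^-1 < 1 by rewrite invf_lt1.
have ip0 : p0^-1 < p^-1 by rewrite ltf_pV2.
have ip00 : 0 < p0^-1 by rewrite invr_gt0.
by apply/andP; split; lra.
Qed.

Definition majnorm (eps : R) (Nu NDu Ng Nf : \bar R) : \bar R :=
  ((cmoll ^+ d * eps `^ (- dl * Dm))%:E * Nu +
   (step_const (d := d) al)%:E * ((scale_const (d := d) al dl * eps `^ (1 - dl * Dm))%:E *
     (NDu + Ng) + (scale_const (d := d) al dl * eps `^ (2 - dl * Dm))%:E * Nf))%E.

Lemma dual_bound_majpot : exists2 C, 0 < C & forall (T eps : R) u f Du g, 0 < T -> 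
  in_Lp p (cyl T setT) u -> in_Lp p (cyl T setT) f -> in_vLp p (cyl T setT) Du ->
  in_vLp p (cyl T setT) g ->
  dual_bound tx C (1 - p0^-1)^-1 (1 - p0^-1) (majpot al dl T u f Du g eps)
    (majnorm eps (Lpnorm p (cyl T setT) u) (vLpnorm p (cyl T setT) Du)
       (vLpnorm p (cyl T setT) g) (Lpnorm p (cyl T setT) f)).
Proof.
have [C C0 hC] := @hls_pot R d p p0 p1 pp0; exists C => //.
move=> T eps u f Du g T0 Lu Lf LDu Lg.
have hdl := exponent_gap.
have s0 := @step_const_ge0 R d al hal; have c0 := @scale_const_ge0 R d al dl hal hdl.
have m0 : 0 <= (@cmoll R) ^+ d by rewrite exprn_ge0// (le_trans ler01)// cmoll1.
have hb F : measurable_fun (cyl T setT : set (T1 * 'rV[R]_d)) F ->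
    dual_bound tx C (1 - p0^-1)^-1 (1 - p0^-1) (pot dl T F) (Lpnorm p (cyl T setT) F).
  move=> mF; split.
  - exact: (measurable_pot _ _ mF).
  - by move=> z; exact: pot_ge0.
  - exact: Lnorm_ge0.
  - by move=> G mG G0; exact: hC.
have ke a : 0 <= scale_const (d := d) al dl * eps `^ a by exact: mulr_ge0 c0 (powR_ge0 _ _).
apply: dual_boundD.
  apply: dual_boundZ; first exact: mulr_ge0 m0 (powR_ge0 _ _).
  exact: hb (in_Lp_measurableD Lu).
apply: (dual_boundZ s0).
apply: dual_boundD.
  apply: (dual_boundZ (ke _)); apply: dual_boundD.
    exact: hb (measurable_enorm LDu).
  exact: hb (measurable_enorm Lg).
apply: (dual_boundZ (ke _)); exact: hb (in_Lp_measurableD Lf).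
Qed.

Lemma majnorm_fin (eps : R) (Nu NDu Ng Nf : \bar R) :
  (0 <= Nu < +oo -> 0 <= NDu < +oo -> 0 <= Ng < +oo -> 0 <= Nf < +oo ->
  majnorm eps Nu NDu Ng Nf \is a fin_num)%E.
Proof.
move=> /andP[? ?] /andP[? ?] /andP[? ?] /andP[? ?].
have [? ?] : (Nu \is a fin_num)%E /\ (NDu \is a fin_num)%E by rewrite !ge0_fin_numE.
have [? ?] : (Ng \is a fin_num)%E /\ (Nf \is a fin_num)%E by rewrite !ge0_fin_numE.
by rewrite /majnorm fin_numD !fin_numM//= fin_numD !fin_numM//= fin_numD; apply/andP.
Qed.

Lemma majnorm_lp_fin (T eps : R) (u f : Z -> R) (Du g : Z -> 'rV[R]_d) :
  in_Lp p (cyl T setT) u -> in_Lp p (cyl T setT) f ->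
  in_vLp p (cyl T setT) Du -> in_vLp p (cyl T setT) g ->
  majnorm eps (Lpnorm p (cyl T setT) u) (vLpnorm p (cyl T setT) Du)
    (vLpnorm p (cyl T setT) g) (Lpnorm p (cyl T setT) f) \is a fin_num.
Proof.
move=> Lu Lf LDu Lg; apply: majnorm_fin; apply/andP; split; try exact: Lnorm_ge0.
- exact: in_Lp_fin.
- exact: (vLpnorm_fin (ltW p1) LDu).
- exact: (vLpnorm_fin (ltW p1) Lg).
- exact: in_Lp_fin.
Qed.

Lemma box_lty (a b : R) (xa xb : 'I_d -> R) : (tx (box a b xa xb) < +oo)%E.
Proof.
have -> : box a b xa xb = `[a, b[%classic `*` [set v : 'rV[R]_d | forall i, `[xa i, xb i[%classic (v ord0 i)].
  apply/seteqP; split => z /=.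
    by move=> [h1 h2]; split => [|i]; rewrite in_itv/=.
  by move=> [h1 h2]; split; [move: h1; rewrite in_itv|move=> i; have := h2 i; rewrite in_itv].
have mB : measurable [set v : 'rV[R]_d | forall i, `[xa i, xb i[%classic (v ord0 i)].
  rewrite [X in measurable X](_ : _ = \bigcap_(i in [set: 'I_d])
    ((fun v : 'rV[R]_d => v ord0 i) @^-1` `[xa i, xb i[%classic)); last first.
    by apply/seteqP; split => v /= h i; [move=> _|]; exact: h.
  apply: fin_bigcap_measurable => // i _.
  by rewrite -[X in measurable X]setTI; apply: measurable_mx_entry.
have hf x y : (lebesgue_measure `[x : R, y[%classic < +oo)%E.
  by rewrite lebesgue_measure_itv/=; case: ifP => _; rewrite ?ltry// -EFinD ltry.
rewrite [ltLHS](product_measure1E mu (lebesgue_rV d) (measurable_itv _) mB).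
apply: lte_mul_pinfty; [exact: measure_ge0| |].
  by rewrite ge0_fin_numE; [exact: hf|exact: measure_ge0].
rewrite (lebesgue_rV_box (fun i => measurable_itv _)).
rewrite ltey_eq; apply/orP; left; apply: prode_fin_num => i _.
by rewrite ge0_fin_numE.
Qed.

Section limit.
Variables (T : R) (u f : Z -> R) (Du g : Z -> 'rV[R]_d).
Hypothesis T0 : 0 < T.
Local Notation D := (cyl T [set: 'rV[R]_d]).
Hypotheses (Lu : in_Lp p D u) (Lf : in_Lp p D f) (LDu : in_vLp p D Du) (Lg : in_vLp p D g).
Hypothesis wDu : weak_gradient T setT u Du.
Hypothesis hw : weak_frac al T u f g.
Variable eps : R.
Hypothesis e0 : 0 < eps.

Local Notation W := (majpot al dl T u f Du g eps).

Lemma measurable_mollify rho : 0 < rho -> measurable_fun [set: T1 * 'rV[R]_d] (fun z => mollify al T u rho z).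
Proof.
move=> r0; have mD := @measurable_cyl R d T.
have [mc _ _ _] := unit_kernel_chi (tscale_gt0 al r0).
have [mm _ _ _] := @unit_kernel_moll R _ r0.
have mK : measurable_fun [set: (T1 * 'rV[R]_d) * (T1 * 'rV[R]_d)] (fun v => ((u \_ D) v.2 *
    (chi (tscale al rho) (v.1.1 - v.2.1) * prodf (fun i y => moll rho (v.1.2 ord0 i - y)) v.2.2))%:E).
  apply/measurable_EFinP; apply: measurable_funM.
    exact: (measurableT_comp (in_Lp_measurable Lu) measurable_snd).
  apply: measurable_funM.
    apply: (measurableT_comp mc); apply: measurable_funB.
      exact: (measurableT_comp measurable_fst measurable_fst).
    exact: (measurableT_comp measurable_fst measurable_snd).
  apply: measurable_prod => i _; apply: (measurableT_comp mm); apply: measurable_funB.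
    exact: (measurableT_comp (measurable_rV_entry i) (measurableT_comp measurable_snd measurable_fst)).
  exact: (measurableT_comp (measurable_rV_entry i) (measurableT_comp measurable_snd measurable_snd)).
have mI := @measurable_integral_param R _ _ _ _ (sfprod mu (lebesgue_rV d)) _ mK.
have -> : (fun z => mollify al T u rho z) = (fun z => fine (\int[sfprod mu (lebesgue_rV d)]_w
    ((u \_ D) w * (chi (tscale al rho) (z.1 - w.1) * prodf (fun i y => moll rho (z.2 ord0 i - y)) w.2))%:E)%E).
  apply/funext => z; rewrite /mollify /wint /Rintegral integral_mkcond; congr fine.
  apply: eq_integral => w _; rewrite !patchE; case: ifP => // _.
  by rewrite [X in X * _](_ : _ = 0) ?mul0r.
exact: (measurableT_comp (@fine_measurable R setT measurableT) mI).
Qed.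

(** An upper limit is measurable without any knowledge of convergence, and it is the limit wherever
    [majpot] is finite. *)
Let v (z : T1 * 'rV[R]_d) : \bar R := limn_esup (fun n => (mollify al T u (eps / 2 ^+ n) z)%:E).

Let v_cvg (z : T1 * 'rV[R]_d) : z.1 < T -> (W z < +oo)%E ->
  (mollify al T u (eps / 2 ^+ n) z)%:E @[n --> \oo] --> v z.
Proof.
move=> zT Wz.
have /cvg_ex[l hl] := mollify_is_cvg hal exponent_gap p1 T0 hq Lu Lf LDu Lg wDu hw e0 zT Wz.
have hE : (mollify al T u (eps / 2 ^+ n) z)%:E @[n --> \oo] --> l%:E.
  by apply: cvg_EFin => //; exact: nearW.
have h2 := cvg_esups hE.
rewrite /v limn_esup_lim (cvg_lim _ h2)//.
Qed.

Let v_le (z : T1 * 'rV[R]_d) : z.1 < T -> (`|v z| <= W z)%E.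
Proof.
move=> zT; have [->|Wz] := eqVneq (W z) +oo%E; first exact: leey.
have Wy : (W z < +oo)%E by rewrite ltey.
have hc := v_cvg zT Wy.
have ha : (`|(mollify al T u (eps / 2 ^+ n) z)%:E| @[n --> \oo] --> `|v z|)%E by exact: cvg_abse.
rewrite -(cvg_lim _ ha)//; apply: lime_le; first by apply/cvg_ex; exists `|v z|%E.
apply: nearW => n.
exact: (mollify_le_majpot hal exponent_gap p1 T0 hq Lu Lf LDu Lg wDu hw e0 n zT).
Qed.

Lemma majpot_integrable a b xa xb : tx.-integrable (box a b xa xb) W.
Proof.
have [C C0 hC] := dual_bound_majpot.
have ip : p0^-1 < 1 by rewrite invf_lt1 ?(lt_trans p1)// (lt_trans _ pp0)// (lt_trans _ p1).
have nz : (1 - p0^-1)^-1 != 0 by rewrite invr_neq0// subr_eq0 gt_eqF.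
apply: (dual_bound_integrable nz (hC T eps _ _ _ _ T0 Lu Lf LDu Lg)).
- by rewrite ltey_eq (majnorm_lp_fin _ Lu Lf LDu Lg).
- exact: measurable_box.
- exact: box_lty.
Qed.

(** W dominates all averages and is integrable over boxes, hence finite almost everywhere there; so
    the averages converge to [v] and their box integrals to those of [v]. By [cvg_box_mollify] the
    same integrals tend to those of u. Thus u - v has zero integral over every box in the cylinder,
    u = v almost everywhere, and |v| <= W. *)
Lemma ae_le_majpot : {ae tx, forall z, (`|(u \_ D) z|%:E <= W z)%E}.
Proof.
have mf n : measurable_fun [set: T1 * 'rV[R]_d] (fun z => (mollify al T u (eps / 2 ^+ n) z)%:E).
  by apply/measurable_EFinP; apply: measurable_mollify; rewrite divr_gt0// exprn_gt0.
have mv : measurable_fun [set: T1 * 'rV[R]_d] v by exact: measurable_fun_limn_esup.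
pose h (z : T1 * 'rV[R]_d) := ((u z)%:E - v z)%E.
have hz : {ae tx, forall z, D z -> h z = 0%E}.
  refine (@ae_zero_boxes R d T h _) => a b xa xb ED.
  have mE := @measurable_box R d a b xa xb.
  have iW := majpot_integrable a b xa xb.
  have zT z : box a b xa xb z -> z.1 < T by move=> /ED [/= tT _]; move: tT; rewrite in_itv/= => /andP[].
  have [iu cu] := cvg_box_mollify hal p1 T0 e0 Lu ED.
  have [|||||iv _ cv] := @dominated_convergence _ _ _ tx _ mE
    (fun n z => (mollify al T u (eps / 2 ^+ n) z)%:E) v W.
  - by move=> n; apply: measurable_funTS; exact: mf.
  - by apply: measurable_funTS.
  - have := integrable_ae mE iW; apply: filterS => z hz Ez; apply: v_cvg; first exact: zT.
    by rewrite ltey_eq hz.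
  - exact: iW.
  - apply: aeW => z n Ez.
    exact: (mollify_le_majpot hal exponent_gap p1 T0 hq Lu Lf LDu Lg wDu hw e0 n (zT _ Ez)).
  have e := cvg_unique (@ereal_hausdorff R) cu cv.
  split; first exact: integrableB.
  rewrite integralB//= e subee//.
  exact: integrable_fin_num.
move: hz; apply: (filterS (F := almost_everywhere tx)) => z hz; rewrite patchE; case: ifPn => [zD|_]; last first.
  by rewrite [X in `|X|](_ : _ = 0) ?normr0 ?majpot_ge0// exponent_gap.
have Dz : D z by move: zD; rewrite inE.
have zT : z.1 < T by case: Dz => /= tT _; move: tT; rewrite in_itv/= => /andP[].
(* Infinite values of [v] are excluded by h z = 0, as u z is a real number. *)
have := v_le zT; have := hz Dz; rewrite /h; case: (v z) => [r|h1|h1]; last 2 first.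
- by move/eqP: h1.
- by move/eqP: h1.
by rewrite -EFinB => -[/eqP]; rewrite subr_eq0 => /eqP ->.
Qed.

End limit.

Lemma Lpnorm_le_majnorm : exists2 C, 0 < C & forall (T : R) (u f : Z -> R) (Du g : Z -> 'rV[R]_d),
  0 < T -> in_Lp p (cyl T setT) u -> in_Lp p (cyl T setT) f ->
  in_vLp p (cyl T setT) Du -> in_vLp p (cyl T setT) g ->
  weak_gradient T setT u Du ->
  weak_frac al T u f g ->
  forall eps, 0 < eps ->
  (Lpnorm p0 (cyl T setT) u <= C%:E * majnorm eps (Lpnorm p (cyl T setT) u)
     (vLpnorm p (cyl T setT) Du) (vLpnorm p (cyl T setT) g) (Lpnorm p (cyl T setT) f))%E.
Proof.
have [C C0 hC] := dual_bound_majpot; exists C => //.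
move=> T u f Du g T0 Lu Lf LDu Lg wDu hw eps e0.
have [mW W0 N0 hb] := hC T eps _ _ _ _ T0 Lu Lf LDu Lg.
set N := majnorm _ _ _ _ _ in hb N0 *.
have Nf : N \is a fin_num by exact: majnorm_lp_fin.
have p01 : 1 < p0 by exact: lt_trans pp0.
rewrite -(fineK Nf) -EFinM.
apply: (@Lnorm_le_dual R _ _ (sfprod mu (lebesgue_rV d)) p0 (C * fine N) (u \_ (cyl T setT))
  (majpot al dl T u f Du g eps)) => //.
- by rewrite mulr_ge0 ?fine_ge0 ?(ltW C0).
- exact: in_Lp_measurable Lu.
- exact: (ae_le_majpot T0 Lu Lf LDu Lg wDu hw e0).
move=> G mG G0; apply: le_trans (hb _ mG G0) _.
by rewrite EFinM fineK// -muleA [X in (_ * X <= _)%E]muleC.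
Qed.

End majorant.

(** * The embedding *)

Section optimisation.
Context {R : realType}.

(** The optimal choice is eps = sqrt U / sqrt F, where the two terms coincide. If U = 0 let eps tend
    to 0, and if F = 0 let it tend to infinity. *)
Lemma le_scaling_optimum (x N U F V : R) : 0 < N -> 0 <= U -> 0 <= F ->
  (forall eps, 0 < eps -> x <= N * eps^-1 * U + N * eps * F + N * V) ->
  x <= 2 * N * Num.sqrt U * Num.sqrt F + N * V.
Proof.
move=> N0 U0 F0 h.
have [U00|Un] := eqVneq U 0.
  rewrite U00 sqrtr0 mulr0 mul0r add0r; apply/ler_addgt0Pr => e e0.
  have k0 : 0 < N * F + 1 by rewrite ltr_pwDr// mulr_ge0// ltW.
  have := h _ (divr_gt0 e0 k0); rewrite U00 mulr0.
  have -> : N * (e / (N * F + 1)) * F = e * (N * F / (N * F + 1)) by ring.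
  have : e * (N * F / (N * F + 1)) <= e.
    by rewrite ler_piMr ?(ltW e0)// ler_pdivrMr// mul1r lerDl.
  by lra.
have Up : 0 < U by rewrite lt_def Un.
have [F00|Fn] := eqVneq F 0.
  rewrite F00 sqrtr0 mulr0 add0r; apply/ler_addgt0Pr => e e0.
  have k0 : 0 < N * U + 1 by rewrite ltr_pwDr// mulr_ge0// ltW.
  have := h _ (divr_gt0 k0 e0); rewrite F00 invf_div.
  have -> : N * (e / (N * U + 1)) * U = e * (N * U / (N * U + 1)) by ring.
  have : e * (N * U / (N * U + 1)) <= e.
    by rewrite ler_piMr ?(ltW e0)// ler_pdivrMr// mul1r lerDl.
  by rewrite mulr0; lra.
have Fp : 0 < F by rewrite lt_def Fn.
set a := Num.sqrt U; set b := Num.sqrt F.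
have a0 : 0 < a by rewrite sqrtr_gt0.
have b0 : 0 < b by rewrite sqrtr_gt0.
have := h _ (divr_gt0 a0 b0).
rewrite -(sqr_sqrtr U0) -(sqr_sqrtr F0) -/a -/b.
have -> : N * (a / b)^-1 * a ^+ 2 + N * (a / b) * b ^+ 2 = 2 * N * a * b.
  by field; rewrite !gt_eqF.
by [].
Qed.

End optimisation.

Section estimate.
Context {R : realType} (d : nat).
Notation Z := (R * 'rV[R]_d)%type.
Notation tx := (@lebesgue_tx R d).
Variables (al p p0 : R).
Hypotheses (hal : 0 < al < 1) (p1 : 1 < p) (pp0 : p < p0).
Notation Dm := (d%:R + 2 / al).
Hypothesis hstar : 1 - Dm / p >= - (Dm / p0).
Notation q := (Dm / p0 - Dm / p).

(** [Hm1_rep] pairs f and g under a single integral; the integrability assumptions built into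
    [weak_frac] are what allows it to be split. *)
Lemma weak_frac_Hm1_rep (T : R) (u f : Z -> R) (g : Z -> 'rV[R]_d) :
  Hm1_rep p T setT (Dt_frac al T setT u) g f -> weak_frac al T u f g.
Proof.
move=> [_ _ h] phi hphi ig if_.
have := h phi hphi; rewrite (RintegralB (@measurable_cyl R d T) if_ ig) /Dt_frac => e.
by rewrite -[LHS]opprK e opprB.
Qed.

Lemma scaled_estimate : exists2 N : R, 0 < N & forall (T : R) (u f : Z -> R) (Du g : Z -> 'rV[R]_d),
  0 < T -> in_Lp p (cyl T setT) u -> in_Lp p (cyl T setT) f ->
  in_vLp p (cyl T setT) Du -> in_vLp p (cyl T setT) g ->
  weak_gradient T setT u Du -> weak_frac al T u f g ->
  forall eps, 0 < eps ->
  Lpnorm p0 (cyl T setT) u \is a fin_num /\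
  fine (Lpnorm p0 (cyl T setT) u) <= N * eps `^ q * fine (Lpnorm p (cyl T setT) u)
    + N * eps `^ (2 + q) * fine (Lpnorm p (cyl T setT) f)
    + N * eps `^ (1 + q) * (fine (vLpnorm p (cyl T setT) Du) + fine (vLpnorm p (cyl T setT) g)).
Proof.
have hq : 0 <= 1 - (p^-1 - p0^-1) * Dm by move: hstar; rewrite mulrBl ![_^-1 * _]mulrC; lra.
have [C C0 hC] := Lpnorm_le_majnorm hal p1 pp0 hq.
have hdl := exponent_gap p1 pp0.
set a := (@cmoll R) ^+ d; set b := step_const (d := d) al * scale_const (d := d) al (p^-1 - p0^-1).
have a0 : 0 <= a by rewrite exprn_ge0// (le_trans ler01)// cmoll1.
have b0 : 0 <= b by apply: mulr_ge0; [exact: step_const_ge0|exact: scale_const_ge0].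
exists (C * (a + b) + 1).
  by rewrite ltr_pwDr// mulr_ge0 ?addr_ge0// ltW.
move=> T u f Du g T0 Lu Lf LDu Lg wDu hw eps e0.
have := hC _ _ _ _ _ T0 Lu Lf LDu Lg wDu hw eps e0.
have fin (x : \bar R) : (0 <= x < +oo)%E -> x \is a fin_num by move=> /andP[? ?]; rewrite ge0_fin_numE.
have Uf : Lpnorm p (cyl T setT) u \is a fin_num by apply: fin; rewrite Lnorm_ge0 in_Lp_fin.
have Ff : Lpnorm p (cyl T setT) f \is a fin_num by apply: fin; rewrite Lnorm_ge0 in_Lp_fin.
have Df : vLpnorm p (cyl T setT) Du \is a fin_num.
  by apply: fin; rewrite Lnorm_ge0/=; exact: (vLpnorm_fin (ltW p1) LDu).
have Gf : vLpnorm p (cyl T setT) g \is a fin_num.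
  by apply: fin; rewrite Lnorm_ge0/=; exact: (vLpnorm_fin (ltW p1) Lg).
set X := Lpnorm p0 _ _.
set U := fine (Lpnorm p _ u); set V := fine (vLpnorm p _ Du).
set G := fine (vLpnorm p _ g); set F := fine (Lpnorm p _ f).
rewrite (_ : majnorm _ _ _ _ _ _ _ _ _ = (a * eps `^ (- (p^-1 - p0^-1) * Dm) * U +
  step_const (d := d) al * (scale_const (d := d) al (p^-1 - p0^-1) * eps `^ (1 - (p^-1 - p0^-1) * Dm) * (V + G) +
  scale_const (d := d) al (p^-1 - p0^-1) * eps `^ (2 - (p^-1 - p0^-1) * Dm) * F))%:E); last first.
  by rewrite -[Lpnorm p _ u](fineK Uf) -[Lpnorm p _ f](fineK Ff) -[vLpnorm p _ Du](fineK Df) -[vLpnorm p _ g](fineK Gf).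
rewrite -EFinM => hX.
have Xf : X \is a fin_num by rewrite ge0_fin_numE ?Lnorm_ge0// (le_lt_trans hX)// ltry.
split => //.
move: hX; rewrite -[X in (X <= _)%E](fineK Xf) lee_fin => hX; apply: le_trans hX _.
have -> : - (p^-1 - p0^-1) * Dm = q by ring.
have -> : 1 - (p^-1 - p0^-1) * Dm = 1 + q by ring.
have -> : 2 - (p^-1 - p0^-1) * Dm = 2 + q by ring.
have U0 : 0 <= U by rewrite fine_ge0// Lnorm_ge0.
have V0 : 0 <= V by rewrite fine_ge0// Lnorm_ge0.
have G0 : 0 <= G by rewrite fine_ge0// Lnorm_ge0.
have F0 : 0 <= F by rewrite fine_ge0// Lnorm_ge0.
have alg (c sc cc e1 e2 e3 : R) : 0 <= e1 -> 0 <= e2 -> 0 <= e3 -> 0 <= c -> 0 <= sc * cc ->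
    C * (c * e1 * U + sc * (cc * e2 * (V + G) + cc * e3 * F)) <=
    (C * (c + sc * cc) + 1) * e1 * U + (C * (c + sc * cc) + 1) * e3 * F +
    (C * (c + sc * cc) + 1) * e2 * (V + G).
  move=> h1 h2 h3 hc hs; set w := V + G.
  have w0 : 0 <= w by exact: addr_ge0.
  have k1 : 0 <= e1 * U by exact: mulr_ge0.
  have k2 : 0 <= e2 * w by exact: mulr_ge0.
  have k3 : 0 <= e3 * F by exact: mulr_ge0.
  rewrite -subr_ge0.
  have -> : (C * (c + sc * cc) + 1) * e1 * U + (C * (c + sc * cc) + 1) * e3 * F +
    (C * (c + sc * cc) + 1) * e2 * w - C * (c * e1 * U + sc * (cc * e2 * w + cc * e3 * F)) =
    (C * (sc * cc) + 1) * (e1 * U) + (C * c + 1) * (e3 * F) + (C * c + 1) * (e2 * w) by ring.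
  have C0' := ltW C0.
  by rewrite !addr_ge0// mulr_ge0// addr_ge0// mulr_ge0.
by apply: alg => //; exact: powR_ge0.
Qed.

End estimate.

Theorem theorem7p5 (R : realType) (d : nat) (al p p0 : R)
    (hd : (0 < d)%N) (hal : 0 < al < 1) (hp : 1 < p) (hp0 : 1 < p0)
    (hpp0 : p < p0)
    (hstar : 1 - (d%:R + 2 / al) / p >= - ((d%:R + 2 / al) / p0)) :
  exists N : R, 0 < N /\
  forall (T : R) (u : R * 'rV[R]_d -> R), 0 < T ->
  let RdT := cyl T [set: 'rV[R]_d] in
  let Du := wgrad p T [set: 'rV[R]_d] u in
  let q := (d%:R + 2 / al) / p0 - (d%:R + 2 / al) / p in
  H_al1_0 al p T [set: 'rV[R]_d] u ->
  (Lpnorm p0 RdT u <= N%:E * H_al1_norm al p T [set: 'rV[R]_d] u)%E /\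
  forall (g : R * 'rV[R]_d -> 'rV[R]_d) (f : R * 'rV[R]_d -> R),
    in_vLp p RdT g -> in_Lp p RdT f ->
    (forall phi, Cc_smooth (`[0, T[%classic `*` [set: 'rV[R]_d]) phi ->
      \int[lebesgue_tx]_(z in RdT) (frac_int al u z * D_t phi z) =
      \int[lebesgue_tx]_(z in RdT) (\sum_(i < d) g z ord0 i * D_x i phi z)
      - \int[lebesgue_tx]_(z in RdT) (f z * phi z)) ->
    (forall eps : R, 0 < eps ->
      (Lpnorm p0 RdT u <=
         N%:E * (eps `^ q)%:E * Lpnorm p RdT u
         + N%:E * (eps `^ (2 + q))%:E * Lpnorm p RdT f
         + N%:E * (eps `^ (1 + q))%:E
           * (vLpnorm p RdT Du + vLpnorm p RdT g))%E) /\
    (1 - (d%:R + 2 / al) / p = - ((d%:R + 2 / al) / p0) ->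
      (Lpnorm p0 RdT u <=
         N%:E * Lpnorm p RdT u `^ 2^-1 * Lpnorm p RdT f `^ 2^-1
         + N%:E * (vLpnorm p RdT Du + vLpnorm p RdT g))%E).
Proof.
have [N N0 hN] := scaled_estimate hal hp hpp0 hstar.
(* The factor 2 is the price of the multiplicative form: at the optimal eps two equal terms add
   up. *)
exists (2 * N); split; first exact: mulr_gt0.
move=> T u T0 RdT Du q [[Lu [G0 [LG0 wG0]] [g1 [f1 rep1]]] _].
(* [wgrad] is a choice with default value 0; membership in the solution space supplies a witness, so
   the choice is a genuine weak gradient in L_p. *)
have [LDu wDu] : in_vLp p RdT Du /\ weak_gradient T [set: 'rV[R]_d] u Du.
  exact: (@xgetPex _ (fun=> 0) [set g | in_vLp p RdT g /\ weak_gradient T [set: 'rV[R]_d] u g]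
    (ex_intro _ G0 (conj LG0 wG0))).
have fin F : in_Lp p RdT F -> Lpnorm p RdT F \is a fin_num.
  by move=> LF; rewrite ge0_fin_numE ?Lnorm_ge0//; exact: in_Lp_fin.
have vfin G : in_vLp p RdT G -> vLpnorm p RdT G \is a fin_num.
  by move=> LG; rewrite ge0_fin_numE ?Lnorm_ge0//; exact: (vLpnorm_fin (ltW hp) LG).
have f0 F : 0 <= fine (Lpnorm p RdT F) by rewrite fine_ge0// Lnorm_ge0.
have vf0 G : 0 <= fine (vLpnorm p RdT G) by rewrite fine_ge0// Lnorm_ge0.
have Uf := fin _ Lu; have Vf := vfin _ LDu.
have le2 (w : R) : 0 <= w -> N * w <= 2 * N * w.
  by move=> w0; apply: ler_wpM2r => //; rewrite ler_pMl// ler1n.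
split.
  (* The estimate at eps = 1, solved for the norms of the representative: the left side no longer
     mentions g and f, so it bounds the infimum in [Hm1_norm] from below. *)
  have key g f : Hm1_rep p T [set: 'rV[R]_d] (Dt_frac al T [set: 'rV[R]_d] u) g f ->
      (((fine (Lpnorm p0 RdT u) / (2 * N) - (fine (Lpnorm p RdT u) + fine (vLpnorm p RdT Du)))%:E <=
        \sum_(i < d) Lpnorm p RdT (fun z => g z ord0 i) + Lpnorm p RdT f)%E /\
       Lpnorm p0 RdT u \is a fin_num).
    move=> rep; have [Lg Lf _] := rep.
    have [Xf] := hN _ _ _ _ _ T0 Lu Lf LDu Lg wDu (weak_frac_Hm1_rep rep) _ ltr01.
    rewrite !powR1 !mulr1 => hX; split => //.
    apply: (@le_trans _ _ (vLpnorm p RdT g + Lpnorm p RdT f)%E); last first.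
      by rewrite leeD2r//; exact: (vLpnorm_le_sum (ltW hp) Lg).
    rewrite -(fineK (vfin _ Lg)) -(fineK (fin _ Lf)) -EFinD lee_fin lerBlDr.
    rewrite ler_pdivrMr ?mulr_gt0//; apply: le_trans hX _.
    rewrite -!mulrDr [leRHS]mulrC; apply: le_trans (le2 _ _) _; last first.
      by rewrite ler_wpM2l ?mulr_ge0 ?(ltW N0)//; lra.
    by rewrite !addr_ge0.
  have [_ Xf] := key _ _ rep1.
  rewrite /H_al1_norm -/RdT -/Du.
  set Y := Hm1_norm _ _ _ _.
  have hY : ((fine (Lpnorm p0 RdT u) / (2 * N) - (fine (Lpnorm p RdT u) + fine (vLpnorm p RdT Du)))%:E <= Y)%E.
    by apply: le_ereal_inf_tmp => _ [g [f [rep ->]]]; have [] := key _ _ rep.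
  have := lee_wpmul2l (_ : 0 <= (2 * N)%:E)%E (leeD2l (Lpnorm p RdT u + vLpnorm p RdT Du)%E hY).
  move=> /(_ _) h; apply: le_trans (h _); last by rewrite lee_fin mulr_ge0// ltW.
  have e (x y z : R) : ((2 * N)%:E * (y%:E + z%:E + (x / (2 * N) - (y + z))%:E) = x%:E)%E.
    by rewrite -!EFinD -EFinM; congr (_%:E); field; rewrite gt_eqF.
  have := e (fine (Lpnorm p0 RdT u)) (fine (Lpnorm p RdT u)) (fine (vLpnorm p RdT Du)).
  by rewrite (fineK Uf) (fineK Vf) (fineK Xf) => ->.
move=> g f Lg Lf hw.
have est := hN _ _ _ _ _ T0 Lu Lf LDu Lg wDu (fun phi hphi _ _ => hw phi hphi).
have [Xf _] := est _ ltr01.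
have Gf := vfin _ Lg; have Ff := fin _ Lf.
split.
  move=> eps e0; have [_] := est _ e0.
  rewrite -(fineK Xf) -(fineK Uf) -(fineK Ff) -(fineK Vf) -(fineK Gf) /=.
  rewrite -/q -!EFinM -!EFinD lee_fin => h; apply: le_trans h _.
  have le3 (a b : R) : 0 <= a -> 0 <= b -> N * a * b <= 2 * N * a * b.
    by move=> a0 b0; rewrite -[leLHS]mulrA -[leRHS]mulrA le2// mulr_ge0.
  apply: lerD; last by rewrite le3 ?powR_ge0// addr_ge0.
  by apply: lerD; rewrite le3 ?powR_ge0.
(* With q = -1 the three powers of eps become -1, 1 and 0, the shape required by
   [le_scaling_optimum]. *)
move=> hq; have q1 : q = -1 by rewrite /q; lra.
rewrite -(fineK Xf) -(fineK Uf) -(fineK Ff) -(fineK Vf) -(fineK Gf) /=.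
rewrite -!EFinM -!EFinD lee_fin.
apply: (le_trans (le_scaling_optimum N0 (f0 u) (f0 f) _)); last first.
  by rewrite !powR12_sqrt// lerD2l; apply: le2; exact: addr_ge0.
move=> eps e0; have [_] := est _ e0; rewrite -/q q1.
have -> : 2 + -1 = 1 :> R by ring.
rewrite subrr powRr0 powRr1 ?(ltW e0)// powR_inv1 ?(ltW e0)// mulr1.
by [].
Qed.
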